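(* Let $\Lambda$ and $\Gamma$ be two finite dimensional algebras which are related by a 1-APR tilt. Then their posets of torsion classes $\mathrm{tors}\,\Lambda$ and $\mathrm{tors}\,\Gamma$ are related by a flip-flop.
   Context: Fix a field $k$. All algebras are basic and finite dimensional over $k$; $\mathrm{mod}\,\Lambda$ is the category of finitely generated right $\Lambda$-modules. A subcategory always means a full subcategory closed under isomorphisms, finite direct sums and direct summands. Torsion classes: a torsion pair in $\mathrm{mod}\,\Lambda$ is a pair $(\mathcal T,\mathcal F)$ of subcategories with $\mathrm{Hom}_\Lambda(\mathcal T,\mathcal F)=0$ such that every $X\in\mathrm{mod}\,\Lambda$ fits in a short exact sequence $0\to tX\to X\to fX\to 0$ with $tX\in\mathcal T$, $fX\in\mathcal F$; then $\mathcal T$ is called a torsion class. $\mathrm{tors}\,\Lambda$ is the set of torsion classes of $\mathrm{mod}\,\Lambda$, partially ordered by inclusion. 1-APR tilt: let $P$ be a simple projective $\Lambda$-module of injective dimension exactly $1$, and write $\Lambda=P\oplus R$ as $\Lambda$-modules. The module $T=\tau^{-1}P\oplus R$ (with $\tau^{-1}$ the inverse Auslander--Reiten translation of $\mathrm{mod}\,\Lambda$) is called a 1-APR tilting module, and $\Gamma=\mathrm{End}_\Lambda(T)$ is called a 1-APR tilt of $\Lambda$. Two algebras $\Lambda,\Gamma$ are related by a 1-APR tilt if $\Gamma\simeq\mathrm{End}_\Lambda(T)$ for such a $P$ and $T$. Flip-flop: let $(X,\leq_X)$, $(Y,\leq_Y)$ be posets and $f:X\to Y$ an order-preserving map. Define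 two partial orders $\leq^f_+$ and $\leq^f_-$ on $X\sqcup Y$: both restrict to $\leq_X$ on $X$ and to $\leq_Y$ on $Y$; for $x\in X$, $y\in Y$, $x\leq^f_+y\iff f(x)\leq_Y y$, and $y\leq^f_-x\iff y\leq_Y f(x)$; there are no other relations. Two posets $Z,Z'$ are related by a flip-flop if there exist $X,Y,f$ such that one of them is isomorphic to $(X\sqcup Y,\leq^f_+)$ and the other to $(X\sqcup Y,\leq^f_-)$. *)

(* Defs.v *)
From HB Require Import structures.
From mathcomp Require Import all_boot all_order all_algebra all_field.
From mathcomp Require Import boolp.
From Stdlib Require Import Relation_Definitions.

Set Implicit Arguments.
Unset Strict Implicit.
Unset Printing Implicit Defensive.

Import GRing.Theory.
Local Open Scope ring_scope.

(* A right module over an algebra A is an [lmodType A^c], a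
   left module over the converse ring A^c; so the notions below are stated for
   left modules over a ring R and used both with R := A^c (right A-modules)
   and R := A (left A-modules). *)

Definition surj (U V : Type) (f : U -> V) : Prop := forall v, exists u, f u = v.

Definition finitely_generated (R : nzRingType) (M : lmodType R) : Prop :=
  exists (n : nat) (g : 'I_n -> M),
    forall x : M, exists c : 'I_n -> R, x = \sum_i c i *: g i.

Record fgmod (R : nzRingType) := Fgmod {
  fgmod_sort :> lmodType R;
  fgmodP : finitely_generated fgmod_sort
}.

Section Constructions.
Variable R : nzRingType.

Lemma fg_regular : finitely_generated (R^o : lmodType R).
Proof.
exists 1%N, (fun=> 1) => x; exists (fun=> x).
by rewrite big_ord1 /GRing.scale /= mulr1.
Qed.

Lemma fg_zero : finitely_generated ('rV[R]_0 : lmodType R).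
Proof.
exists 0%N, (fun=> 0) => x; exists (fun=> 0).
by rewrite big_ord0 [x]thinmx0.
Qed.

Lemma fg_prod (M N : fgmod R) :
  finitely_generated ((M * N)%type : lmodType R).
Proof.
case: M N => [M [m [g Hg]]] [N [n [h Hh]]] /=.
exists (m + n)%N, (fun i => match split i with
                            | inl i => (g i, 0) | inr j => (0, h j) end).
case=> x y; have [c ->] := Hg x; have [d ->] := Hh y.
exists (fun i => match split i with inl i => c i | inr j => d j end).
have scaleE (a : R) (u : M) (v : N) : a *: (u, v) = (a *: u, a *: v) by [].
rewrite big_split_ord /=.
have splitl i : split (lshift n i) = inl i := unsplitK (inl i : 'I_m + 'I_n).
have splitr i : split (rshift m i) = inr i := unsplitK (inr i : 'I_m + 'I_n).
under [X in _ = X + _]eq_bigr => i _ do rewrite splitl scaleE scaler0.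
under [X in _ = _ + X]eq_bigr => i _ do rewrite splitr scaleE scaler0.
have pairE (I : finType) (F : I -> M * N) :
    \sum_i F i = (\sum_i (F i).1, \sum_i (F i).2).
  by elim/big_rec3: _ => // i u v [w1 w2] _ [-> ->].
rewrite !pairE /= !big1_eq.
by apply: injective_projections; rewrite /= ?addr0 ?add0r.
Qed.

Definition regular_module : fgmod R := Fgmod fg_regular.
Definition zero_module : fgmod R := Fgmod fg_zero.
Definition dsum (M N : fgmod R) : fgmod R := Fgmod (fg_prod M N).

End Constructions.

Section ModuleCategory.
Variable R : nzRingType.
Implicit Types M N L P I : fgmod R.

Definition mod_iso M N : Prop := exists f : {linear M -> N}, bijective f.

Definition is_zero M : Prop := forall x : M, x = 0.

Definition exact_at M N L (f : {linear M -> N}) (g : {linear N -> L}) : Prop :=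
  forall y, g y = 0 <-> exists x, f x = y.

Definition short_exact M N L
    (f : {linear M -> N}) (g : {linear N -> L}) : Prop :=
  [/\ injective f, exact_at f g & surj g].

(* Submodules are boolean predicates satisfying [submod_closed]; classically
   these are all the submodules. *)
Definition simple_module M : Prop :=
  ~ is_zero M /\
  forall S : {pred M}, submod_closed S ->
    (forall x, x \in S -> x = 0) \/ (forall x, x \in S).

Definition indecomposable M : Prop :=
  ~ is_zero M /\
  forall N L, mod_iso M (dsum N L) -> is_zero N \/ is_zero L.

Definition projective_module P : Prop :=
  forall M N (g : {linear M -> N}) (h : {linear P -> N}),
    surj g -> exists f : {linear P -> M}, forall x, g (f x) = h x.

Definition injective_module I : Prop :=
  forall M N (g : {linear M -> N}) (h : {linear M -> I}),
    injective g -> exists f : {linear N -> I}, forall x, f (g x) = h x.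

(* There is an injective resolution 0 -> M -> I_0 -> ... -> I_n -> 0. *)
Fixpoint injdim_le (n : nat) (M : fgmod R) : Prop :=
  match n with
  | 0%N => injective_module M
  | n'.+1 => exists (I N : fgmod R) (f : {linear M -> I}) (g : {linear I -> N}),
      [/\ injective_module I, short_exact f g & injdim_le n' N]
  end.

Definition injdim_eq1 M : Prop := injdim_le 1 M /\ ~ injdim_le 0 M.

Definition superfluous_kernel M N (f : {linear M -> N}) : Prop :=
  forall S : {pred M}, submod_closed S ->
    (forall x, exists y z, [/\ y \in S, f z = 0 & x = y + z]) ->
    forall x, x \in S.

(* P1 -> P0 -> M -> 0 is exact, and P0 -> M and P1 -> ker p0 are projective
   covers. *)
Definition minimal_projective_presentation M P1 P0
    (p1 : {linear P1 -> P0}) (p0 : {linear P0 -> M}) : Prop :=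
  [/\ projective_module P1 /\ projective_module P0,
      surj p0, exact_at p1 p0, superfluous_kernel p0 & superfluous_kernel p1].

(* N is isomorphic to Tr M, the cokernel of Hom(p1, R) : Hom(P0, R) ->
   Hom(P1, R); the right action on Hom(P1, R) is (phi . a)(x) = phi(x) a. *)
Definition is_transpose M (N : fgmod R^c) : Prop :=
  exists (P1 P0 : fgmod R) (p1 : {linear P1 -> P0}) (p0 : {linear P0 -> M}),
    minimal_projective_presentation p1 p0 /\
    exists pr : {linear P1 -> R^o} -> N,
      [/\ forall (a : R) (phi1 phi2 phi3 : {linear P1 -> R^o}),
            (forall x, phi3 x = phi1 x * a + phi2 x) ->
            pr phi3 = (a : R^c) *: pr phi1 + pr phi2,
          surj pr
        & forall phi, pr phi = 0 <->
            exists psi : {linear P0 -> R^o}, forall x, phi x = psi (p1 x)].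

Definition subcategory (C : fgmod R -> Prop) : Prop :=
  [/\ forall M N, mod_iso M N -> C M -> C N,
      C (zero_module R),
      forall M N, C M -> C N -> C (dsum M N)
    & forall M N, C (dsum M N) -> C M /\ C N].

Definition torsion_pair (T F : fgmod R -> Prop) : Prop :=
  [/\ subcategory T, subcategory F,
      forall M N (f : {linear M -> N}), T M -> F N -> forall x, f x = 0
    & forall X : fgmod R, exists (tX fX : fgmod R)
        (i : {linear tX -> X}) (p : {linear X -> fX}),
        [/\ T tX, F fX & short_exact i p]].

Definition is_torsion_class (T : fgmod R -> Prop) : Prop :=
  exists F, torsion_pair T F.

End ModuleCategory.

Section Algebras.
Variables (k : fieldType) (A : falgType k).

Definition rmod := fgmod A^c.

(* A_A is a finite direct sum of pairwise non-isomorphic indecomposables. *)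
Definition basic_algebra : Prop :=
  exists s : seq rmod,
    [/\ mod_iso (regular_module A^c) (foldr (@dsum A^c) (zero_module A^c) s),
        forall i, (i < size s)%N -> indecomposable (nth (zero_module A^c) s i)
      & forall i j, (i < j < size s)%N ->
          ~ mod_iso (nth (zero_module A^c) s i) (nth (zero_module A^c) s j)].

Definition klinear_form (M : rmod) (g : M -> k) : Prop :=
  forall (c : k) (x y : M), g ((c%:A : A^c) *: x + y) = c * g x + g y.

(* N is isomorphic to DM = Hom_k(M, k), with left action (a g)(x) = g(x a). *)
Definition is_dual (M : rmod) (N : fgmod A) : Prop :=
  exists delta : N -> M -> k,
    [/\ forall n, klinear_form (delta n),
        forall (a : A) (n n' : N) (x : M),
          delta (a *: n + n') x = delta n ((a : A^c) *: x) + delta n' x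
      & forall g, klinear_form g -> exists! n, forall x, delta n x = g x].

(* N is isomorphic to Tr D M. *)
Definition is_tau_inv (M N : rmod) : Prop :=
  exists DM : fgmod A, is_dual M DM /\ is_transpose DM N.

(* G is isomorphic as a k-algebra to End_A(T), whose product is composition. *)
Definition iso_End (G : falgType k) (T : rmod) : Prop :=
  exists phi : G -> {linear T -> T},
    [/\ forall x, phi 1 x = x,
        forall a b x, phi (a * b) x = phi a (phi b x),
        forall (c : k) a b x,
          phi (c *: a + b) x = (c%:A : A^c) *: phi a x + phi b x,
        forall a b, (forall x, phi a x = phi b x) -> a = b
      & forall f : {linear T -> T}, exists a, forall x, phi a x = f x].

End Algebras.

Definition related_by_1APR_tilt (k : fieldType) (A G : falgType k) : Prop :=
  exists P Q tauP : rmod A,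
    [/\ simple_module P /\ projective_module P,
        injdim_eq1 P,
        mod_iso (regular_module A^c) (dsum P Q),
        is_tau_inv P tauP
      & iso_End G (dsum tauP Q)].

Record poset := Poset {
  poset_sort :> Type;
  ple : relation poset_sort;
  ple_order : order poset_sort ple
}.

Definition poset_iso (Z Z' : poset) : Prop :=
  exists g : Z -> Z', bijective g /\ forall u v, ple u v <-> ple (g u) (g v).

Section FlipFlop.
Variables (X Y : poset) (f : X -> Y).

Definition le_plus : relation (X + Y) := fun u v =>
  match u, v with
  | inl x, inl x' => ple x x'
  | inr y, inr y' => ple y y'
  | inl x, inr y => ple (f x) y
  | inr _, inl _ => False
  end.

Definition le_minus : relation (X + Y) := fun u v =>
  match u, v with
  | inl x, inl x' => ple x x'
  | inr y, inr y' => ple y y'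
  | inr y, inl x => ple y (f x)
  | inl _, inr _ => False
  end.

Definition order_preserving : Prop := forall x x', ple x x' -> ple (f x) (f x').

Lemma le_plus_order : order_preserving -> order (X + Y)%type le_plus.
Proof.
move=> f_mono.
case: (ple_order X) (ple_order Y) => rX tX aX [rY tY aY].
split; first by case.
- move=> [x|y] [x'|y'] [x''|y''] //=; try exact: tX; try exact: tY.
  by move=> /f_mono; apply: tY.
- by move=> [x|y] [x'|y'] //= ? ?; congr (_ _); [apply: aX | apply: aY].
Qed.

Lemma le_minus_order : order_preserving -> order (X + Y)%type le_minus.
Proof.
move=> f_mono.
case: (ple_order X) (ple_order Y) => rX tX aX [rY tY aY].
split; first by case.
- move=> [x|y] [x'|y'] [x''|y''] //=; try exact: tX; try exact: tY.
  by move=> h /f_mono; apply: tY.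
- by move=> [x|y] [x'|y'] //= ? ?; congr (_ _); [apply: aX | apply: aY].
Qed.

Definition poset_plus (f_mono : order_preserving) : poset :=
  Poset (le_plus_order f_mono).
Definition poset_minus (f_mono : order_preserving) : poset :=
  Poset (le_minus_order f_mono).

End FlipFlop.

Definition related_by_flip_flop (Z Z' : poset) : Prop :=
  exists (X Y : poset) (f : X -> Y) (f_mono : order_preserving f),
    (poset_iso Z (poset_plus f_mono) /\ poset_iso Z' (poset_minus f_mono)) \/
    (poset_iso Z' (poset_plus f_mono) /\ poset_iso Z (poset_minus f_mono)).

Section Tors.
Variables (k : fieldType) (A : falgType k).

Record torsion_class := TorsionClass {
  tc_mem :> rmod A -> Prop;
  tcP : is_torsion_class tc_mem
}.

Definition tors_le : relation torsion_class :=
  fun T U => forall M : rmod A, T M -> U M.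

Lemma tors_le_order : order torsion_class tors_le.
Proof.
split=> [T M //|T U V TU UV M /TU /UV //|[T pT] [U pU] TU UT].
have E : T = U by apply/funext => M; apply/propext; split=> [/TU|/UT].
by case: _ / E pU {TU UT} => pU; congr TorsionClass; apply: Prop_irrelevance.
Qed.

Definition tors : poset := Poset tors_le_order.

End Tors.

(* Main.v *)
Require Import Defs.
From HB Require Import structures.
From mathcomp Require Import all_boot all_order all_algebra all_field.
From mathcomp Require Import boolp.
From Stdlib Require Import Relation_Definitions.

(** Write A for Lambda, G for Gamma and T for the tilting module, the direct
    sum of N = tau^-1 P and Q.  A torsion class of a module category of
    finite length is a class of the form {M | Hom(M, W) = 0 for all W in some
    class}, so the poset of torsion classes only depends on the relation
    Hom(M, M') = 0; it is the concept lattice of that relation.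

    The projection of A onto P is an idempotent p with complement e, and
    Hom(Q, P) = 0 because A is basic and P is simple projective, so pAe = 0
    and A is triangular with corners eAe and pAp.  On the other side
    Hom(N, Q) = 0 because P has injective dimension at most 1, so G is
    triangular as well, with corners fGf = End(Q) = eAe and
    qGq = End(N), which is a division ring.  Hence G has a simple injective
    module S, the top of qG.  Three comparisons follow.

    - Every torsion class of A that does not contain P lies in
      calT = {M | Hom(M, P) = 0}, and every torsion class of G that contains S
      is determined by its trace on calY = {Y | Hom(S, Y) = 0}.  The functor
      Hom(T, -) is an equivalence from calT to calY.
    - Every torsion class of A that contains P is determined by its trace on
      calP = {M | Hom(P, M) = 0}, and every torsion class of G that does not
      contain S lies in calS = {Z | Hom(Z, S) = 0}.  Both calP and calS are
      the category of modules over the common corner eAe = fGf.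
    - For M in calT the modules M e and Hom(T, M) f over that corner agree.

    So, with X the torsion classes of A containing P and Y those not
    containing P, both posets of torsion classes have X and Y as pieces.  For
    A the piece Y lies below X, and y <= x exactly when y lies in the
    intersection of x with calT.  For G the piece X lies below Y, and the last
    comparison shows that x <= y exactly when that same intersection lies in
    y.  This is the flip-flop along x |-> x /\ calT.

    The order-theoretic part is [flip_flop_of_contexts], for two arbitrary
    relations; only the vanishing of Hom matters there, so the equivalences
    above enter as correspondences between objects ([hom_iso] and
    [corner_iso]) that are total on both sides and respect vanishing of Hom.
    Both correspondences are studied from the description of T by generators
    and relations recorded in [reflection_data], which
    [reflection_data_exists] extracts from the minimal projective presentation
    of the dual of P.  The injective dimension enters through
    [injective_presentation_of_injdim1]: the first map of that presentation is
    injective. *)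

Set Implicit Arguments.
Unset Strict Implicit.
Unset Printing Implicit Defensive.

Import GRing.Theory.
Local Open Scope ring_scope.

(** * Linear maps and submodules *)

Section LinearMaps.
Variable R : nzRingType.

Lemma linear_exists (M N : lmodType R) (f : M -> N) :
  linear f -> exists g : {linear M -> N}, forall x, g x = f x.
Proof.
move=> fL; pose mx := GRing.isLinear.Build R M N *:%R f fL.
pose F : {linear M -> N} := HB.pack f mx.
by exists F.
Qed.

Definition submodule (M : lmodType R) (S : M -> Prop) :=
  S 0 /\ forall a x y, S x -> S y -> S (a *: x + y).

Section Submodule.
Variables (M : lmodType R) (S : M -> Prop).
Hypothesis S_sub : submodule S.

Lemma submodule0 : S 0. Proof. by case: S_sub. Qed.
Lemma submoduleZ a x : S x -> S (a *: x).
Proof. by case: S_sub => S0 SL Sx; rewrite -[_ *: _]addr0; apply: SL. Qed.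
Lemma submoduleD x y : S x -> S y -> S (x + y).
Proof. by case: S_sub => S0 SL Sx Sy; rewrite -[x]scale1r; apply: SL. Qed.
Lemma submoduleN x : S x -> S (- x).
Proof. by move=> Sx; rewrite -scaleN1r; apply: submoduleZ. Qed.
Lemma submodule_sum (I : Type) (r : seq I) (P : pred I) (F : I -> M) :
  (forall i, P i -> S (F i)) -> S (\sum_(i <- r | P i) F i).
Proof.
move=> SF; elim/big_rec: _ => [|i x Pi Sx]; first exact: submodule0.
exact: submoduleD (SF i Pi) Sx.
Qed.

Lemma submodule_closed : submod_closed (fun x : M => `[< S x >]).
Proof.
split=> [|a x y /asboolP Sx /asboolP Sy]; apply/asboolP; first exact: submodule0.
by apply: submoduleD => //; apply: submoduleZ.
Qed.
End Submodule.

(** Most linear maps below are given on generators; checking that the generated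
    submodule of the product is the graph of a map replaces the verification of
    well-definedness and of linearity. *)
Lemma linear_of_graph (M N : lmodType R) (G : M -> N -> Prop) :
  (forall x, exists y, G x y) ->
  (forall a x y x' y', G x y -> G x' y' -> G (a *: x + x') (a *: y + y')) ->
  (forall y, G 0 y -> y = 0) ->
  exists f : {linear M -> N}, forall x y, G x y <-> y = f x.
Proof.
move=> Gtot GL G0; have [f Gf] := choice Gtot.
have GU x y y' : G x y -> G x y' -> y = y'.
  move=> Gy Gy'; apply/eqP; rewrite -subr_eq0; apply/eqP/G0.
  by have := GL (-1) _ _ _ _ Gy' Gy; rewrite !scaleN1r addNr addrC.
have fL : linear f by move=> a x y; apply: GU (Gf _) _; apply: GL.
have [g gE] := linear_exists fL.
exists g => x y; rewrite gE; split=> [Gy|->] //; exact: GU Gy (Gf x).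
Qed.

Lemma factor_surj (M N L : lmodType R) (p : {linear M -> N})
    (f : {linear M -> L}) :
  surj p -> (forall x, p x = 0 -> f x = 0) ->
  exists g : {linear N -> L}, forall x, g (p x) = f x.
Proof.
move=> pS kfp; pose G y z := exists x, p x = y /\ f x = z.
have [||y [x [px fx]]|g gE] := @linear_of_graph N L G.
- by move=> y; have [x px] := pS y; exists (f x), x.
- move=> a _ _ _ _ [x [<- <-]] [y [<- <-]]; exists (a *: x + y).
  by rewrite !linearP.
- by rewrite -fx kfp.
by exists g => x; apply/esym/gE; exists x.
Qed.

Lemma factor_inj (M N L : lmodType R) (i : {linear N -> L})
    (f : {linear M -> L}) :
  injective i -> (forall x, exists y, i y = f x) ->
  exists g : {linear M -> N}, forall x, i (g x) = f x.
Proof.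
move=> iI imf; pose G x y := i y = f x.
have [||y|g gE] := @linear_of_graph M N G.
- exact: imf.
- by move=> a x y x' y' iy iy'; rewrite /G !linearP iy iy'.
- by rewrite /G linear0 => iy; apply: iI; rewrite linear0.
by exists g => x; apply/gE.
Qed.

Lemma bij_linear_inv (M N : lmodType R) (f : {linear M -> N}) :
  injective f -> surj f ->
  exists g : {linear N -> M}, cancel f g /\ cancel g f.
Proof.
move=> fI fS.
have [g gE] := @factor_inj N M N f idfun fI (fun y => fS y).
by exists g; split=> x; [apply: fI|]; rewrite gE.
Qed.

Lemma mod_iso_bij (M N : fgmod R) (f : {linear M -> N}) :
  injective f -> surj f -> mod_iso M N.
Proof.
by move=> fI fS; have [g [fK gK]] := bij_linear_inv fI fS; exists f, g.
Qed.

Lemma mod_iso_inj_surj (M N : fgmod R) :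
  mod_iso M N -> exists f : {linear M -> N}, injective f /\ surj f.
Proof. by case=> f [g fK gK]; exists f; split=> [|y]; [exact: can_inj fK|exists (g y)]. Qed.

End LinearMaps.

(** * Modules of functions *)

Section FunctionModule.
Variables (R : nzRingType) (X : Type) (V : zmodType).
Variables (act : R -> X -> X) (K : (X -> V) -> Prop).
Hypothesis K0 : K (fun=> 0).
Hypothesis KB : forall f g, K f -> K g -> K (fun x => f x - g x).
Hypothesis KZ : forall a f, K f -> K (fun x => f (act a x)).
Hypothesis actD : forall f a b x, K f ->
  f (act (a + b) x) = f (act a x) + f (act b x).
Hypothesis actM : forall f a b x, K f -> f (act (a * b) x) = f (act b (act a x)).
Hypothesis act1 : forall f x, K f -> f (act 1 x) = f x.

Local Notation H := {f : X -> V | K f}.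
Let ev (h : H) : X -> V := sval h.

Let ev_inj (h h' : H) : (forall x, ev h x = ev h' x) -> h = h'.
Proof. by move=> E; apply: eq_sig_hprop => [f|]; [exact: Prop_irrelevance | exact/funext]. Qed.

Let h0 : H := exist K _ K0.
Let hB (f g : H) : H := exist K _ (KB (svalP f) (svalP g)).
Let hN f := hB h0 f.
Let hD f g := hB f (hN g).
Let hZ a (f : H) : H := exist K _ (KZ a (svalP f)).

(** Both the k-dual of a left module and Hom(T, M) are groups of functions with
    scalars acting by precomposition; this is their common construction, and
    [act] reverses products, so that a right action on the argument becomes a
    left action on functions. *)
Lemma function_module :
  exists (N : lmodType R) (ev : N -> X -> V),
  [/\ forall h h', (forall x, ev h x = ev h' x) -> h = h',
      forall f, K f <-> exists h, forall x, ev h x = f x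
    & forall a h h' x, ev (a *: h + h') x = ev h (act a x) + ev h' x].
Proof.
have DA : associative hD.
  by move=> f g h; apply: ev_inj => x /=; rewrite !sub0r !opprK addrA.
have DC : commutative hD.
  by move=> f g; apply: ev_inj => x /=; rewrite !sub0r !opprK addrC.
have D0 : left_id h0 hD.
  by move=> f; apply: ev_inj => x /=; rewrite !sub0r !opprK.
have DN : left_inverse h0 hN hD.
  by move=> f; apply: ev_inj => x /=; rewrite !sub0r !opprK addNr.
pose Hc : choiceType := HB.pack H (gen_eqMixin H) (gen_choiceMixin H).
pose Hz : zmodType := HB.pack H (Choice.on Hc)
  (GRing.isZmodule.Build Hc DA DC D0 DN).
have ZA a b (v : Hz) : hZ a (hZ b v) = hZ (a * b) v.
  by apply: ev_inj => x /=; rewrite (actM _ _ _ (svalP v)).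
have Z1 : left_id 1 (hZ : R -> Hz -> Hz).
  by move=> v; apply: ev_inj => x /=; rewrite (act1 _ (svalP v)).
have ZDr : right_distributive (hZ : R -> Hz -> Hz) +%R.
  by move=> a f g; apply: ev_inj => x.
have ZDl (v : Hz) : {morph (hZ : R -> Hz -> Hz)^~ v : a b / a + b}.
  move=> a b; apply: ev_inj => x /=.
  by rewrite (actD _ _ _ (svalP v)) sub0r opprK.
pose Hl : lmodType R := HB.pack H (GRing.Zmodule.on Hz)
  (GRing.Zmodule_isLmodule.Build R Hz ZA Z1 ZDr ZDl).
exists Hl, ev; split=> //.
- move=> f; split=> [Kf|[h hf]]; first by exists (exist K f Kf).
  by have <- : ev h = f; [apply/funext | exact: svalP h].
- by move=> a h h' x /=; rewrite sub0r opprK.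
Qed.

End FunctionModule.

(** * Finite-dimensional modules *)

(** A family of generators of minimal length admits no relation with an
    invertible coefficient, since the corresponding generator could be
    dropped.  Over a division ring this says that it is a basis. *)
Lemma minimal_generators (R : nzRingType) (M : lmodType R) :
  finitely_generated M ->
  exists (n : nat) (g : 'I_n -> M),
    (forall x, exists c : 'I_n -> R, x = \sum_i c i *: g i) /\
    forall (c : 'I_n -> R) j, \sum_i c i *: g i = 0 ->
      ~ exists r, forall x : M, r *: (c j *: x) = x.
Proof.
pose spans n (g : 'I_n -> M) := forall x, exists c : 'I_n -> R, x = \sum_i c i *: g i.
move=> fgM; have exn : exists n, `[< exists g : 'I_n -> M, spans n g >].
  by case: fgM => n [g Hg]; exists n; apply/asboolP; exists g.
case: (ex_minnP exn) => n /asboolP[g gS] nmin; exists n, g; split=> // c j c0 [r rc].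
case: n g gS nmin c j c0 rc => [|n] g gS nmin c j; first by case: j.
move=> c0 rc; suff: (n.+1 <= n)%N by rewrite ltnn.
apply: nmin; apply/asboolP; exists (fun i => g (lift j i)) => x.
have [d ->] := gS x.
exists (fun i => d (lift j i) - d j * r * c (lift j i)).
rewrite (bigD1_ord j) //= -[g j]rc.
have -> : c j *: g j = - \sum_i c (lift j i) *: g (lift j i).
  by move: c0; rewrite (bigD1_ord j) //= => /eqP; rewrite addr_eq0 => /eqP.
rewrite !scalerN addrC scalerA scaler_sumr -sumrB; apply: eq_bigr => i _.
by rewrite scalerBl scalerA.
Qed.

(** The same group, seen as a vector space through s.  The ring map is a
    parameter of the type only to let the scalar action be inferred. *)
Definition restr (k : fieldType) (R : nzRingType) (s : {rmorphism k -> R})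
  (M : lmodType R) : Type := M.

Section Restrict.
Variables (k : fieldType) (R : nzRingType) (s : {rmorphism k -> R}).

Section Module.
Variable M : lmodType R.
HB.instance Definition _ := GRing.Zmodule.on (restr s M).
Let rscale (c : k) (x : restr s M) : restr s M := s c *: (x : M).
Let rscaleA a b (v : restr s M) : rscale a (rscale b v) = rscale (a * b) v.
Proof. by rewrite /rscale scalerA rmorphM. Qed.
Let rscale1 : left_id 1 rscale.
Proof. by move=> v; rewrite /rscale rmorph1 scale1r. Qed.
Let rscaleDr : right_distributive rscale +%R.
Proof. by move=> a u v; apply: scalerDr. Qed.
Let rscaleDl (v : restr s M) : {morph rscale^~ v : a b / a + b}.
Proof. by move=> a b; rewrite /rscale rmorphD scalerDl. Qed.
HB.instance Definition _ :=
  GRing.Zmodule_isLmodule.Build k (restr s M) rscaleA rscale1 rscaleDr rscaleDl.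
End Module.

Lemma restrZ (M : lmodType R) (c : k) (x : restr s M) : c *: x = s c *: (x : M) :> M.
Proof. by []. Qed.

Lemma restr_linear (M N : lmodType R) (f : {linear M -> N}) :
  linear (f : restr s M -> restr s N).
Proof. by move=> c x y; rewrite restrZ linearP. Qed.

End Restrict.

Lemma coordinates (k : fieldType) (M : lmodType k) : finitely_generated M ->
  exists (n : nat) (v : {linear M -> 'rV[k]_n}) (u : {linear 'rV[k]_n -> M}),
    cancel v u /\ cancel u v.
Proof.
case/minimal_generators=> n [g [gS gI]].
have uL : linear (fun c : 'rV[k]_n => \sum_i c 0 i *: g i).
  move=> a c d; rewrite scaler_sumr -big_split; apply: eq_bigr => i _ /=.
  by rewrite !mxE scalerDl scalerA.
have [u uE] := linear_exists uL.
have uI : injective u.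
  move=> c d /eqP; rewrite -subr_eq0 -linearB uE => /eqP cd0.
  apply/eqP; rewrite -subr_eq0; apply/eqP/rowP => j; rewrite [RHS]mxE.
  apply/eqP/negP => /negP cdj; apply: (gI _ j cd0).
  by exists ((c - d) 0 j)^-1 => x; rewrite scalerA mulVf // scale1r.
have uS : surj u.
  by move=> x; have [c ->] := gS x; exists (\row_i c i); rewrite uE;
    apply: eq_bigr => i _; rewrite mxE.
by have [v [uK vK]] := bij_linear_inv uI uS; exists n, v, u.
Qed.

Section FiniteDimension.
Variable k : fieldType.
Implicit Types M N : lmodType k.

(** Choose finitely many vectors whose images span a subspace of maximal rank:
    they generate, because adding a vector cannot increase the rank. *)
Lemma fg_submodule_rV M n (f : {linear M -> 'rV[k]_n}) :
  injective f -> finitely_generated M.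
Proof.
move=> fI; pose rows m (x : 'I_m -> M) := \matrix_(i < m) f (x i).
pose P r := `[< exists m (x : 'I_m -> M), \rank (rows m x) = r >].
have exP : exists r, P r.
  exists (\rank (rows 0%N (fun=> 0))); apply/asboolP; by exists 0%N, (fun=> 0).
have ubP r : P r -> (r <= n)%N.
  by case/asboolP => m [x <-]; exact: rank_leq_col.
case: (ex_maxnP exP ubP) => r /asboolP[m [x xr]] rmax.
exists m, x => y; pose y' (i : 'I_(m + 1)) := if split i is inl j then x j else y.
have y'E : rows _ y' = col_mx (rows m x) (f y).
  apply/row_matrixP => i; rewrite rowK /y'; case: (splitP i) => j ij.
    have -> : i = lshift 1 j by apply: val_inj.
    by rewrite rowKu rowK.
  have -> : i = rshift m j by apply: val_inj.
  by rewrite rowKd [j]ord1 row_id.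
have le_r : (\rank (rows _ y') <= r)%N.
  by apply: rmax; apply/asboolP; exists (m + 1)%N, y'.
have : (f y <= rows m x)%MS.
  have sub : (rows m x <= rows _ y')%MS by rewrite y'E -addsmxE addsmxSl.
  have: (rows _ y' <= rows m x)%MS.
    by have := (mxrank_leqif_sup sub).2; rewrite eqn_leq -xr in le_r *;
      rewrite le_r mxrankS.
  by apply: submx_trans; rewrite y'E -addsmxE addsmxSr.
case/submxP=> c fy; exists (fun i => c 0 i); apply: fI; rewrite fy linear_sum.
rewrite mulmx_sum_row; apply: eq_bigr => i _; by rewrite linearZ rowK.
Qed.

Lemma fg_inj_field M N (f : {linear M -> N}) :
  injective f -> finitely_generated N -> finitely_generated M.
Proof.
move=> fI /coordinates[n [v [u [vK uK]]]].
by apply: (@fg_submodule_rV M n (v \o f)%FUN); apply: inj_comp => //; exact: can_inj vK.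
Qed.

(** In coordinates f is a row-free matrix, which has a right inverse. *)
Lemma form_extend M N (f : {linear M -> N}) (xi : {linear M -> k^o}) :
  finitely_generated M -> finitely_generated N -> injective f ->
  exists zeta : {linear N -> k^o}, forall x, zeta (f x) = xi x.
Proof.
move=> /coordinates[m [v [u [vK uK]]]] /coordinates[n [v' [u' [v'K u'K]]]] fI.
pose F := lin1_mx (v' \o f \o u)%FUN.
have FE x : v x *m F = v' (f x) by rewrite mul_rV_lin1 /= vK.
have Ffree : row_free F.
  apply/row_freeP; apply/row_freeP; rewrite -kermx_eq0; apply/rowV0P => a /sub_kermxP.
  rewrite -(uK a) FE => /(canRL v'K); rewrite linear0 -(linear0 f) => /fI ->.
  by rewrite linear0.
have [G FG] := row_freeP Ffree.
have zL : linear ((fun y => xi (u (v' y *m G))) : N -> k^o).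
  by move=> c x y; rewrite linearP mulmxDl -scalemxAl linearP linearP.
have [zeta zE] := linear_exists zL.
by exists zeta => x; rewrite zE -FE -mulmxA FG mulmx1 vK.
Qed.

Lemma dual_basis_exists M : finitely_generated M ->
  exists n (g : 'I_n -> M) (xi : 'I_n -> {linear M -> k^o}),
    forall x, x = \sum_i xi i x *: g i.
Proof.
move=> /coordinates[n [v [u [vK uK]]]].
have xL i : linear ((fun x => v x 0 i) : M -> k^o).
  by move=> c x y; rewrite linearP !mxE.
have [xi xiE] := choice (fun i => linear_exists (xL i)).
exists n, (fun i => u (delta_mx 0 i)), xi => x.
rewrite -{1}[x]vK [in LHS](row_sum_delta (v x)) linear_sum; apply: eq_bigr => i _.
by rewrite linearZ xiE.
Qed.

End FiniteDimension.

Section Subquotient.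
Variables (R : nzRingType) (M : lmodType R) (S : M -> Prop).
Hypothesis S_sub : submodule S.

Let pS : {pred M} := fun x => `[< S x >].
Let pS_closed : submod_closed pS := submodule_closed S_sub.
HB.instance Definition _ := GRing.isSubmodClosed.Build R M pS pS_closed.

Let sub_of : Type := {x : M | x \in pS}.
HB.instance Definition _ := [isSub of sub_of for @sval M (fun x => x \in pS)].
HB.instance Definition _ := [Choice of sub_of by <:].
HB.instance Definition _ := [SubChoice_isSubLmodule of sub_of by <:].

Lemma submodule_embedding :
  exists (N : lmodType R) (i : {linear N -> M}),
    injective i /\ forall x, S x <-> exists y, i y = x.
Proof.
exists (sub_of : lmodType R), (val : {linear sub_of -> M}); split; first exact: val_inj.
move=> x; split=> [Sx|[y <-]]; last exact/asboolP/(valP y).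
have px : x \in pS by apply/asboolP.
by exists (exist _ x px).
Qed.

Let coset_rel x y := S (x - y).
Let coset_rel_refl x : coset_rel x x.
Proof. by rewrite /coset_rel subrr; apply: submodule0. Qed.
Let coset_rel_sym x y : coset_rel x y -> coset_rel y x.
Proof. by move=> /(submoduleN S_sub); rewrite /coset_rel opprB. Qed.
Let coset_rel_trans x y z : coset_rel x y -> coset_rel y z -> coset_rel x z.
Proof.
move=> xy yz; rewrite /coset_rel -[x](subrK y) -addrA.
exact: (submoduleD S_sub xy yz).
Qed.

(** The quotient consists of chosen representatives of the cosets; choosing
    extensionally in the coset makes the representative depend on the coset
    only. *)
Lemma quotient_projection :
  exists (N : lmodType R) (p : {linear M -> N}),
    surj p /\ forall x, p x = 0 <-> S x.
Proof.
pose cl x y := `[< coset_rel x y >]; pose rho x := choose (cl x) x.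
have clx x : cl x x by apply/asboolP.
have rhoS x : S (x - rho x) by have /asboolP := chooseP (clx x).
have rho_eq x y : S (x - y) -> rho x = rho y.
  move=> xy; have clE : cl x =1 cl y.
    move=> z; apply/asboolP/asboolP; apply: coset_rel_trans => //.
    exact: coset_rel_sym.
  rewrite /rho (eq_choose clE); apply: choose_id; last exact: clx.
  by rewrite -clE.
pose Q := {x : M | rho x = x}.
pose mk x : Q := exist _ (rho x) (esym (rho_eq _ _ (rhoS x))).
have mk_eq x y : S (x - y) -> mk x = mk y.
  move=> xy; apply: eq_sig_hprop => [?|] /=; first exact: Prop_irrelevance.
  exact: (rho_eq _ _ xy).
have mkS x y : mk x = mk y -> S (x - y).
  move=> [] E; rewrite -[x](subrK (rho x)) {2}E -addrA.
  by apply: submoduleD => //; rewrite -opprB; apply: submoduleN.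
have mkK (q : Q) : mk (sval q) = q.
  case: q => x rx; apply: eq_sig_hprop => //= ?; exact: Prop_irrelevance.
pose qD (q r : Q) := mk (sval q + sval r); pose qN (q : Q) := mk (- sval q).
pose qZ a (q : Q) := mk (a *: sval q).
have qDE x y : qD (mk x) (mk y) = mk (x + y).
  apply: mk_eq; rewrite opprD addrACA -opprB -[rho y - y]opprB -opprD.
  by apply: submoduleN => //; apply: submoduleD.
have qZE a x : qZ a (mk x) = mk (a *: x).
  apply: mk_eq; rewrite -scalerBr; apply: submoduleZ => //.
  by rewrite -opprB; apply: submoduleN.
have qNE x : qN (mk x) = mk (- x).
  by apply: mk_eq; rewrite opprK addrC; apply: rhoS.
have DA : associative qD.
  by move=> x y z; rewrite -[x]mkK -[y]mkK -[z]mkK !qDE addrA.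
have DC : commutative qD.
  by move=> x y; rewrite -[x]mkK -[y]mkK !qDE addrC.
have D0 : left_id (mk 0) qD by move=> x; rewrite -[x]mkK qDE add0r.
have DN : left_inverse (mk 0) qN qD.
  by move=> x; rewrite -[x]mkK qNE qDE addNr.
pose Qc : choiceType := HB.pack Q (gen_eqMixin Q) (gen_choiceMixin Q).
pose Qz : zmodType := HB.pack Q (Choice.on Qc)
  (GRing.isZmodule.Build Qc DA DC D0 DN).
have ZA a b (v : Qz) : qZ a (qZ b v) = qZ (a * b) v.
  by rewrite -[v]mkK !qZE scalerA.
have Z1 : left_id 1 (qZ : R -> Qz -> Qz).
  by move=> v; rewrite -[v]mkK qZE scale1r.
have ZDr : right_distributive (qZ : R -> Qz -> Qz) +%R.
  move=> a x y; rewrite -[x]mkK -[y]mkK [qZ _ (mk _)]qZE [qZ _ (mk (sval y))]qZE.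
  by rewrite [RHS]qDE [_ + _]qDE qZE scalerDr.
have ZDl (v : Qz) : {morph (qZ : R -> Qz -> Qz)^~ v : a b / a + b}.
  by move=> a b; rewrite -[v]mkK /= !qZE scalerDl [RHS]qDE.
pose Ql : lmodType R := HB.pack Q (GRing.Zmodule.on Qz)
  (GRing.Zmodule_isLmodule.Build R Qz ZA Z1 ZDr ZDl).
have mkL : linear (mk : M -> Ql).
  by move=> a x y; rewrite -[LHS]qDE -qZE.
have [p pE] := linear_exists mkL; exists Ql, p; split=> [q|x].
  by exists (sval q); rewrite pE mkK.
by rewrite pE; split=> [/mkS|Sx]; [rewrite subr0 | apply: mk_eq; rewrite subr0].
Qed.

End Subquotient.

Lemma fg_surj (R : nzRingType) (M N : lmodType R) (p : {linear M -> N}) :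
  surj p -> finitely_generated M -> finitely_generated N.
Proof.
move=> pS [n [g Hg]]; exists n, (p \o g) => y; have [x <-] := pS y.
have [c ->] := Hg x; exists c; rewrite linear_sum; apply: eq_bigr => i _.
by rewrite linearZ.
Qed.

Lemma quotient_module (R : nzRingType) (M : fgmod R) (S : M -> Prop) :
  submodule S -> exists (N : fgmod R) (p : {linear M -> N}),
    surj p /\ forall x, p x = 0 <-> S x.
Proof.
case/quotient_projection => N [p [pS pE]].
by exists (Fgmod (fg_surj pS (fgmodP M))), p.
Qed.

Section FdModules.
Variables (k : fieldType) (R : nzRingType) (s : {rmorphism k -> R}).
Hypothesis R_fd : finitely_generated (restr s (R^o : lmodType R)).

(** Over a finite-dimensional algebra, finitely generated means finite
    dimensional; this is what makes submodules of finitely generated modules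
    finitely generated. *)
Lemma fg_restrP (M : lmodType R) :
  finitely_generated M <-> finitely_generated (restr s M).
Proof.
split=> [[n [g Hg]]|[n [g Hg]]]; last first.
  by exists n, g => x; have [c ->] := Hg x; exists (fun i => s (c i)).
have [m [b Hb]] := R_fd.
pose h (ij : 'I_n * 'I_m) : M := (b ij.2 : R) *: g ij.1.
exists #|{: 'I_n * 'I_m}|, (fun l => h (enum_val l)) => x.
have [c ->] := Hg x; have [d dE] := choice (fun i => Hb (c i)).
exists (fun l => d (enum_val l).1 (enum_val l).2).
transitivity (\sum_i \sum_j s (d i j) *: h (i, j)).
  apply: eq_bigr => i _; rewrite {1}dE scaler_suml; apply: eq_bigr => j _.
  by rewrite scalerA.
rewrite pair_bigA (reindex (@enum_val _ {: 'I_n * 'I_m})) /=; last first.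
  exact/onW_bij/enum_val_bij.
by apply: eq_bigr => l _; case: (enum_val l).
Qed.

Lemma fg_inj (M N : lmodType R) (i : {linear M -> N}) :
  injective i -> finitely_generated N -> finitely_generated M.
Proof.
move=> iI /fg_restrP fgN; apply/fg_restrP.
have [f fE] := linear_exists (@restr_linear _ _ s _ _ i).
by apply: (@fg_inj_field k _ _ f) fgN => x y; rewrite !fE => /iI.
Qed.

Lemma submodule_object (M : fgmod R) (S : M -> Prop) :
  submodule S -> exists (N : fgmod R) (i : {linear N -> M}),
    injective i /\ forall x, S x <-> exists y, i y = x.
Proof.
case/submodule_embedding => N [i [iI iE]].
by exists (Fgmod (fg_inj iI (fgmodP M))), i.
Qed.

Lemma image_submodule (M N : lmodType R) (f : {linear M -> N}) :
  submodule (fun y => exists x, f x = y).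
Proof.
split; first by exists 0; rewrite linear0.
by move=> a _ _ [x <-] [y <-]; exists (a *: x + y); rewrite linearP.
Qed.

Lemma image_factorization (M N : fgmod R) (f : {linear M -> N}) :
  exists (L : fgmod R) (p : {linear M -> L}) (i : {linear L -> N}),
    [/\ surj p, injective i & forall x, i (p x) = f x].
Proof.
have [L [i [iI iE]]] := submodule_object (image_submodule f).
have [p pE] := factor_inj (f := f) iI (fun x => (iE (f x)).1 (ex_intro _ x erefl)).
exists L, p, i; split=> // y; have [x fx] := (iE (i y)).2 (ex_intro _ y erefl).
by exists x; apply: iI; rewrite pE.
Qed.

End FdModules.

(** * Flip-flops from two relations *)

Section Closed.
Variables (U : Type) (H : U -> U -> Prop).

(** H x y stands for the vanishing of Hom(x, y). *)
Definition rperp (T : U -> Prop) (y : U) : Prop := forall x, T x -> H x y.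
Definition lperp (W : U -> Prop) (x : U) : Prop := forall y, W y -> H x y.
Definition orth_closed (T : U -> Prop) : Prop := forall x, lperp (rperp T) x -> T x.

Lemma lperp_closed W : orth_closed (lperp W).
Proof. by move=> x Hx y Wy; apply: Hx => z; apply. Qed.

Record closed_class := ClosedClass { cc_mem :> U -> Prop; ccP : orth_closed cc_mem }.

Definition cc_le : relation closed_class := fun T T' => forall x, T x -> T' x.

Lemma closed_class_eq (T T' : closed_class) : (forall x, T x <-> T' x) -> T = T'.
Proof.
case: T T' => [T cT] [T' cT'] /= E.
have {}E : T = T' by apply/funext => x; apply/propext.
by case: _ / E cT' => cT'; congr ClosedClass; apply: Prop_irrelevance.
Qed.

Lemma cc_le_order : order closed_class cc_le.
Proof.
split=> [T //|T1 T2 T3 h12 h23 x /h12 /h23 //|T T' h h'].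
by apply: closed_class_eq => x; split=> [/h|/h'].
Qed.

Definition closed_poset : poset := Poset cc_le_order.

Definition sub_poset (Q : closed_class -> Prop) : poset.
Proof.
exists {T : closed_class | Q T} (fun T T' => cc_le (sval T) (sval T')).
split=> [T x //|T1 T2 T3 h12 h23 x /h12 /h23 //|[T QT] [T' QT'] h h'].
apply: eq_sig_hprop => [x|] /=; first exact: Prop_irrelevance.
by apply: closed_class_eq => x; split=> [/h|/h'].
Defined.

Lemma rperp_sub (T T' : U -> Prop) :
  (forall x, T x -> T' x) -> forall y, rperp T' y -> rperp T y.
Proof. by move=> TT' y Ty x /TT' /Ty. Qed.

End Closed.

(** Antisymmetry makes an order embedding injective. *)
Lemma poset_iso_embedding (Z Z' : poset) (g : Z -> Z') :
  (forall u v, ple u v <-> ple (g u) (g v)) -> surj g -> poset_iso Z Z'.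
Proof.
move=> gle gS; exists g; split=> //.
have gI : injective g.
  case: (ple_order Z) (ple_order Z') => _ _ anti [rfl _ _] u v guv.
  by apply: anti; apply/gle; rewrite guv; apply: rfl.
have [h hK] := choice gS; exists h => // u; apply: gI; exact: hK.
Qed.

Lemma poset_iso_trans (Z1 Z2 Z3 : poset) :
  poset_iso Z1 Z2 -> poset_iso Z2 Z3 -> poset_iso Z1 Z3.
Proof.
move=> [f [fB fle]] [g [gB gle]]; exists (g \o f); split; first exact: bij_comp.
by move=> u v; split=> [/fle /gle|/gle /fle].
Qed.

Section FlipFlop.
Variables (U V : Type) (HA : U -> U -> Prop) (HB : V -> V -> Prop).
Variables (P : U) (S : V).

(** P is a simple projective object for HA and S a simple injective object for
    HB.  The hypotheses [to_calT] to [to_calS] say that on suitable test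
    objects every object may be replaced by one of the named class: the
    largest subobject in calT, the largest quotient in calP, the largest
    quotient in calY and the largest subobject in calS. *)
Local Notation calT := (fun M => HA M P).
Local Notation calP := (fun M => HA P M).
Local Notation calS := (fun Z => HB Z S).
Local Notation calY := (fun Z => HB S Z).

Hypothesis P_neq0 : ~ HA P P.
Hypothesis P_quot : forall M, ~ HA M P -> forall W, HA M W -> HA P W.
Hypothesis S_neq0 : ~ HB S S.
Hypothesis S_quot : forall Z, ~ HB Z S -> forall W, HB Z W -> HB S W.

Hypothesis to_calT : forall M', exists2 N', HA N' P &
  forall M, HA M P -> (HA M M' <-> HA M N').
Hypothesis to_calP : forall M, exists2 N, HA P N &
  forall M', HA P M' -> (HA M M' <-> HA N M').
Hypothesis to_calY : forall Z, exists Y,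
  [/\ HB S Y, forall Y', HB S Y' -> (HB Z Y' <-> HB Y Y'),
      HB Z S -> HB Y S & forall Z', HB Z Z' -> HB Y Z'].
Hypothesis to_calS : forall Z', exists2 N', HB N' S &
  forall Z, HB Z S -> (HB Z Z' <-> HB Z N').

Variables F Theta : U -> V -> Prop.
Hypothesis F_dom : forall M Y, F M Y -> HA M P /\ HB S Y.
Hypothesis F_totl : forall M, HA M P -> exists Y, F M Y.
Hypothesis F_totr : forall Y, HB S Y -> exists M, F M Y.
Hypothesis F_hom : forall M Y M' Y', F M Y -> F M' Y' -> (HA M M' <-> HB Y Y').
Hypothesis Theta_dom : forall N Z, Theta N Z -> HA P N /\ HB Z S.
Hypothesis Theta_totl : forall N, HA P N -> exists Z, Theta N Z.
Hypothesis Theta_totr : forall Z, HB Z S -> exists N, Theta N Z.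
Hypothesis Theta_hom :
  forall N Z N' Z', Theta N Z -> Theta N' Z' -> (HA N N' <-> HB Z Z').

Hypothesis F_Theta : forall M Y, F M Y -> exists N0 Y0,
  [/\ Theta N0 Y0, forall N, HA P N -> (HA M N <-> HA N0 N),
      forall Y', HB S Y' -> HB Y0 Y' -> HB Y Y'
    & HB Y S -> forall Z', HB Y Z' -> HB Y0 Z'].

Let PA (T : closed_class HA) : Prop := T P.
Let nPA (T : closed_class HA) : Prop := ~ T P.

(** An object with a nonzero map to P has P as a quotient. *)
Lemma closed_calT (T : closed_class HA) : ~ T P -> forall M, T M -> HA M P.
Proof.
move=> nTP M TM; apply: contrapT => nMP; apply: nTP; apply: ccP => W TW.
exact: P_quot nMP _ (TW _ TM).
Qed.

Lemma closed_calS (T : closed_class HB) : ~ T S -> forall Z, T Z -> HB Z S.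
Proof.
move=> nTS Z TZ; apply: contrapT => nZS; apply: nTS; apply: ccP => W TW.
exact: S_quot nZS _ (TW _ TZ).
Qed.

(** The intersection with calT, which is the map of the flip-flop. *)
Let meetT (T : closed_class HA) : closed_class HA :=
  ClosedClass (@lperp_closed _ HA (fun W => W = P \/ rperp HA T W)).

Let meetT_E (T : closed_class HA) M : meetT T M <-> HA M P /\ T M.
Proof.
split=> [h|[MP TM] W [->|TW]]; [|exact: MP|exact: TW].
by split; [apply: h; left|apply: ccP => W TW; apply: h; right].
Qed.

Let meetT_nP T : nPA (meetT T).
Proof. by move=> /meetT_E[/P_neq0]. Qed.

Local Notation XP := (sub_poset PA).
Local Notation YP := (sub_poset nPA).
Let fXY (T : XP) : YP := exist nPA _ (@meetT_nP (sval T)).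

Let fXY_mono : order_preserving fXY.
Proof.
move=> [T TP] [T' TP'] h M /meetT_E[MP TM]; apply/meetT_E; split=> //; exact: h.
Qed.

Let splitA (T : closed_poset HA) : poset_minus fXY_mono :=
  match pselect (T P) with
  | left TP => inl (exist PA T TP)
  | right nTP => inr (exist nPA T nTP)
  end.

Let isoA : poset_iso (closed_poset HA) (poset_minus fXY_mono).
Proof.
apply: (@poset_iso_embedding _ _ splitA); last first.
  case=> [[T TP]|[T nTP]]; exists T; rewrite /splitA; case: pselect => // h.
  - by congr (inl _); apply: eq_sig_hprop => // ?; apply: Prop_irrelevance.
  - by congr (inr _); apply: eq_sig_hprop => // ?; apply: Prop_irrelevance.
move=> T T'; rewrite /splitA; case: pselect => TP; case: pselect => TP' //=.
- by split=> // /(_ P TP).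
- split=> [h M TM|h M TM].
    by apply/meetT_E; split; [apply: closed_calT TM|apply: h].
  by have /meetT_E[] := h M TM.
Qed.

(** The classes of HA attached to a class Z of HB: TX when Z does not contain
    S, TY when it does. *)
Let TX (Z : closed_class HB) : closed_class HA := ClosedClass (@lperp_closed _ HA
  (fun N => exists2 Z', Theta N Z' & rperp HB Z Z')).
Let TY (Z : closed_class HB) : closed_class HA := ClosedClass (@lperp_closed _ HA
  (fun N => N = P \/ exists2 Y', F N Y' & rperp HB Z Y')).

Let TX_P Z : PA (TX Z).
Proof. by move=> N [Z' /Theta_dom[]]. Qed.
Let TY_nP Z : nPA (TY Z).
Proof. by move=> h; apply: P_neq0; apply: h; left. Qed.

Let TY_E Z M :
  TY Z M <-> HA M P /\ forall M' Y', F M' Y' -> rperp HB Z Y' -> HA M M'.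
Proof.
split=> [h|[MP h] N [->|[Y' FNY ZY]]] //; last exact: h FNY ZY.
by split=> [|M' Y' FM ZY]; apply: h; [left|right; exists Y'].
Qed.

(** Objects may be replaced by their reflections in calY, on which F is
    essentially surjective. *)
Let TY_le (Z1 Z2 : closed_class HB) : Z2 S -> cc_le Z1 Z2 <-> cc_le (TY Z1) (TY Z2).
Proof.
move=> Z2S; split=> [h M /TY_E[MP hM]|h Z ZZ].
  apply/TY_E; split=> // M' Y' FM ZY; apply: hM FM _.
  exact: rperp_sub ZY.
apply: ccP => Y' Z2Y'; have SY' : HB S Y' by apply: Z2Y'.
have [Y [SY YE _ _]] := to_calY Z; apply/YE => //.
have [M FMY] := F_totr SY; have [M' FM'] := F_totr SY'.
apply/(F_hom FMY FM').
have /TY_E[_] : TY Z2 M; last by apply; [exact: FM'|].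
apply: h; apply/TY_E; split; first by case: (F_dom FMY).
move=> M'' Y'' FM'' Z1Y''; apply/(F_hom FMY FM'').
by apply/YE; [case: (F_dom FM'')|apply: Z1Y''].
Qed.

Let TX_le (Z1 Z2 : closed_class HB) : ~ Z1 S -> ~ Z2 S ->
  cc_le Z1 Z2 <-> cc_le (TX Z1) (TX Z2).
Proof.
move=> nZ1S nZ2S; split=> [h M hM N [Z' tNZ Z2Z']|h Z ZZ].
  by apply: hM; exists Z' => //; apply: rperp_sub Z2Z'.
apply: ccP => Z' Z2Z'; have ZS := closed_calS nZ1S ZZ.
have [N' N'S N'E] := to_calS Z'; apply/N'E => //.
have [M tMZ] := Theta_totr ZS; have [N tNN'] := Theta_totr N'S.
apply/(Theta_hom tMZ tNN').
have hM : TX Z2 M.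
  by apply: h => N1 [Z1' tN1 Z1Z']; apply/(Theta_hom tMZ tN1)/Z1Z'.
apply: hM; exists N' => // Z2' Z2Z2'; apply/N'E; first exact: closed_calS Z2Z2'.
exact: Z2Z'.
Qed.

(** In terms of modules, with F a functor and Y0 the largest subobject of F M in
    calS: from left to right, if M lies in calT and in TX Z1, then Y0 lies in
    Z1, hence in Z2, and F M is an extension of Y0 by multiples of S.  From
    right to left, an object Z of calS is compared with its reflection Y in
    calY, which is again in calS and therefore agrees with its part Y0. *)
Let TXY_le (Z1 Z2 : closed_class HB) : ~ Z1 S -> Z2 S ->
  cc_le Z1 Z2 <-> cc_le (meetT (TX Z1)) (TY Z2).
Proof.
move=> nZ1S Z2S; split=> [h M /meetT_E[MP hM]|h Z ZZ].
  apply/TY_E; split=> // M' Y' FM' Z2Y'.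
  have [Y FMY] := F_totl MP; apply/(F_hom FMY FM').
  have [N0 [Y0 [tN0 N0E Y0E _]]] := F_Theta FMY.
  apply: Y0E; [by case: (F_dom FM')|apply: Z2Y'; apply: h; apply: ccP => Z' Z1Z'].
  have Y0S : HB Y0 S by case: (Theta_dom tN0).
  have [N' N'S N'E] := to_calS Z'; apply/N'E => //.
  have [N tN] := Theta_totr N'S; apply/(Theta_hom tN0 tN)/N0E.
    by case: (Theta_dom tN).
  apply: hM; exists N' => // Z1' Z1Z1'; apply/N'E; first exact: closed_calS Z1Z1'.
  exact: Z1Z'.
have ZS := closed_calS nZ1S ZZ.
have [Y [SY YE YS YZ]] := to_calY Z; have [M FMY] := F_totr SY.
have [N0 [Y0 [tN0 N0E _ Y0E]]] := F_Theta FMY.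
have /TY_E[_ hM] : TY Z2 M.
  apply: h; apply/meetT_E; split; first by case: (F_dom FMY).
  move=> N [Z' tN Z1Z']; apply/N0E; first by case: (Theta_dom tN).
  by apply/(Theta_hom tN0 tN); apply: Y0E; [apply: YS|apply: YZ; apply: Z1Z'].
apply: ccP => Y' Z2Y'; have SY' := Z2Y' _ Z2S.
have [M' FM'] := F_totr SY'; apply/YE => //; apply/(F_hom FMY FM').
exact: hM FM' Z2Y'.
Qed.

Let splitB (Z : closed_poset HB) : poset_plus fXY_mono :=
  match pselect (Z S) with
  | left _ => inr (exist nPA _ (@TY_nP Z))
  | right _ => inl (exist PA _ (@TX_P Z))
  end.

Let isoB : poset_iso (closed_poset HB) (poset_plus fXY_mono).
Proof.
apply: (@poset_iso_embedding _ _ splitB).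
  move=> Z1 Z2; rewrite /splitB; case: pselect => Z1S; case: pselect => Z2S //=.
  - exact: TY_le.
  - by split=> // /(_ _ Z1S).
  - exact: TXY_le.
  - exact: TX_le.
case=> [[T TP]|[T nTP]].
- pose Z : closed_class HB := ClosedClass (@lperp_closed _ HB
    (fun Z' => Z' = S \/ exists2 N, Theta N Z' & rperp HA T N)).
  have nZS : ~ Z S by move=> h; apply: S_neq0; apply: h; left.
  exists Z; rewrite /splitB; case: pselect => // h; congr (inl _).
  apply: eq_sig_hprop => [?|] /=; first exact: Prop_irrelevance.
  apply: closed_class_eq => M; split=> [hM|TM N [Z' tN ZZ']].
    apply: ccP => W TW; have [Z' tW] := Theta_totl (TW _ TP).
    by apply: hM; exists Z' => // Z0 ZZ0; apply: ZZ0; right; exists W.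
  have [N0 PN0 N0E] := to_calP M; have [Z0 tN0] := Theta_totl PN0.
  apply/N0E; first by case: (Theta_dom tN).
  apply/(Theta_hom tN0 tN)/ZZ' => Z1 [->|[N1 tN1 TN1]].
    by case: (Theta_dom tN0).
  by apply/(Theta_hom tN0 tN1)/N0E; [apply: TN1|apply: TN1].
- pose Z : closed_class HB := ClosedClass (@lperp_closed _ HB
    (fun Y' => exists2 M, F M Y' & rperp HA T M)).
  have ZS : Z S by move=> Y' [M /F_dom[]].
  exists Z; rewrite /splitB; case: pselect => // h; congr (inr _).
  apply: eq_sig_hprop => [?|] /=; first exact: Prop_irrelevance.
  apply: closed_class_eq => M; split=> [/TY_E[MP hM]|TM].
    apply: ccP => W TW; have [N' N'P N'E] := to_calT W; apply/N'E => //.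
    have [Y' FN'] := F_totl N'P; apply: (hM _ _ FN') => Y ZY; apply: ZY.
    by exists N' => // M1 TM1; apply/N'E; [apply: closed_calT TM1|apply: TW].
  have MP := closed_calT nTP TM; apply/TY_E; split=> // M' Y' FM' ZY'.
  have [Y FMY] := F_totl MP; apply/(F_hom FMY FM')/ZY' => Y1 [M1 FM1 TM1].
  by apply/(F_hom FMY FM1)/TM1.
Qed.

Theorem flip_flop_of_contexts :
  related_by_flip_flop (closed_poset HA) (closed_poset HB).
Proof. by exists XP, YP, fXY, fXY_mono; right; split; [exact: isoB|exact: isoA]. Qed.

End FlipFlop.

(** * Torsion classes as classes closed under double orthogonals *)

Section DirectSum.
Variable R : nzRingType.
Implicit Types M N L : fgmod R.

Lemma dsum_inl M N : exists f : {linear M -> dsum M N}, forall x, f x = (x, 0).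
Proof.
by apply: linear_exists => a x y; apply: injective_projections; rewrite /= ?scaler0 ?addr0.
Qed.

Lemma dsum_inr M N : exists f : {linear N -> dsum M N}, forall x, f x = (0, x).
Proof.
by apply: linear_exists => a x y; apply: injective_projections; rewrite /= ?scaler0 ?addr0.
Qed.

Lemma dsum_fst M N : exists f : {linear dsum M N -> M}, forall x, f x = x.1.
Proof. by apply: linear_exists. Qed.

Lemma dsum_snd M N : exists f : {linear dsum M N -> N}, forall x, f x = x.2.
Proof. by apply: linear_exists. Qed.

Lemma dsum_copair M N L (f : {linear M -> L}) (g : {linear N -> L}) :
  exists h : {linear dsum M N -> L}, forall x, h x = f x.1 + g x.2.
Proof.
by apply: linear_exists => a x y /=; rewrite !linearP scalerDr addrACA.
Qed.

End DirectSum.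

Section TorsionClasses.
Variables (k : fieldType) (R : nzRingType) (s : {rmorphism k -> R}).
Hypothesis R_fd : finitely_generated (restr s (R^o : lmodType R)).
Implicit Types M N L X W : fgmod R.

Definition hom0 M N : Prop := forall (f : {linear M -> N}) x, f x = 0.

Lemma torsion_class_closed (T : fgmod R -> Prop) :
  is_torsion_class T -> orth_closed hom0 T.
Proof.
case=> F [[Tiso _ _ _] _ TF0 dec] M HM.
have [tM [fM [i [p [TtM FfM [iI ex pS]]]]]] := dec M.
apply: (Tiso tM) TtM; apply: (mod_iso_bij iI) => x; apply/ex.
by apply: HM => N TN f y; apply: TF0 f TN FfM y.
Qed.

Section FromClosed.
Variable T : fgmod R -> Prop.
Hypothesis T_closed : orth_closed hom0 T.

Lemma closed_quot M N (p : {linear M -> N}) : surj p -> T M -> T N.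
Proof.
move=> pS TM; apply: T_closed => W TW f y; have [x <-] := pS y.
exact: (TW M TM (f \o p)%FUN).
Qed.

Lemma closed_ext N M L (i : {linear N -> M}) (p : {linear M -> L}) :
  exact_at i p -> surj p -> T N -> T L -> T M.
Proof.
move=> ex pS TN TL; apply: T_closed => W TW f x.
have fi y : f (i y) = 0 by apply: (TW N TN (f \o i)%FUN).
have [g gE] : exists g : {linear L -> W}, forall x, g (p x) = f x.
  by apply: factor_surj => // z /ex[y <-].
by rewrite -gE; apply: (TW L TL g).
Qed.

Lemma closed_zero : T (zero_module R).
Proof. by apply: T_closed => W TW f x; rewrite [x]thinmx0 linear0. Qed.

Lemma closed_dsum M N : T M -> T N -> T (dsum M N).
Proof.
have [f fE] := dsum_inl M N; have [g gE] := dsum_snd M N.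
apply: (@closed_ext _ _ _ f g) => [[x y]|y]; last by exists (0, y); rewrite gE.
rewrite gE /=; split=> [->|[z]]; first by exists x; rewrite fE.
by rewrite fE => -[].
Qed.

(** The torsion part of X is the trace of T: the union of the images of all
    maps from members of T.  It lies in T because a map from it to an object
    orthogonal to T vanishes on each of these images. *)
Lemma closed_torsion_pair : torsion_pair T (rperp hom0 T).
Proof.
split.
- split.
  + by move=> M N /mod_iso_inj_surj[f [_ fS]]; apply: closed_quot fS.
  + exact: closed_zero.
  + exact: closed_dsum.
  + move=> M N TMN; have [f fE] := dsum_fst M N; have [g gE] := dsum_snd M N.
    split; first by apply: (closed_quot (p := f)) TMN => y; exists (y, 0); rewrite fE.
    by apply: (closed_quot (p := g)) TMN => y; exists (0, y); rewrite gE.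
- split.
  + move=> M N /mod_iso_inj_surj[f [fI fS]] FM.
    have [g [fK gK]] := bij_linear_inv fI fS.
    by move=> L TL h x; apply: (can_inj gK); rewrite linear0; apply: (FM L TL (g \o h)%FUN).
  + by move=> M _ f x; apply: thinmx0.
  + move=> M N FM FN L TL h x.
    have [f fE] := dsum_fst M N; have [g gE] := dsum_snd M N.
    have := FM L TL (f \o h)%FUN x; have := FN L TL (g \o h)%FUN x.
    by rewrite /= fE gE => h2 h1; apply: injective_projections.
  + move=> M N FMN; have [f fE] := dsum_inl M N; have [g gE] := dsum_inr M N.
    split=> L TL h x; first by have := FMN L TL (f \o h)%FUN x; rewrite /= fE => -[].
    by have := FMN L TL (g \o h)%FUN x; rewrite /= gE => -[].
- by move=> M N f TM FN x; apply: FN TM f x.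
- move=> X.
  pose tr x := exists M (f : {linear M -> X}), T M /\ exists m, f m = x.
  have trS : submodule tr.
    split; first by exists (zero_module R), \0; split; [exact: closed_zero|exists 0].
    move=> a _ _ [M [f [TM [m <-]]]] [N [g [TN [n <-]]]].
    have [h hE] := dsum_copair f g; exists (dsum M N), h.
    split; first exact: closed_dsum.
    by exists (a *: m, n); rewrite hE /= linearZ.
  have [tX [i [iI iE]]] := submodule_object R_fd trS.
  have [fX [p [pS pE]]] := quotient_module trS.
  have ex : exact_at i p by move=> x; split=> [/pE/iE|/iE/pE].
  have TtX : T tX.
    apply: T_closed => W TW f y.
    have /iE [M [g [TM [m gm]]]] : exists y', i y' = i y by exists y.
    have [h hE] : exists h : {linear M -> tX}, forall x, i (h x) = g x.
      by apply: factor_inj => // x; apply/iE; exists M, g; split=> //; exists x.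
    have -> : y = h m by apply: iI; rewrite hE.
    exact: (TW M TM (f \o h)%FUN).
  exists tX, fX, i, p; split=> // M TM h m.
  have [x pm] := pS (h m).
  (* the pullback L of h along p extends M by the trace, so it lies in T *)
  pose D (z : dsum M X) := h z.1 = p z.2.
  have DS : submodule D.
    by split=> [|a u v Du Dv]; rewrite /D /= ?linear0 // !linearP Du Dv.
  have [L [j [jI jE]]] := submodule_object R_fd DS.
  have [f fE] := dsum_fst M X; have [g gE] := dsum_snd M X.
  have [u uE] := dsum_inr M X.
  have [v vE] : exists v : {linear tX -> L}, forall y, j (v y) = (u \o i)%FUN y.
    apply: factor_inj => // y; apply/jE; rewrite /D /= uE /= linear0.
    by apply/esym/ex; exists y.
  have TL : T L.
    apply: (@closed_ext _ _ _ v (f \o j)%FUN) TtX TM => [y|m']; last first.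
      have [x' px'] := pS (h m'); have /jE[y jy] : D (m', x') by [].
      by exists y; rewrite /= jy fE.
    split=> [/= |[y' <-]]; last by rewrite /= vE /= uE fE.
    rewrite fE => y1; have /jE : exists y', j y' = j y by exists y.
    rewrite /D y1 linear0 => /esym/ex[y' iy']; exists y'; apply: jI.
    by rewrite vE /= uE iy'; apply: injective_projections; rewrite //= y1.
  have /jE[y jy] : D (m, x) by [].
  rewrite -pm; apply/pE; exists L, (g \o j)%FUN; split=> //; exists y.
  by rewrite /= jy gE.
Qed.

End FromClosed.

Lemma torsion_classP (T : fgmod R -> Prop) : is_torsion_class T <-> orth_closed hom0 T.
Proof.
split; first exact: torsion_class_closed.
by move=> cT; exists (rperp hom0 T); apply: closed_torsion_pair.
Qed.

End TorsionClasses.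

(** * Right actions of matrices *)

Lemma opposite_scalars (k : fieldType) (A : falgType k) :
  exists s : {rmorphism k -> A^c}, forall c, s c = c%:A :> A.
Proof.
pose f (c : k) : A^c := (c%:A : A).
have fB : zmod_morphism f by move=> a b; rewrite /f scalerBl.
have fM : monoid_morphism f.
  split=> [|a b]; rewrite /f ?scale1r //= [in RHS]/GRing.mul /=.
  by rewrite -scalerAl mul1r scalerA mulrC.
pose F : {rmorphism k -> A^c} := HB.pack f
  (GRing.isZmodMorphism.Build k A^c f fB) (GRing.isMonoidMorphism.Build k A^c f fM).
by exists F.
Qed.

(** If the annihilator of s0 kills L and every other scalar is invertible on L,
    then L is a vector space over a division ring acting on S = R s0 too, and
    the first coordinate in a basis is a map onto S. *)
Lemma map_onto_generator (R : nzRingType) (S L : lmodType R) (s0 : S) :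
  finitely_generated L ->
  (forall r (l : L), r *: s0 = 0 -> r *: l = 0) ->
  (forall r, r *: s0 <> 0 -> exists r', forall l : L, r' *: (r *: l) = l) ->
  (exists l : L, l <> 0) -> exists (f : {linear L -> S}) (l : L), f l = s0.
Proof.
case/minimal_generators=> -[|n] [g [gS gI]] _ Sinv [l l_neq0].
  by have [c lE] := gS l; case: l_neq0; rewrite lE big_ord0.
pose G x y := exists2 c : 'I_n.+1 -> R, x = \sum_i c i *: g i & y = c ord0 *: s0.
have [|a _ _ _ _ [c -> ->] [d -> ->]|_ [c c0 ->]|f fE] := @linear_of_graph R L S G.
- by move=> x; have [c ->] := gS x; exists (c ord0 *: s0), c.
- exists (fun i => a * c i + d i).
    rewrite scaler_sumr -big_split; apply: eq_bigr => i _ /=.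
    by rewrite scalerDl scalerA.
  by rewrite scalerDl scalerA.
- apply: contrapT => /Sinv inv; exact: gI (esym c0) inv.
exists f, (g ord0); apply/esym/fE; exists (fun i => (i == ord0)%:R).
  by rewrite (bigD1 ord0) //= scale1r big1 ?addr0 // => i /negPf ->; rewrite scale0r.
by rewrite scale1r.
Qed.

Definition ract (A : nzRingType) (M : lmodType A^c) (x : M) (a : A) : M :=
  (a : A^c) *: x.

Notation "x ◁ a" := (ract x a) (at level 40, left associativity).

Section RightAction.
Variable A : nzRingType.

Section OneModule.
Variable M : lmodType A^c.
Implicit Types (x y : M) (a b : A).

Lemma ractM x a b : x ◁ (a * b) = x ◁ a ◁ b.
Proof. by rewrite /ract scalerA. Qed.
Lemma ract1 x : x ◁ 1 = x. Proof. exact: scale1r. Qed.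
Lemma ractDr x a b : x ◁ (a + b) = x ◁ a + x ◁ b. Proof. exact: scalerDl. Qed.
Lemma ractDl x y a : (x + y) ◁ a = x ◁ a + y ◁ a. Proof. exact: scalerDr. Qed.
Lemma ractBl x y a : (x - y) ◁ a = x ◁ a - y ◁ a. Proof. exact: scalerBr. Qed.
Lemma ractBr x a b : x ◁ (a - b) = x ◁ a - x ◁ b. Proof. exact: scalerBl. Qed.
Lemma ract0l a : (0 : M) ◁ a = 0. Proof. exact: scaler0. Qed.
Lemma ract0r x : x ◁ 0 = 0. Proof. exact: scale0r. Qed.
Lemma ract_suml (I : Type) (r : seq I) (F : I -> M) a :
  (\sum_(i <- r) F i) ◁ a = \sum_(i <- r) F i ◁ a.
Proof. exact: scaler_sumr. Qed.
Lemma ract_sumr (I : Type) (r : seq I) x (F : I -> A) :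
  x ◁ (\sum_(i <- r) F i) = \sum_(i <- r) x ◁ F i.
Proof. exact: scaler_suml. Qed.

(** The row vector x times the matrix B. *)
Definition racts m n (x : 'I_m -> M) (B : 'M[A]_(m, n)) (j : 'I_n) : M :=
  \sum_i x i ◁ B i j.

Lemma eq_racts m n (x y : 'I_m -> M) (B : 'M[A]_(m, n)) j :
  (forall i, x i = y i) -> racts x B j = racts y B j.
Proof. by move=> xy; apply: eq_bigr => i _; rewrite xy. Qed.
Lemma ractsM l m n (x : 'I_l -> M) (B : 'M[A]_(l, m)) (C : 'M[A]_(m, n)) j :
  racts x (B *m C) j = racts (racts x B) C j.
Proof.
rewrite /racts; under eq_bigr => i _ do rewrite mxE ract_sumr.
rewrite exchange_big /=; apply: eq_bigr => i _; rewrite ract_suml.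
by apply: eq_bigr => h _; rewrite ractM.
Qed.
Lemma ractsZ m n (x : 'I_m -> M) (B : 'M[A]_(m, n)) j a :
  racts x B j ◁ a = \sum_i x i ◁ (B i j * a).
Proof. by rewrite /racts ract_suml; apply: eq_bigr => i _; rewrite ractM. Qed.
Lemma ractsDl m n (x y : 'I_m -> M) (B : 'M[A]_(m, n)) j :
  racts (fun i => x i + y i) B j = racts x B j + racts y B j.
Proof. by rewrite /racts -big_split; apply: eq_bigr => i _; rewrite ractDl. Qed.
Lemma ractsBl m n (x y : 'I_m -> M) (B : 'M[A]_(m, n)) j :
  racts (fun i => x i - y i) B j = racts x B j - racts y B j.
Proof. by rewrite /racts -sumrB; apply: eq_bigr => i _; rewrite ractBl. Qed.
Lemma ractsDr m n (x : 'I_m -> M) (B C : 'M[A]_(m, n)) j :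
  racts x (B + C) j = racts x B j + racts x C j.
Proof. by rewrite /racts -big_split; apply: eq_bigr => i _; rewrite mxE ractDr. Qed.
Lemma racts0l m n (B : 'M[A]_(m, n)) j : racts (fun=> 0) B j = 0.
Proof. by rewrite /racts big1 // => i _; rewrite ract0l. Qed.
Lemma racts0r m n (x : 'I_m -> M) j : racts x (0 : 'M[A]_(m, n)) j = 0.
Proof. by rewrite /racts big1 // => i _; rewrite mxE ract0r. Qed.
Lemma racts_scalar m (x : 'I_m -> M) a j : racts x (a%:M) j = x j ◁ a.
Proof.
rewrite /racts (bigD1 j) //= mxE eqxx mulr1n big1 ?addr0 // => i /negPf ij.
by rewrite mxE ij ract0r.
Qed.
End OneModule.

Section Linear.
Variables (M N : lmodType A^c) (f : {linear M -> N}).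
Lemma ract_linear x a : f (x ◁ a) = f x ◁ a. Proof. exact: linearZ. Qed.
Lemma racts_linear m n (x : 'I_m -> M) (B : 'M[A]_(m, n)) j :
  f (racts x B j) = racts (f \o x) B j.
Proof. by rewrite linear_sum; apply: eq_bigr => i _; rewrite ract_linear. Qed.
End Linear.

Lemma submodule_ract (M : lmodType A^c) (S : M -> Prop) :
  S 0 -> (forall x y, S x -> S y -> S (x + y)) ->
  (forall x a, S x -> S (x ◁ a)) -> submodule S.
Proof. by move=> S0 SD SZ; split=> // a x y Sx Sy; apply: SD => //; apply: SZ. Qed.

Lemma linear_ract (M N : lmodType A^c) (f : M -> N) :
  (forall x y, f (x + y) = f x + f y) -> (forall x a, f (x ◁ a) = f x ◁ a) ->
  linear f.
Proof. by move=> fD fZ a x y; rewrite fD -[a *: x]/(x ◁ a) fZ. Qed.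

Lemma linear_of_graph_ract (M N : lmodType A^c) (G : M -> N -> Prop) :
  (forall x, exists y, G x y) ->
  (forall x y x' y', G x y -> G x' y' -> G (x + x') (y + y')) ->
  (forall x y a, G x y -> G (x ◁ a) (y ◁ a)) ->
  (forall y, G 0 y -> y = 0) ->
  exists f : {linear M -> N}, forall x y, G x y <-> y = f x.
Proof.
move=> Gtot GD GZ G0; apply: linear_of_graph => // a x y x' y' Gxy Gxy'.
by apply: GD => //; apply: (GZ x y a).
Qed.

Definition rspan (M : lmodType A^c) (X : M -> Prop) (u : M) : Prop :=
  exists l (x : 'I_l -> M) (a : 'I_l -> A),
    (forall h, X (x h)) /\ u = \sum_h x h ◁ a h.

Lemma rspan_submodule (M : lmodType A^c) (X : M -> Prop) : submodule (rspan X).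
Proof.
apply: submodule_ract.
- by exists 0%N, (fun=> 0), (fun=> 0); split=> [[]//|]; rewrite big_ord0.
- move=> _ _ [l [x [a [Xx ->]]]] [m [y [b [Xy ->]]]].
  exists (l + m)%N, (fun i => match split i with inl i => x i | inr j => y j end),
    (fun i => match split i with inl i => a i | inr j => b j end).
  split=> [i|]; first by case: split.
  rewrite big_split_ord /=; congr (_ + _); apply: eq_bigr => i _.
    by rewrite (unsplitK (inl i : 'I_l + 'I_m)).
  by rewrite (unsplitK (inr i : 'I_l + 'I_m)).
- move=> _ b [l [x [a [Xx ->]]]]; exists l, x, (fun h => a h * b); split=> //.
  by rewrite ract_suml; apply: eq_bigr => i _; rewrite ractM.
Qed.

Lemma rspan_in (M : lmodType A^c) (X : M -> Prop) x : X x -> rspan X x.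
Proof.
move=> Xx; exists 1%N, (fun=> x), (fun=> 1); split=> //.
by rewrite big_ord1 ract1.
Qed.

End RightAction.

(** * The tilting module by generators and relations *)

(** The algebra A is triangular for p + e = 1, with pA simple.  The left module
    eAp, the radical of Ap, is projective: the entries of the column w
    generate it, and the rows of the idempotent matrix eps are the coordinates
    of these entries, so that b w = 0 forces b eps = 0.  The module T is the
    direct sum of eA, generated by t0, and of the cokernel N of the map from
    pA to eps (eA)^n given by w; the classes nu of the columns of eps generate
    N.  The relations of N among the columns c are the c with eps c in w A. *)
Record reflection_data (A : nzRingType) (p e : A) (n : nat)
    (w : 'cV[A]_n) (eps : 'M[A]_n) (T : lmodType A^c) (t0 : T) (nu : 'I_n -> T) :
    Prop := ReflectionData {
  rd_pe1 : p + e = 1;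
  rd_pAe : forall a, p * a * e = 0;
  rd_pA_simple : forall a, p * a <> 0 -> exists b, p * a * b = p;
  rd_ew : forall j i, e * w j i = w j i;
  rd_wp : forall j i, w j i * p = w j i;
  rd_eeps : forall i j, e * eps i j = eps i j;
  rd_epse : forall i j, eps i j * e = eps i j;
  rd_eps_w : eps *m w = w;
  rd_w_span : forall a, exists b : 'rV[A]_n, b *m w = (e * a * p)%:M;
  rd_w_free : forall b : 'rV[A]_n, b *m w = 0 -> b *m eps = 0;
  rd_eAp_neq0 : exists a, e * a * p <> 0;
  rd_t0e : t0 ◁ e = t0;
  rd_nue : forall j, nu j ◁ e = nu j;
  rd_nu_eps : forall j, racts nu eps j = nu j;
  rd_nu_w : racts nu w ord0 = 0;
  rd_gen : forall t, exists a (c : 'cV[A]_n), t = t0 ◁ a + racts nu c ord0;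
  rd_rel : forall a (c : 'cV[A]_n), t0 ◁ a + racts nu c ord0 = 0 ->
    e * a = 0 /\ exists d, eps *m c = w *m d%:M
}.

(** The module P is pA, with u in the role of p. *)
Record simple_data (A : nzRingType) (p : A) (P : lmodType A^c) (u : P) : Prop :=
    SimpleData {
  sd_up : u ◁ p = u;
  sd_gen : forall x, exists a, x = u ◁ a;
  sd_rel : forall a, u ◁ a = 0 <-> p * a = 0
}.

Section Reflection.
Variables (A : nzRingType) (p e : A) (n : nat) (w : 'cV[A]_n) (eps : 'M[A]_n).
Variables (T : fgmod A^c) (t0 : T) (nu : 'I_n -> T).
Hypothesis D : reflection_data p e w eps t0 nu.

Lemma rd_pe : p * e = 0. Proof. by have := rd_pAe D 1; rewrite mulr1. Qed.
Lemma rd_ee : e * e = e.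
Proof. by rewrite -[RHS]mul1r -(rd_pe1 D) mulrDl rd_pe add0r. Qed.
Lemma rd_pp : p * p = p.
Proof. by rewrite -[RHS]mulr1 -(rd_pe1 D) mulrDr rd_pe addr0. Qed.
Lemma rd_ep : e * p = 0.
Proof.
by apply: (addIr (e * e)); rewrite -mulrDr (rd_pe1 D) mulr1 rd_ee add0r.
Qed.
Lemma rd_p_neq0 : p <> 0.
Proof. by case: (rd_eAp_neq0 D) => a ap p0; apply: ap; rewrite p0 mulr0. Qed.
Lemma rd_eaeE a : e * a * e = a * e.
Proof. by rewrite -[a in RHS]mul1r -(rd_pe1 D) !mulrDl (rd_pAe D) add0r. Qed.

Lemma rd_eps_eps : eps *m eps = eps.
Proof.
suff: (eps - 1%:M) *m eps = 0.
  by move=> h; apply/eqP; rewrite -subr_eq0 -[X in _ - X]mul1mx -mulmxBl h.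
apply/row_matrixP => i; rewrite row_mul row0; apply: (rd_w_free D).
by rewrite -row_mul mulmxBl (rd_eps_w D) mul1mx subrr row0.
Qed.

Lemma rd_w_free_mx m (B : 'M[A]_(m, n)) : B *m w = 0 -> B *m eps = 0.
Proof.
move=> Bw; apply/row_matrixP => i; rewrite row_mul row0; apply: (rd_w_free D).
by rewrite -row_mul Bw row0.
Qed.

Lemma rd_w_span_mx m (x : 'cV[A]_m) : (forall i, e * x i ord0 * p = x i ord0) ->
  exists B : 'M[A]_(m, n), B *m w = x.
Proof.
move=> xE; have [b bE] := choice (fun i => rd_w_span D (x i ord0)).
exists (\matrix_(i < m) b i); apply/row_matrixP => i.
rewrite row_mul rowK bE xE; apply/rowP => j.
by rewrite !mxE [j]ord1 eqxx mulr1n.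
Qed.

Lemma rd_wscale_p d : w *m (p * d)%:M = w *m d%:M.
Proof.
apply/matrixP => i j; rewrite !mxE; apply: eq_bigr => h _.
by rewrite !mxE mulrnAr mulrA (rd_wp D) -mulrnAr.
Qed.

Lemma mul_mx_scalar_r m l (B : 'M[A]_(m, l)) a : B *m a%:M = \matrix_(i, j) (B i j * a).
Proof.
apply/matrixP => i j; rewrite !mxE (bigD1 j) //= mxE eqxx mulr1n big1 ?addr0 // => h.
by move=> /negPf hj; rewrite mxE hj mulr0.
Qed.

Section Modules.
Variable M : lmodType A^c.
Implicit Types x y : M.

Lemma ract_pe x : x ◁ p + x ◁ e = x.
Proof. by rewrite -ractDr (rd_pe1 D) ract1. Qed.
Lemma ract_ee x : x ◁ e ◁ e = x ◁ e. Proof. by rewrite -ractM rd_ee. Qed.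
Lemma ract_ep x : x ◁ e ◁ p = 0. Proof. by rewrite -ractM rd_ep ract0r. Qed.
Lemma ract_pae x a : x ◁ p ◁ a ◁ e = 0.
Proof. by rewrite -!ractM mulrA (rd_pAe D) ract0r. Qed.
Lemma ract_ae x a : x ◁ a ◁ e = x ◁ e ◁ a ◁ e.
Proof. by rewrite -[x in LHS]ract_pe !ractDl ract_pae add0r. Qed.

(** The element x lies in the submodule generated by M e: since eAp is generated
    by w, only the component x p has to be tested. *)
Definition generated_at_e x : Prop :=
  exists2 m : 'I_n -> M, forall j, m j ◁ e = m j & x ◁ p = racts m w ord0.

Lemma racts_e m l (y : 'I_m -> M) (B : 'M[A]_(m, l)) j :
  (forall i j, B i j * e = B i j) -> racts y B j ◁ e = racts y B j.
Proof. by move=> Be; rewrite ractsZ; apply: eq_bigr => i _; rewrite Be. Qed.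

Lemma generated_at_e_mul m l (y : 'I_m -> M) (x : 'M[A]_(m, l)) j :
  (forall i, y i ◁ e = y i) -> (forall i j, x i j * p = x i j) ->
  exists2 z : 'I_n -> M, forall i, z i ◁ e = z i & racts y x j = racts z w ord0.
Proof.
move=> ye xp; have [|B Bw] := rd_w_span_mx (x := \col_i (e * x i j)).
  by move=> i; rewrite mxE mulrA rd_ee -mulrA xp.
exists (racts y (B *m e%:M)) => [i|].
  by rewrite ractsM racts_scalar ract_ee.
rewrite -ractsM -mulmxA.
have -> : e%:M *m w = w by apply/matrixP => i h; rewrite mul_scalar_mx mxE (rd_ew D).
rewrite Bw; apply: eq_bigr => i _; rewrite mxE ractM ye //.
Qed.

Lemma generated_at_e_submodule : submodule generated_at_e.
Proof.
apply: submodule_ract.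
- by exists (fun=> 0) => [j|]; rewrite ?ract0l ?racts0l.
- move=> x y [m me mE] [l le lE]; exists (fun j => m j + l j) => [j|].
    by rewrite ractDl me le.
  by rewrite ractDl mE lE ractsDl.
- move=> x a [m me mE].
  have [|i j|y ye yE] := @generated_at_e_mul 1 1 (fun=> x ◁ e) (e * a * p)%:M ord0.
  + by move=> i; rewrite ract_ee.
  + by rewrite [i]ord1 [j]ord1 !mxE mulr1n -mulrA rd_pp.
  have [i j|z ze zE] := @generated_at_e_mul _ _ m (w *m (a * p)%:M) ord0 me.
    by rewrite mul_mx_scalar_r mxE -!mulrA rd_pp.
  exists (fun j => y j + z j) => [j|]; first by rewrite ractDl ye ze.
  rewrite ractsDl -yE -zE ractsM !racts_scalar -mE.
  by rewrite !ractM -ractDl ract_ee -ractDl addrC ract_pe.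
Qed.

End Modules.

Lemma generated_at_e_of (M : lmodType A^c) (x : M) : x ◁ e = x -> generated_at_e x.
Proof.
by move=> xe; exists (fun=> 0) => [j|]; rewrite ?ract0l // racts0l -xe ract_ep.
Qed.

Lemma generated_at_e_linear (M N : lmodType A^c) (f : {linear M -> N}) x :
  generated_at_e x -> generated_at_e (f x).
Proof.
case=> m me mE; exists (f \o m) => [j|]; first by rewrite /= -ract_linear me.
by rewrite -ract_linear mE racts_linear.
Qed.

Lemma tilting_generated_at_e (t : T) : generated_at_e t.
Proof.
have [a [c ->]] := rd_gen D t; have GS := generated_at_e_submodule T.
apply: (submoduleD GS).
  by apply: (submoduleZ GS); apply: generated_at_e_of; apply: (rd_t0e D).
apply: (submodule_sum GS) => i _; apply: (submoduleZ GS); apply: generated_at_e_of.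
exact: (rd_nue D).
Qed.

(** Hom(T, M) is the set of pairs of an element m of M e and of a row kap over
    M e subject to the relations of nu. *)
Lemma tilting_hom (M : lmodType A^c) (m : M) (kap : 'I_n -> M) :
  m ◁ e = m -> (forall j, kap j ◁ e = kap j) ->
  (forall j, racts kap eps j = kap j) -> racts kap w ord0 = 0 ->
  exists f : {linear T -> M}, f t0 = m /\ forall j, f (nu j) = kap j.
Proof.
move=> me kape kapeps kapw.
pose G t y := exists a (c : 'cV[A]_n),
  t = t0 ◁ a + racts nu c ord0 /\ y = m ◁ a + racts kap c ord0.
have [||||f fE] := @linear_of_graph_ract A T M G.
- move=> t; have [a [c tE]] := rd_gen D t.
  by exists (m ◁ a + racts kap c ord0), a, c.
- move=> _ _ _ _ [a [c [-> ->]]] [b [d [-> ->]]]; exists (a + b), (c + d).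
  by rewrite !ractDr !ractsDr addrACA; split=> //; rewrite addrACA.
- move=> _ _ b [a [c [-> ->]]]; exists (a * b), (c *m b%:M).
  by rewrite !ractDl !ractM !ractsM !racts_scalar.
- move=> y [a [c [/esym/(rd_rel D)[ea0 [d epsc]] ->]]].
  rewrite -me -ractM ea0 ract0r add0r.
  rewrite -(eq_racts (x := racts kap eps)) // -ractsM epsc ractsM racts_scalar.
  by rewrite kapw ract0l.
exists f; split=> [|j]; apply/esym/fE.
  by exists 1, 0; rewrite !ract1 !racts0r !addr0.
exists 0, (delta_mx j ord0); rewrite !ract0r !add0r.
have dE (N : lmodType A^c) (x : 'I_n -> N) : racts x (delta_mx j ord0 : 'cV_n) ord0 = x j.
  rewrite /racts (bigD1 j) //= mxE !eqxx ract1 big1 ?addr0 // => i /negPf ij.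
  by rewrite mxE ij ract0r.
by rewrite !dE.
Qed.

Lemma tilting_hom_ext (M : lmodType A^c) (f g : {linear T -> M}) :
  f t0 = g t0 -> (forall j, f (nu j) = g (nu j)) -> forall t, f t = g t.
Proof.
move=> f0 fnu t; have [a [c ->]] := rd_gen D t.
by rewrite !linearD !ract_linear f0 !racts_linear; congr (_ + _); apply: eq_racts.
Qed.

Lemma tilting_nu_relation (c : 'cV[A]_n) :
  (forall i, c i ord0 * e = c i ord0) -> racts nu c ord0 = 0 -> eps *m c = 0.
Proof.
move=> ce nuc; have [|_ [d epsc]] := rd_rel D (a := 0) (c := c).
  by rewrite ract0r add0r.
have -> : c = c *m e%:M by apply/colP => i; rewrite mul_mx_scalar_r mxE ce.
rewrite mulmxA epsc -rd_wscale_p -mulmxA -scalar_mxM (rd_pAe D).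
by apply/matrixP => i j; rewrite mul_mx_scalar_r !mxE mulr0.
Qed.

Lemma tilting_nu_neq0 : exists j, nu j <> 0.
Proof.
apply: contrapT => nu0; have {}nu0 j : nu j = 0.
  by apply: contrapT => h; apply: nu0; exists j.
have eps0 : eps = 0.
  apply/matrixP => i j; rewrite -[eps]rd_eps_eps.
  have /matrixP/(_ i ord0) : eps *m col j eps = 0.
    apply: tilting_nu_relation => [h|]; first by rewrite mxE (rd_epse D).
    by rewrite (eq_racts (y := fun=> 0)) // racts0l.
  by rewrite colE mulmxA -colE !mxE.
case: (rd_eAp_neq0 D) => a; apply; have [b bE] := rd_w_span D a.
have /matrixP/(_ ord0 ord0) := bE.
by rewrite -(rd_eps_w D) eps0 mul0mx mulmx0 !mxE eqxx mulr1n.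
Qed.

Section Simple.
Variables (P : fgmod A^c) (u : P).
Hypothesis DP : simple_data p u.

Lemma simple_e (x : P) : x ◁ e = 0.
Proof.
have [a ->] := sd_gen DP x; rewrite -(sd_up DP) -!ractM mulrA (rd_pAe D).
by rewrite ract0r.
Qed.

Lemma simple_neq0 : u <> 0.
Proof.
move=> u0; apply: rd_p_neq0; rewrite -[p]mulr1; apply/(sd_rel DP).
by rewrite u0 ract0l.
Qed.

Lemma simple_inv a : u ◁ a <> 0 -> exists b, u ◁ a ◁ b = u.
Proof.
move=> ua; have [|b bE] := rd_pA_simple D (a := a).
  by move=> pa; apply: ua; apply/(sd_rel DP).
by exists b; rewrite -[u in LHS](sd_up DP) -!ractM mulrA bE (sd_up DP).
Qed.

Lemma hom0_simplel (M : fgmod A^c) : hom0 P M <-> forall x : M, x ◁ p = 0.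
Proof.
split=> [h x|h f y]; last first.
  have [a ->] := sd_gen DP y; rewrite ract_linear -(sd_up DP) ract_linear.
  by rewrite h ract0l.
pose G y z := exists a, y = u ◁ a /\ z = x ◁ p ◁ a.
have [y|_ _ _ _ [a [-> ->]] [b [-> ->]]|_ _ b [a [-> ->]]|y [a [ua ->]]|f fE] :=
  @linear_of_graph_ract A P M G.
- by have [a ->] := sd_gen DP y; exists (x ◁ p ◁ a), a.
- by exists (a + b); rewrite !ractDr.
- by exists (a * b); rewrite !ractM.
- by rewrite -ractM (sd_rel DP a).1 ?ract0r.
by rewrite -(h f u); apply/fE; exists 1; rewrite !ract1.
Qed.

(** The quotient of M by the submodule generated by M e is a vector space over
    the division ring pAp, so it maps onto P unless it is zero. *)
Lemma hom0_simpler (M : fgmod A^c) : hom0 M P <-> forall x : M, generated_at_e x.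
Proof.
split=> [h x|h f x].
- have [L [q [qS qE]]] := quotient_module (generated_at_e_submodule M).
  have Le (l : L) : l ◁ e = 0.
    have [y <-] := qS l; rewrite -ract_linear; apply/qE/generated_at_e_of.
    exact: ract_ee.
  have Lpl (l : L) : l ◁ p = l by rewrite -[RHS]ract_pe Le addr0.
  apply/qE; apply: contrapT => qx.
  have [r l rl|r rl||f [l fl]] := @map_onto_generator A^c P L u (fgmodP L).
  + rewrite -[l]Lpl -[_ *: _]/(l ◁ p ◁ r) -ractM.
    by rewrite ((sd_rel DP r).1 rl) ract0r.
  + have [b bE] : exists b, p * r * b = p.
      by apply: (rd_pA_simple D) => pr; apply: rl; apply/(sd_rel DP).
    exists b => l; rewrite -[LHS]/(l ◁ r ◁ b) -[l]Lpl -!ractM mulrA bE Lpl //.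
  + by exists (q x).
  have [y yl] := qS l.
  by apply: simple_neq0; rewrite -fl -yl; apply: (h (f \o q)%FUN).
- have [m me mE] := h x.
  rewrite -[f x]ract_pe simple_e addr0 -ract_linear mE racts_linear.
  rewrite (eq_racts (y := fun=> 0)) ?racts0l // => j /=.
  by rewrite -me ract_linear simple_e.
Qed.

Lemma simple_not_hom0 : ~ hom0 P P.
Proof. by move=> /(_ idfun u); apply: simple_neq0. Qed.

(** A nonzero map to P is surjective. *)
Lemma simple_quotient (M : fgmod A^c) : ~ hom0 M P ->
  forall W, hom0 M W -> hom0 P W.
Proof.
move=> nMP W MW g y; apply: contrapT => gy; apply: nMP => f x.
apply: contrapT => fx; apply: gy; have [a ua] := sd_gen DP (f x).
have [b bE] : exists b, u ◁ a ◁ b = u by apply: simple_inv; rewrite -ua.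
have [c ->] := sd_gen DP y; rewrite -bE -ua -!ract_linear.
exact: (MW (g \o f)%FUN).
Qed.

(** The quotient by M p, which is a submodule because pAe = 0. *)
Lemma calP_reflection (M : fgmod A^c) : exists (N : fgmod A^c) (q : {linear M -> N}),
  [/\ surj q, hom0 P N, forall x, q x = 0 <-> x ◁ e = 0 &
      forall M', hom0 P M' -> (hom0 M M' <-> hom0 N M')].
Proof.
have Ms : submodule (fun x : M => x ◁ e = 0).
  apply: submodule_ract => [|x y xe ye|x a xe]; first by rewrite ract0l.
    by rewrite ractDl xe ye addr0.
  by rewrite ract_ae xe !ract0l.
have [N [q [qS qE]]] := quotient_module Ms; exists N, q; split=> //.
  apply/hom0_simplel => y; have [x <-] := qS y; rewrite -ract_linear; apply/qE.
  by rewrite -ractM rd_pe ract0r.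
move=> M' /hom0_simplel PM'; split=> h f x; last first.
  have [|g gE] := factor_surj (f := f) qS; last by rewrite -gE h.
  by move=> y /qE ye; rewrite -[y]ract_pe ye addr0 ract_linear PM'.
by have [y <-] := qS x; apply: (h (f \o q)%FUN).
Qed.

Variables (k : fieldType) (s : {rmorphism k -> A^c}).
Hypothesis A_fd : finitely_generated (restr s ((A^c)^o : lmodType A^c)).

(** The submodule generated by M' e. *)
Lemma calT_coreflection (M' : fgmod A^c) : exists2 N', hom0 N' P &
  forall M, hom0 M P -> (hom0 M M' <-> hom0 M N').
Proof.
have [N' [i [iI iE]]] := submodule_object A_fd (generated_at_e_submodule M').
exists N'.
  apply/hom0_simpler => x; have /iE [m me mE] : exists y, i y = i x by exists x.
  have [l lE] := choice (fun j => (iE (m j)).1 (generated_at_e_of (me j))).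
  exists l => [j|]; apply: iI; first by rewrite ract_linear lE me.
  by rewrite ract_linear mE racts_linear; apply: eq_racts => j; rewrite -lE.
move=> M /hom0_simpler MP; split=> h f x.
  by apply: iI; rewrite linear0; apply: (h (i \o f)%FUN).
have [|g gE] := factor_inj (f := f) iI; last by rewrite -gE h linear0.
by move=> y; apply/iE/generated_at_e_linear.
Qed.

End Simple.
End Reflection.

(** * Triangular algebras with a division corner *)

Record triangular_data (G : nzRingType) (f q : G) : Prop := TriangularData {
  td_fq1 : f + q = 1;
  td_fGq : forall a, f * a * q = 0;
  td_q_div : forall a, q * a * q <> 0 -> exists b, q * a * q * b = q;
  td_q_neq0 : q <> 0
}.

Record simple_top_data (G : nzRingType) (q : G) (S : lmodType G^c) (s0 : S) : Prop :=
    SimpleTopData {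
  st_gen : forall x, exists a, x = s0 ◁ a;
  st_rel : forall a, s0 ◁ a = 0 <-> q * a * q = 0
}.

Section Triangular.
Variables (G : nzRingType) (f q : G).
Hypothesis D : triangular_data f q.

Lemma td_fq : f * q = 0. Proof. by have := td_fGq D 1; rewrite mulr1. Qed.
Lemma td_qq : q * q = q.
Proof. by rewrite -[RHS]mul1r -(td_fq1 D) mulrDl td_fq add0r. Qed.
Lemma td_ff : f * f = f.
Proof. by rewrite -[RHS]mulr1 -(td_fq1 D) mulrDr td_fq addr0. Qed.
Lemma td_qaq a : q * a * q = a * q.
Proof. by rewrite -[a in RHS]mul1r -(td_fq1 D) !mulrDl (td_fGq D) add0r. Qed.

Section Modules.
Variable Z : lmodType G^c.
Implicit Types z : Z.
Lemma ract_fq1 z : z ◁ f + z ◁ q = z.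
Proof. by rewrite -ractDr (td_fq1 D) ract1. Qed.
Lemma ract_faq z a : z ◁ f ◁ a ◁ q = 0.
Proof. by rewrite -!ractM mulrA (td_fGq D) ract0r. Qed.
Lemma ract_aq z a : z ◁ a ◁ q = z ◁ q ◁ a ◁ q.
Proof. by rewrite -[z in LHS]ract_fq1 !ractDl ract_faq add0r. Qed.

Lemma f_submodule : submodule (fun z => z ◁ q = 0).
Proof.
apply: submodule_ract => [|x y xe ye|x a xe]; first by rewrite ract0l.
  by rewrite ractDl xe ye addr0.
by rewrite ract_aq xe !ract0l.
Qed.

Lemma f_annihilated_submodule : submodule (fun z => forall a, z ◁ a ◁ f = 0).
Proof.
apply: submodule_ract => [a|x y xe ye a|x b xe a]; first by rewrite !ract0l.
  by rewrite !ractDl xe ye addr0.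
by rewrite -[x ◁ b ◁ a]ractM xe.
Qed.
End Modules.

(** The top of qG, written as the quotient of G by the right ideal of the a with
    q a q = 0. *)
Lemma simple_top_exists : exists (S : fgmod G^c) (s0 : S), simple_top_data q s0.
Proof.
pose M := regular_module G^c.
have ME (x : M) a : x ◁ a = (x : G) * a by [].
have Ks : submodule (fun x : M => q * (x : G) * q = 0).
  apply: submodule_ract => [|x y xq yq|x a xq].
  - by rewrite mulr0 mul0r.
  - by rewrite mulrDr mulrDl xq yq addr0.
  - by rewrite ME -!mulrA -td_qaq !mulrA xq !mul0r.
have [S [r [rS rE]]] := quotient_module Ks.
exists S, (r (1 : G)); split=> [x|a].
  by have [a <-] := rS x; exists a; rewrite -ract_linear ME mul1r.
by rewrite -ract_linear ME mul1r; apply: rE.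
Qed.

Variables (S : fgmod G^c) (s0 : S).
Hypothesis DS : simple_top_data q s0.

Lemma top_f (x : S) : x ◁ f = 0.
Proof.
have [a ->] := st_gen DS x; rewrite -ractM; apply/(st_rel DS).
by rewrite -!mulrA td_fq !mulr0.
Qed.

Lemma top_neq0 : s0 <> 0.
Proof.
rewrite -[s0]ract1 => /(st_rel DS); rewrite mulr1 td_qq.
exact: (td_q_neq0 D).
Qed.

Lemma top_q : s0 ◁ q = s0.
Proof. by rewrite -[RHS]ract_fq1 top_f add0r. Qed.

Lemma top_inv a : s0 ◁ a <> 0 -> exists b, s0 ◁ a ◁ b = s0.
Proof.
move=> sa; have [|b bE] := td_q_div D (a := a).
  by move=> qa; apply: sa; apply/(st_rel DS).
exists (q * b); rewrite -[s0 in LHS]top_q -!ractM.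
by rewrite !mulrA bE top_q.
Qed.

Lemma hom0_topl (Y : fgmod G^c) :
  hom0 S Y <-> forall y : Y, (forall a, y ◁ a ◁ f = 0) -> y = 0.
Proof.
split=> [h y yf|h g x]; last first.
  by apply: h => a; rewrite -!ract_linear top_f linear0.
have yq : y ◁ q = y.
  by have yf1 := yf 1; rewrite ract1 in yf1; rewrite -[RHS]ract_fq1 yf1 add0r.
have yE a : y ◁ (q * a * q) = y ◁ a.
  by rewrite !ractM yq -[RHS]ract_fq1 yf add0r.
pose H x z := exists a, x = s0 ◁ a /\ z = y ◁ a.
have [x|_ _ _ _ [a [-> ->]] [b [-> ->]]|_ _ b [a [-> ->]]|z [a [sa ->]]|g gE] :=
  @linear_of_graph_ract G S Y H.
- by have [a ->] := st_gen DS x; exists (y ◁ a), a.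
- by exists (a + b); rewrite !ractDr.
- by exists (a * b); rewrite !ractM.
- by rewrite -yE ((st_rel DS a).1 (esym sa)) ract0r.
by rewrite -(h g s0); apply/gE; exists 1; rewrite !ract1.
Qed.

(** S is injective: Z f is a submodule, and Z / Z f is a vector space over qGq,
    so a nonzero Z q yields a nonzero map from Z to S. *)
Lemma hom0_topr (Z : fgmod G^c) : hom0 Z S <-> forall z : Z, z ◁ q = 0.
Proof.
split=> [h z|h g z]; last first.
  by rewrite -[g z]ract_fq1 top_f add0r -ract_linear h linear0.
have [L [r [rS rE]]] := quotient_module (f_submodule Z).
have Lf (l : L) : l ◁ f = 0.
  have [y <-] := rS l; rewrite -ract_linear; apply/rE.
  by rewrite -ractM td_fq ract0r.
have Lq (l : L) : l ◁ q = l by rewrite -[RHS]ract_fq1 Lf add0r.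
have LqE (l : L) a : l ◁ (q * a * q) = l ◁ a by rewrite !ractM !Lq.
apply/rE; apply: contrapT => rz.
have [a l al|a al||g [l gl]] := @map_onto_generator G^c S L s0 (fgmodP L).
- by rewrite -[LHS]/(l ◁ a) -LqE ((st_rel DS a).1 al) ract0r.
- have [|b bE] := td_q_div D (a := a); first by move=> qa; apply: al; apply/(st_rel DS).
  by exists b => l; rewrite -[LHS]/(l ◁ a ◁ b) -[l ◁ a]LqE -ractM bE Lq.
- by exists (r z).
have [y yl] := rS l.
by apply: top_neq0; rewrite -gl -yl; apply: (h (g \o r)%FUN).
Qed.

Lemma top_not_hom0 : ~ hom0 S S.
Proof. by move=> /(_ idfun s0); apply: top_neq0. Qed.

Lemma top_quotient (Z : fgmod G^c) : ~ hom0 Z S -> forall W, hom0 Z W -> hom0 S W.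
Proof.
move=> nZS W ZW g y; apply: contrapT => gy; apply: nZS => h z.
apply: contrapT => hz; apply: gy; have [a sa] := st_gen DS (h z).
have [b bE] : exists b, s0 ◁ a ◁ b = s0 by apply: top_inv; rewrite -sa.
have [c ->] := st_gen DS y; rewrite -bE -sa -!ract_linear.
exact: (ZW (g \o h)%FUN).
Qed.

(** The quotient by the largest submodule annihilated by f, the trace of S. *)
Lemma calY_reflection (Z : fgmod G^c) : exists (Y : fgmod G^c),
  [/\ hom0 S Y, forall Y', hom0 S Y' -> (hom0 Z Y' <-> hom0 Y Y'),
      hom0 Z S -> hom0 Y S & forall Z', hom0 Z Z' -> hom0 Y Z'].
Proof.
have [Y [r [rS rE]]] := quotient_module (f_annihilated_submodule Z).
have quotr Z' : hom0 Z Z' -> hom0 Y Z'.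
  by move=> h g y; have [z <-] := rS y; apply: (h (g \o r)%FUN).
exists Y; split=> //; last exact: quotr.
  apply/hom0_topl => y; have [z <-] := rS y => rzf; apply/rE => a.
  have /rE/(_ 1) : r (z ◁ a ◁ f) = 0 by rewrite !ract_linear rzf.
  by rewrite ract1 -[_ ◁ f ◁ f]ractM td_ff.
move=> Y' /hom0_topl SY'; split=> [|h g z]; first exact: quotr.
have [|g' g'E] := factor_surj (f := g) rS; last by rewrite -g'E h.
by move=> x /rE xf; apply: SY' => a; rewrite -!ract_linear xf linear0.
Qed.

Variables (k : fieldType) (s : {rmorphism k -> G^c}).
Hypothesis G_fd : finitely_generated (restr s ((G^c)^o : lmodType G^c)).

(** The submodule Z f, which is the kernel of q because fGq = 0. *)
Lemma calS_coreflection (Z : fgmod G^c) : exists (N : fgmod G^c) (i : {linear N -> Z}),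
  [/\ injective i, hom0 N S, forall z, z ◁ q = 0 <-> exists x, i x = z &
    forall Z', hom0 Z' S -> (hom0 Z' Z <-> hom0 Z' N)].
Proof.
have [N [i [iI iE]]] := submodule_object G_fd (f_submodule Z); exists N, i; split=> //.
  apply/hom0_topr => x; apply: iI; rewrite ract_linear linear0; apply/iE.
  by exists x.
move=> Z' /hom0_topr Z'S; split=> h g z.
  by apply: iI; rewrite linear0; apply: (h (i \o g)%FUN).
have [|g' g'E] := factor_inj (f := g) iI; last by rewrite -g'E h linear0.
by move=> y; apply/iE; rewrite -ract_linear Z'S linear0.
Qed.

End Triangular.

(** * The endomorphism algebra of the tilting module *)

Lemma falg_opposite_fd (k : fieldType) (A : falgType k) (s : {rmorphism k -> A^c}) :
  (forall c, s c = c%:A :> A) ->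
  finitely_generated (restr s ((A^c)^o : lmodType A^c)).
Proof.
move=> sE; pose b := vbasis {: A}.
exists (\dim {: A}), (fun i => b`_i) => x.
exists (fun i => coord b i x); rewrite [LHS](coord_vbasis (memvf (x : A))).
apply: eq_bigr => i _; rewrite restrZ -[RHS]/((b`_i : A) * (s _ : A)) sE.
by rewrite mulr_algr.
Qed.

Lemma falg_fd (k : fieldType) (A : falgType k) :
  exists s : {rmorphism k -> A}, (forall c, s c = c%:A) /\
    finitely_generated (restr s (A^o : lmodType A)).
Proof.
exists (in_alg A); split=> //; pose b := vbasis {: A}.
exists (\dim {: A}), (fun i => b`_i) => x.
exists (fun i => coord b i x); rewrite [LHS](coord_vbasis (memvf (x : A))).
apply: eq_bigr => i _; rewrite restrZ -[RHS]/((_%:A : A) * (b`_i : A)).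
by rewrite mulr_algl.
Qed.

Lemma change_of_rings (R R' : nzRingType) (M : lmodType R) (th : R' -> R) :
  (forall a b (m : M), th (a + b) *: m = th a *: m + th b *: m) ->
  (forall a b (m : M), th (a * b) *: m = th a *: (th b *: m)) ->
  (forall m : M, th 1 *: m = m) ->
  exists (M' : lmodType R') (h : M -> M'),
    [/\ bijective h, forall x y, h (x + y) = h x + h y
      & forall r x, h (th r *: x) = r *: h x].
Proof.
move=> thD thM th1; pose sc r (m : M) : M := th r *: m.
have scA a b v : sc a (sc b v) = sc (a * b) v by rewrite /sc thM.
have sc1 : left_id 1 sc by exact: th1.
have scDr : right_distributive sc +%R by move=> a x y; apply: scalerDr.
have scDl v : {morph sc^~ v : a b / a + b} by move=> a b; apply: thD.
pose M' : lmodType R' := HB.pack (M : Type) (GRing.Zmodule.on M)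
  (GRing.Zmodule_isLmodule.Build R' M scA sc1 scDr scDl).
by exists M', id; split=> //; exists id.
Qed.

Lemma change_of_rings_fg (k : fieldType) (R R' : nzRingType)
    (s : {rmorphism k -> R}) (s' : {rmorphism k -> R'})
    (M : fgmod R) (th : R' -> R) :
  finitely_generated (restr s (R^o : lmodType R)) ->
  (forall c (m : M), th (s' c) *: m = s c *: m) ->
  (forall a b (m : M), th (a + b) *: m = th a *: m + th b *: m) ->
  (forall a b (m : M), th (a * b) *: m = th a *: (th b *: m)) ->
  (forall m : M, th 1 *: m = m) ->
  exists (M' : fgmod R') (h : M -> M'),
    [/\ bijective h, forall x y, h (x + y) = h x + h y
      & forall r x, h (th r *: x) = r *: h x].
Proof.
move=> R_fd ths thD thM th1; have [M' [h [hB hD hZ]]] := change_of_rings thD thM th1.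
suff fgM' : finitely_generated M' by exists (Fgmod fgM'), h.
have [n [g Hg]] := (fg_restrP R_fd M).1 (fgmodP M).
exists n, (h \o g) => y; have [x <-] : exists x, h x = y.
  by case: hB => h' _ hK; exists (h' y).
have [c ->] := Hg x; exists (fun i => s' (c i)).
have h0 : h 0 = 0 by apply: (addrI (h 0)); rewrite -hD !addr0.
elim/big_rec2: _ => // i y1 y2 _ <-.
by rewrite hD /= -hZ ths.
Qed.

Section Endomorphisms.
Variables (k : fieldType) (A G : falgType k).
Variables (p e : A) (n : nat) (w : 'cV[A]_n) (eps : 'M[A]_n).
Variables (T : fgmod A^c) (t0 : T) (nu : 'I_n -> T).
Hypothesis D : reflection_data p e w eps t0 nu.
Variable phi : G -> {linear T -> T}.
Hypothesis phi1 : forall x, phi 1 x = x.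
Hypothesis phiM : forall a b x, phi (a * b) x = phi a (phi b x).
Hypothesis phiL : forall (c : k) a b x,
  phi (c *: a + b) x = (c%:A : A^c) *: phi a x + phi b x.
Hypothesis phiI : forall a b, (forall x, phi a x = phi b x) -> a = b.
Hypothesis phiS : forall f : {linear T -> T}, exists a, forall x, phi a x = f x.

Lemma phiD a b x : phi (a + b) x = phi a x + phi b x.
Proof. by rewrite -[a]scale1r phiL !scale1r. Qed.

Lemma phi0 x : phi 0 x = 0.
Proof. by apply: (addrI (phi 0 x)); rewrite -phiD !addr0. Qed.

Lemma phiZ c a x : phi (c *: a) x = phi a x ◁ c%:A.
Proof. by rewrite -[c *: a]addr0 phiL phi0 addr0. Qed.

Lemma endo_ext a b : phi a t0 = phi b t0 ->
  (forall j, phi a (nu j) = phi b (nu j)) -> a = b.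
Proof. by move=> ab0 abnu; apply: phiI; apply: (tilting_hom_ext D). Qed.

Lemma endo_exists (m : T) (kap : 'I_n -> T) :
  m ◁ e = m -> (forall j, kap j ◁ e = kap j) ->
  (forall j, racts kap eps j = kap j) -> racts kap w ord0 = 0 ->
  exists a, phi a t0 = m /\ forall j, phi a (nu j) = kap j.
Proof.
move=> me ke keps kw; have [f [f0 fnu]] := tilting_hom D me ke keps kw.
by have [a aE] := phiS f; exists a; split=> [|j]; rewrite aE.
Qed.

(** The projections of T onto eA and onto N. *)
Definition splitting_idempotents (f q : G) : Prop :=
  [/\ phi f t0 = t0, forall j, phi f (nu j) = 0, phi q t0 = 0
    & forall j, phi q (nu j) = nu j].

Lemma splitting_idempotents_exist : exists f q, splitting_idempotents f q.
Proof.
have [|j|j||f [f0 fnu]] := @endo_exists t0 (fun=> 0).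
- exact: (rd_t0e D).
- exact: ract0l.
- exact: racts0l.
- exact: racts0l.
have [|j|j||q [q0 qnu]] := @endo_exists 0 nu.
- exact: ract0l.
- exact: (rd_nue D).
- exact: (rd_nu_eps D).
- exact: (rd_nu_w D).
by exists f, q.
Qed.

Section Idempotents.
Variables (f q : G).
Hypothesis fqP : splitting_idempotents f q.

Lemma phi_f0 : phi f t0 = t0. Proof. by case: fqP. Qed.
Lemma phi_fnu j : phi f (nu j) = 0. Proof. by case: fqP. Qed.
Lemma phi_q0 : phi q t0 = 0. Proof. by case: fqP. Qed.
Lemma phi_qnu j : phi q (nu j) = nu j. Proof. by case: fqP. Qed.

Lemma phi_f_span t : exists a, phi f t = t0 ◁ a.
Proof.
have [a [c ->]] := rd_gen D t; exists a.
rewrite linearD ract_linear phi_f0 racts_linear (eq_racts (y := fun=> 0)).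
  by rewrite racts0l addr0.
exact: phi_fnu.
Qed.

Lemma phi_q_span t : exists c : 'cV[A]_n, phi q t = racts nu c ord0.
Proof.
have [a [c ->]] := rd_gen D t; exists c.
rewrite linearD ract_linear phi_q0 ract0l add0r racts_linear.
by apply: eq_racts => j; apply: phi_qnu.
Qed.

Lemma t0_eq0 a : t0 ◁ a = 0 -> e * a = 0.
Proof.
by move=> ta; have [|] := rd_rel D (a := a) (c := 0); rewrite ?racts0r ?addr0.
Qed.

(** There is no nonzero map from N to eA: the images of nu would be a row b
    over eAe with b w = 0. *)
Lemma endo_fGq a : f * a * q = 0.
Proof.
apply: endo_ext => [|j]; rewrite !phiM phi0; first by rewrite phi_q0 !linear0.
rewrite phi_qnu; pose kap j := phi f (phi a (nu j)).
have [b bE] := choice (fun j => phi_f_span (phi a (nu j))).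
pose B : 'rV[A]_n := \row_j (e * b j * e).
have kapE i : kap i = t0 ◁ (B ord0 i).
  by rewrite mxE !ractM (rd_t0e D) -bE -!ract_linear (rd_nue D).
have kapM m (C : 'M[A]_(n, m)) i : racts kap C i = t0 ◁ ((B *m C) ord0 i).
  by rewrite mxE ract_sumr; apply: eq_bigr => h _; rewrite kapE ractM.
have Bw : B *m w = 0.
  apply/matrixP => i h; rewrite [i]ord1 [h]ord1 [RHS]mxE.
  have /t0_eq0 : t0 ◁ ((B *m w) ord0 ord0) = 0.
    rewrite -kapM -[kap]/((phi f \o phi a)%FUN \o nu).
    by rewrite -racts_linear (rd_nu_w D) linear0.
  move=> E; rewrite -[RHS]E mxE mulr_sumr; apply: eq_bigr => l _.
  by rewrite !mxE !mulrA (rd_ee D).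
rewrite -(rd_nu_eps D j) !racts_linear [LHS](kapM _ eps j) (rd_w_free D Bw).
by rewrite mxE ract0r.
Qed.

(** End(N) is a division ring.  An endomorphism is a matrix B over eAe with
    eps B w = w d for some d, because it preserves the relation nu w = 0.  If
    p d = 0 then B acts as zero.  Otherwise pA being simple gives b with
    p d b = p, and a matrix B' with B' w = w b p is an inverse. *)
Lemma endo_q_div a : q * a * q <> 0 -> exists b, q * a * q * b = q.
Proof.
move=> qaq; pose kap j := phi (q * a * q) (nu j).
have [c cE] := choice (fun j => phi_q_span (phi a (nu j))).
pose B : 'M[A]_n := \matrix_(i, j) (c j i ord0 * e).
have kapE j : kap j = racts nu B j.
  rewrite /kap !phiM phi_qnu -(rd_nue D) !ract_linear cE ractsZ.
  by apply: eq_bigr => i _; rewrite mxE.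
have kapM m (C : 'M[A]_(n, m)) i : racts kap C i = racts nu (B *m C) i.
  by rewrite ractsM; apply: eq_racts.
have [|_ [d dE]] := rd_rel D (a := 0) (c := B *m w).
  by rewrite ract0r add0r -kapM -racts_linear (rd_nu_w D) linear0.
have pd : p * d <> 0.
  move=> pd; apply: qaq; apply: endo_ext => [|j]; rewrite phi0.
    by rewrite !phiM phi_q0 !linear0.
  have : eps *m B *m eps = 0.
    apply: (rd_w_free_mx D); rewrite -mulmxA dE -(rd_wscale_p D) pd.
    by apply/matrixP => i l; rewrite mul_mx_scalar_r !mxE mulr0.
  rewrite -[nu j](rd_nu_eps D) racts_linear kapM => E.
  rewrite -(eq_racts (x := racts nu eps)); last exact: (rd_nu_eps D).
  by rewrite -ractsM mulmxA E racts0r.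
have [b pdb] := rd_pA_simple D pd.
have [|B' B'w] := rd_w_span_mx D (x := w *m (b * p)%:M).
  by move=> i; rewrite mul_mx_scalar_r mxE mulrA (rd_ew D) -!mulrA (rd_pp D).
have [|j|j||g [g0 gnu]] := @endo_exists 0 (racts nu (B' *m eps)).
- exact: ract0l.
- rewrite ractsZ; apply: eq_bigr => i _; congr (_ ◁ _).
  by rewrite mxE mulr_suml; apply: eq_bigr => l _; rewrite -mulrA (rd_epse D).
- by rewrite -ractsM -mulmxA (rd_eps_eps D).
- rewrite -ractsM -mulmxA (rd_eps_w D) B'w ractsM racts_scalar.
  by rewrite (rd_nu_w D) ract0l.
exists g; apply: endo_ext => [|j]; rewrite [LHS]phiM ?g0 ?linear0 ?phi_q0 //.
rewrite gnu racts_linear phi_qnu -[RHS](rd_nu_eps D) kapM.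
rewrite -(eq_racts (x := racts nu eps)); last exact: (rd_nu_eps D).
rewrite -ractsM; congr (racts _ _ _).
apply/eqP; rewrite -subr_eq0 !mulmxA -[X in _ - X]mul1mx -mulmxBl; apply/eqP.
apply: (rd_w_free_mx D); rewrite mulmxBl mul1mx -[_ *m B' *m w]mulmxA B'w.
rewrite mulmxA -[eps *m B *m w]mulmxA dE -(rd_wscale_p D) -mulmxA -scalar_mxM.
rewrite mulrA pdb (rd_pp D) -[p]mulr1 (rd_wscale_p D).
by rewrite mulmx1 subrr.
Qed.

Lemma endo_triangular : triangular_data f q.
Proof.
split.
- apply: endo_ext => [|j]; rewrite phiD phi1.
    by rewrite phi_f0 phi_q0 addr0.
  by rewrite phi_fnu phi_qnu add0r.
- exact: endo_fGq.
- exact: endo_q_div.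
- move=> q0; have [j] := tilting_nu_neq0 D; apply.
  by rewrite -phi_qnu q0 phi0.
Qed.


(** * Modules over the common corner *)

(** The component of g in fGf = End(eA) = eAe. *)
Definition corner (g : G) (a : A) : Prop := phi f (phi g t0) = t0 ◁ a.

Lemma corner_exists g : exists a, corner g a.
Proof. exact: phi_f_span. Qed.

Lemma corner_eq g a b : corner g a -> corner g b -> e * a = e * b.
Proof.
rewrite /corner => -> /eqP; rewrite -subr_eq0 -ractBr => /eqP/t0_eq0.
by rewrite mulrBr => /eqP; rewrite subr_eq0 => /eqP.
Qed.

Lemma phi_fq x : phi f x + phi q x = x.
Proof. by rewrite -phiD (td_fq1 endo_triangular) phi1. Qed.

Lemma phi_fgq g x : phi f (phi g (phi q x)) = 0.
Proof. by rewrite -[phi g _]phiM -phiM mulrA endo_fGq phi0. Qed.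

Lemma cornerM g h a b : corner g a -> corner h b -> corner (g * h) (a * b).
Proof.
move=> ga hb; rewrite /corner phiM -[phi h t0]phi_fq 2!linearD hb.
by rewrite phi_fgq addr0 !ract_linear ga ractM.
Qed.

Lemma cornerD g h a b : corner g a -> corner h b -> corner (g + h) (a + b).
Proof. by move=> ga hb; rewrite /corner phiD linearD ga hb ractDr. Qed.

Lemma corner1 : corner 1 1.
Proof. by rewrite /corner phi1 phi_f0 ract1. Qed.

Lemma corner_scalar c : corner c%:A c%:A.
Proof. by rewrite /corner phiZ phi1 ract_linear phi_f0. Qed.

Lemma corner_q : corner q 0.
Proof. by rewrite /corner phi_q0 linear0 ract0r. Qed.

Lemma corner_e g a : corner g a -> t0 ◁ a ◁ e = t0 ◁ a.
Proof. by move=> <-; rewrite -!ract_linear (rd_t0e D). Qed.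

Lemma endo_at_e (m : T) : m ◁ e = m ->
  exists g, phi g t0 = m /\ forall j, phi g (nu j) = 0.
Proof.
move=> me; apply: endo_exists me _ _ _ => [j|j|]; first exact: ract0l.
  exact: racts0l.
exact: racts0l.
Qed.

Lemma corner_lift a : exists g,
  [/\ phi g t0 = t0 ◁ (a * e), forall j, phi g (nu j) = 0 & corner g (a * e)].
Proof.
have [|g [g0 gnu]] := @endo_at_e (t0 ◁ (a * e)).
  by rewrite -ractM -mulrA (rd_ee D).
by exists g; split=> //; rewrite /corner g0 ract_linear phi_f0.
Qed.

(** N and Z are the same module over the common corner, on which both algebras
    act through their projection to the corner. *)
Definition corner_iso (N : fgmod A^c) (Z : fgmod G^c) : Prop :=
  [/\ forall x : N, x ◁ p = 0, forall z : Z, z ◁ q = 0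
    & exists h : N -> Z, [/\ bijective h, forall x y, h (x + y) = h x + h y
        & forall g a x, corner g a -> h (x ◁ a) = h x ◁ g]].

Lemma ract_at_e (N : lmodType A^c) (x : N) a b :
  (forall x : N, x ◁ p = 0) -> e * a = e * b -> x ◁ a = x ◁ b.
Proof.
move=> Np ab; have xe : x ◁ e = x by rewrite -[RHS](ract_pe D) Np add0r.
by rewrite -xe -!ractM ab.
Qed.

Variables (sA : {rmorphism k -> A^c}) (sG : {rmorphism k -> G^c}).
Hypothesis sAE : forall c, sA c = c%:A :> A.
Hypothesis sGE : forall c, sG c = c%:A :> G.

Let A_fd := falg_opposite_fd sAE.
Let G_fd := falg_opposite_fd sGE.

(** The projection of G to the corner is a ring morphism, along which N becomes
    a module over G. *)
Lemma corner_iso_totall (N : fgmod A^c) : (forall x : N, x ◁ p = 0) ->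
  exists Z, corner_iso N Z.
Proof.
move=> Np; have [th thE] := choice corner_exists.
have thP (x : N) g a : corner g a -> x ◁ th g = x ◁ a.
  by move=> ga; apply: ract_at_e => //; apply: corner_eq ga.
have [c m|a b m|a b m|m|Z [h [hB hD hZ]]] :=
  @change_of_rings_fg k A^c G^c sA sG N (th : G^c -> A^c) A_fd.
- by rewrite [LHS](thP _ _ (sA c)) //; rewrite sGE sAE; apply: corner_scalar.
- by rewrite [LHS](thP _ _ _ (cornerD (thE a) (thE b))) ractDr.
- by rewrite [LHS](thP _ _ _ (cornerM (thE b) (thE a))) ractM.
- by rewrite [LHS](thP _ _ _ corner1) ract1.
have h0 : h 0 = 0 by apply: (addrI (h 0)); rewrite -hD !addr0.
have hc g a x : corner g a -> h (x ◁ a) = h x ◁ g.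
  by move=> ga; rewrite -(thP _ _ _ ga); apply: hZ.
exists Z; split=> // [z|]; last by exists h.
case: hB => h' _ hK; rewrite -[z]hK -(hc _ _ _ corner_q).
by rewrite ract0r h0.
Qed.

(** The map from A to G sending a to the endomorphism of eA given by e a e is
    multiplicative and sends 1 to f, which acts on Z as the identity. *)
Lemma corner_iso_totalr (Z : fgmod G^c) : (forall z : Z, z ◁ q = 0) ->
  exists N, corner_iso N Z.
Proof.
move=> Zq; have TD := endo_triangular.
have [th thE] := choice corner_lift.
have th_eq g a : phi g t0 = t0 ◁ (a * e) -> (forall j, phi g (nu j) = 0) -> th a = g.
  case: (thE a) => E0 Enu _ g0 gnu; apply: endo_ext => [|j]; first by rewrite E0 g0.
  by rewrite Enu gnu.
have Zf (z : Z) : z ◁ f = z by rewrite -[RHS](ract_fq1 TD) Zq addr0.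
have [c m|a b m|a b m|m|N [h [hB hD hZ]]] :=
  @change_of_rings_fg k G^c A^c sG sA Z (th : A^c -> G^c) G_fd.
- have Ec : th (sA c) = f * c%:A.
    apply: th_eq => [|j]; rewrite phiM phiZ phi1 ract_linear; last first.
      by rewrite phi_fnu ract0l.
    by rewrite phi_f0 sAE mulr_algl -(mulr_algr c e) ractM (rd_t0e D).
  rewrite [LHS](_ : _ = m ◁ (f * c%:A)); last by rewrite -Ec.
  by rewrite ractM Zf -sGE.
- rewrite [LHS](_ : _ = m ◁ (th a + th b)); first exact: ractDr.
  apply: (congr1 (ract m)).
  case: (thE a) (thE b) => a0 anu _ [b0 bnu _].
  apply: th_eq => [|j]; rewrite phiD ?a0 ?b0 ?anu ?bnu ?addr0 //.
  by rewrite -ractDr -mulrDl.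
- rewrite [LHS](_ : _ = m ◁ (th b * th a)); first exact: ractM.
  apply: (congr1 (ract m)).
  case: (thE a) (thE b) => a0 anu _ [b0 bnu _].
  apply: th_eq => [|j]; rewrite phiM ?anu ?linear0 // a0 ract_linear b0 -ractM.
  by rewrite -[X in _ ◁ X = _]mulrA [e * (_ * e)]mulrA (rd_eaeE D) mulrA.
- rewrite [LHS](_ : _ = m ◁ f) //; apply: (congr1 (ract m)).
  by apply: th_eq => [|j]; rewrite ?phi_f0 ?phi_fnu // mul1r (rd_t0e D).
have h0 : h 0 = 0 by apply: (addrI (h 0)); rewrite -hD !addr0.
have hc g a z : corner g a -> h (z ◁ g) = h z ◁ a.
  move=> ga; rewrite -[RHS]hZ; congr h; rewrite [RHS](_ : _ = z ◁ th a) //.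
  case: (thE a) => E0 Enu _.
  rewrite -[z]Zf -[LHS]Zf -[RHS]Zf -!ractM; congr (_ ◁ _).
  apply: endo_ext => [|j]; last by rewrite !phiM phi_fnu !linear0.
  rewrite !phiM phi_f0 ga E0 ract_linear phi_f0 ractM.
  by rewrite (corner_e ga).
have [h' hK h'K] := hB.
exists N; split=> // [x|].
  rewrite -[x]h'K -[LHS]hZ [X in h X](_ : _ = h' x ◁ th p) //.
  rewrite (th_eq 0) ?ract0r ?h0 // => [|j]; last exact: phi0.
  by rewrite phi0 (rd_pe D) ract0r.
exists h'; split; first by exists h.
  by move=> x y; apply: (can_inj hK); rewrite hD !h'K.
by move=> g a x ga; apply: (can_inj hK); rewrite (hc _ _ _ ga) !h'K.
Qed.

Lemma corner_iso_hom0 N Z N' Z' : corner_iso N Z -> corner_iso N' Z' ->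
  (hom0 N N' <-> hom0 Z Z').
Proof.
case=> Np Zq [h [[l hl lh] hD hc]] [N'p Z'q [h' [[l' hl' lh'] hD' hc']]].
have lc g a z : corner g a -> l (z ◁ g) = l z ◁ a.
  by move=> ga; apply: (can_inj hl); rewrite (hc _ _ _ ga) !lh.
have lD x y : l (x + y) = l x + l y by apply: (can_inj hl); rewrite hD !lh.
have lc' g a z : corner g a -> l' (z ◁ g) = l' z ◁ a.
  by move=> ga; apply: (can_inj hl'); rewrite (hc' _ _ _ ga) !lh'.
have lD' x y : l' (x + y) = l' x + l' y by apply: (can_inj hl'); rewrite hD' !lh'.
have h0' : h' 0 = 0 by apply: (addrI (h' 0)); rewrite -hD' !addr0.
have l0' : l' 0 = 0 by apply: (addrI (l' 0)); rewrite -lD' !addr0.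
have aeE (M : lmodType A^c) (Mp : forall x : M, x ◁ p = 0) (x : M) a :
    x ◁ (a * e) = x ◁ a.
  by rewrite -[RHS](ract_pe D) Mp add0r ractM.
split=> H g x.
- have [||g' g'E] := linear_exists (linear_ract (f := l' \o g \o h) _ _).
  + by move=> x1 y1; rewrite /= hD linearD lD'.
  + move=> x1 a; have [b [_ _ bE]] := corner_lift a.
    by rewrite -aeE //= (hc _ _ _ bE) ract_linear (lc' _ _ _ bE) aeE.
  by apply: (can_inj lh'); rewrite l0' -[x]lh -[LHS]g'E H.
- have [||g' g'E] := linear_exists (linear_ract (f := h' \o g \o l) _ _).
  + by move=> x1 y1; rewrite /= lD linearD hD'.
  + move=> x1 b; have [a ba] := corner_exists b.
    by rewrite /= (lc _ _ _ ba) ract_linear (hc' _ _ _ ba).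
  by apply: (can_inj hl'); rewrite h0' -[x]hl -[LHS]g'E H.
Qed.


(** * The functor Hom(T, -) *)

(** Y is isomorphic to Hom(T, M), where G acts on the right through T. *)
Definition hom_iso (M : fgmod A^c) (Y : fgmod G^c) : Prop :=
  exists eta : Y -> {linear T -> M},
  [/\ forall y z t, eta (y + z) t = eta y t + eta z t,
      forall y g t, eta (y ◁ g) t = eta y (phi g t),
      forall y, (forall t, eta y t = 0) -> y = 0
    & forall h : {linear T -> M}, exists y, forall t, eta y t = h t].

(** Evaluation at the generators t0 and nu embeds Hom(T, M) in a power of M,
    so it is finite dimensional. *)
Lemma hom_iso_totall (M : fgmod A^c) : exists Y, hom_iso M Y.
Proof.
pose K (h : T -> M) := linear h.
have [|a b Ka Kb|a h Kh|h a b x Kh|h a b x Kh|h x Kh|Y [ev [evI evS evL]]] :=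
  @function_module G^c T M (fun g : G^c => phi g : T -> T) K.
- by move=> a x y; rewrite scaler0 addr0.
- by move=> c x y; rewrite Ka Kb scalerBr opprD addrACA.
- by move=> c x y; rewrite linearP Kh.
- have [h' hE] := linear_exists Kh; by rewrite phiD -!hE linearD.
- by rewrite -phiM.
- by rewrite phi1.
have evK y : linear (ev y) by apply/evS; exists y.
have [eta etaE] := choice (fun y => linear_exists (evK y)).
have ev0 x : ev 0 x = 0.
  have := evL 1 0 0 x; rewrite scale1r addr0 phi1 => E.
  by apply: (addrI (ev 0 x)); rewrite -E addr0.
have fgY : finitely_generated Y.
  have [m [v [u [vK _]]]] := coordinates ((fg_restrP A_fd M).1 (fgmodP M)).
  pose gens (i : 'I_n.+1) : T := if unlift ord0 i is Some j then nu j else t0.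
  pose F (y : restr sG Y) : 'rV[k]_(n.+1 * m) :=
    mxvec (\matrix_(i < n.+1, j < m) v (ev y (gens i)) 0 j).
  have FL : linear F.
    move=> c x y; rewrite /F -linearP; congr mxvec; apply/matrixP => i j.
    rewrite !mxE restrZ evL sGE phiZ phi1 -[ev x _]etaE ract_linear etaE.
    have -> : ev x (gens i) ◁ c%:A = c *: (ev x (gens i) : restr sA M).
      by rewrite restrZ -sAE.
    by rewrite linearP !mxE.
  have [F' F'E] := linear_exists FL.
  apply/(fg_restrP G_fd)/(@fg_submodule_rV k _ _ F') => x y; rewrite !F'E.
  move=> /(can_inj mxvecK)/matrixP E.
  have {}E i : ev x (gens i) = ev y (gens i).
    by apply: (can_inj vK); apply/rowP => j; have := E i j; rewrite !mxE.
  apply: evI => t; rewrite -!etaE; apply: (tilting_hom_ext D) => [|j]; rewrite !etaE.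
    by have := E ord0; rewrite /gens unlift_none.
  by have := E (lift ord0 j); rewrite /gens liftK.
exists (Fgmod fgY), eta; split=> [y z t|y g t|y y0|h].
- by have := evL 1 y z t; rewrite scale1r phi1 !etaE.
- by have := evL g y 0 t; rewrite addr0 ev0 addr0 !etaE.
- by apply: evI => t; rewrite ev0 -etaE y0.
- have [|y yE] := (evS h).1; first by move=> a x z; rewrite linearP.
  by exists y => t; rewrite etaE.
Qed.

Section HomIso.
Variables (M : fgmod A^c) (Y : fgmod G^c) (eta : Y -> {linear T -> M}).
Hypothesis etaD : forall y z t, eta (y + z) t = eta y t + eta z t.
Hypothesis etaZ : forall y g t, eta (y ◁ g) t = eta y (phi g t).
Hypothesis etaI : forall y, (forall t, eta y t = 0) -> y = 0.
Hypothesis etaS : forall h : {linear T -> M}, exists y, forall t, eta y t = h t.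

Lemma eta0 t : eta 0 t = 0.
Proof. by apply: (addrI (eta 0 t)); rewrite -etaD !addr0. Qed.

Lemma eta_sum (I : Type) (r : seq I) (F : I -> Y) t :
  eta (\sum_(i <- r) F i) t = \sum_(i <- r) eta (F i) t.
Proof. by elim/big_rec2: _ => [|i x y _ <-]; rewrite ?eta0 ?etaD. Qed.

Lemma eta_eq0 y : eta y t0 = 0 -> (forall j, eta y (nu j) = 0) -> y = 0.
Proof.
move=> y0 ynu; apply: etaI => t; rewrite -[RHS](eta0 t).
by apply: (tilting_hom_ext D) => [|j]; rewrite eta0.
Qed.

Lemma eta_inj y z : eta y t0 = eta z t0 -> (forall j, eta y (nu j) = eta z (nu j)) ->
  y = z.
Proof.
have etaN x t : eta (- x) t = - eta x t.
  by apply: (addrI (eta x t)); rewrite -etaD !subrr eta0.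
move=> yz0 yznu; apply/eqP; rewrite -subr_eq0; apply/eqP/eta_eq0 => [|j].
  by rewrite etaD etaN yz0 subrr.
by rewrite etaD etaN yznu subrr.
Qed.

Lemma eta_exists (m : M) (kap : 'I_n -> M) :
  m ◁ e = m -> (forall j, kap j ◁ e = kap j) ->
  (forall j, racts kap eps j = kap j) -> racts kap w ord0 = 0 ->
  exists y, eta y t0 = m /\ forall j, eta y (nu j) = kap j.
Proof.
move=> me ke keps kw; have [h [h0 hnu]] := tilting_hom D me ke keps kw.
by have [y yE] := etaS h; exists y; split=> [|j]; rewrite yE.
Qed.

Lemma eta_at_e (m : M) : m ◁ e = m ->
  exists y, eta y t0 = m /\ forall j, eta y (nu j) = 0.
Proof.
move=> me; apply: eta_exists me _ _ _ => [j|j|]; first exact: ract0l.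
  exact: racts0l.
exact: racts0l.
Qed.

Lemma eta_torsion_free (y : Y) : (forall g, y ◁ g ◁ f = 0) -> y = 0.
Proof.
move=> yf; apply: eta_eq0 => [|j].
  by rewrite -phi_f0 -etaZ -[y]ract1 yf eta0.
have [g [g0 _]] := endo_at_e (rd_nue D j).
by rewrite -g0 -phi_f0 -!etaZ yf eta0.
Qed.
End HomIso.

Lemma hom_iso_torsion_free M Y : hom_iso M Y ->
  forall y : Y, (forall g, y ◁ g ◁ f = 0) -> y = 0.
Proof. by case=> eta [etaD etaZ etaI etaS]; apply: eta_torsion_free etaD etaZ etaI. Qed.

(** Composition with a nonzero h is nonzero because M is generated by M e, the
    set of values at t0 of maps from T. *)
Lemma hom_iso_faithful (M M' : fgmod A^c) (Y Y' : fgmod G^c) :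
  (forall x : M, generated_at_e p e w x) ->
  hom_iso M Y -> hom_iso M' Y' -> hom0 Y Y' -> hom0 M M'.
Proof.
move=> Mgen [eta [etaD etaZ etaI etaS]] [eta' [etaD' etaZ' etaI' etaS']] H h x.
have [g0 g0E] := choice (fun y => etaS' (h \o eta y)%FUN).
have g0_eq y z : (forall t, eta' y t = eta' z t) -> y = z.
  by move=> yz; apply: (eta_inj etaD' etaI') => [|j]; apply: yz.
have [||g gE] := linear_exists (linear_ract (f := g0) _ _).
- by move=> y z; apply: g0_eq => t; rewrite etaD' !g0E /= etaD linearD.
- by move=> y b; apply: g0_eq => t; rewrite etaZ' !g0E /= etaZ.
have h0 m : m ◁ e = m -> h m = 0.
  move=> me; have [y [<- _]] := eta_at_e etaS me.
  by rewrite -[LHS]g0E -gE H (eta0 etaD').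
have [m me mE] := Mgen x.
rewrite -[x](ract_pe D) linearD mE racts_linear (h0 (x ◁ e)) ?(ract_ee D) //.
by rewrite addr0 (eq_racts (y := fun=> 0)) ?racts0l // => j; apply: h0.
Qed.

(** A G-linear map g from Hom(T, M) to Hom(T, M') determines the values of a
    map h from M to M' on M e, by h (y t0) = (g y) t0, and M is generated by
    M e.  It has to be shown that a relation between elements of M e and
    scalars a is preserved.  Its component at e is a single value of h.  For
    its component at p, write e a p = B w; the relation then says that the row
    x1 B eps satisfies the relations of nu, so it is the row of values at nu
    of some y in Hom(T, M), and (g y) (nu w) = 0 is the relation sought. *)
Lemma hom_iso_full (M M' : fgmod A^c) (Y Y' : fgmod G^c) :
  (forall x : M, generated_at_e p e w x) ->
  hom_iso M Y -> hom_iso M' Y' -> hom0 M M' -> hom0 Y Y'.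
Proof.
move=> Mgen [eta [etaD etaZ etaI etaS]] [eta' [etaD' etaZ' etaI' etaS']] H g.
pose X (z : M * M') := exists y, z = (eta y t0, eta' (g y) t0).
have XS := rspan_submodule X.
pose Gr x x' := rspan X (x, x').
suff [h hE] : exists h : {linear M -> M'}, forall x x', Gr x x' <-> x' = h x.
  have gy0 y : eta' (g y) t0 = 0.
    rewrite -(H h (eta y t0)); apply/hE/rspan_in; by exists y.
  move=> y; apply: (eta_eq0 etaD' etaI') => [|j]; first exact: gy0.
  have [b [<- _]] := endo_at_e (rd_nue D j).
  by rewrite -etaZ' -ract_linear gy0.
apply: linear_of_graph_ract.
- move=> x; pose GS x := exists x', Gr x x'.
  have GSs : submodule GS.
    apply: submodule_ract => [|y z [y' hy] [z' hz]|y b [y' hy]].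
    + by exists 0; apply: (submodule0 XS).
    + by exists (y' + z'); apply: (submoduleD XS hy hz).
    + by exists (y' ◁ b); apply: (submoduleZ XS _ hy).
  have GSe m : m ◁ e = m -> GS m.
    move=> me; have [y [<- _]] := eta_at_e etaS me.
    by exists (eta' (g y) t0); apply: rspan_in; exists y.
  have [m me mE] := Mgen x; rewrite -[x](ract_pe D) mE.
  apply: (submoduleD GSs); last by apply: GSe; apply: (ract_ee D).
  by apply: (submodule_sum GSs) => j _; apply: (submoduleZ GSs); apply: GSe.
- by move=> x y x' y' hx hy; apply: (submoduleD XS hx hy).
- by move=> x y b hx; apply: (submoduleZ XS _ hx).
- move=> x' [l [z [a [Xz zE]]]]; have [ys ysE] := choice Xz.
  have /(congr1 fst) /= E1 := zE; have /(congr1 snd) /= E2 := zE.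
  have fstE (F : 'I_l -> M * M') : (\sum_h F h).1 = \sum_h (F h).1.
    by elim/big_rec2: _ => //= h y y' _ <-.
  have sndE (F : 'I_l -> M * M') : (\sum_h F h).2 = \sum_h (F h).2.
    by elim/big_rec2: _ => //= h y y' _ <-.
  rewrite {}fstE in E1; rewrite {}sndE in E2.
  have {}E1 : \sum_h eta (ys h) t0 ◁ a h = 0.
    by rewrite [RHS]E1; apply: eq_bigr => h _; rewrite ysE.
  have {}E2 : x' = \sum_h eta' (g (ys h)) t0 ◁ a h.
    by rewrite E2; apply: eq_bigr => h _; rewrite ysE.
  pose x1 h := eta (ys h) t0; pose x2 h := eta' (g (ys h)) t0.
  have x1e h : x1 h ◁ e = x1 h by rewrite -ract_linear (rd_t0e D).
  have x2e h : x2 h ◁ e = x2 h by rewrite -ract_linear (rd_t0e D).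
  have sumE (g' : 'I_l -> G) t : eta' (g (\sum_h ys h ◁ g' h)) t =
      \sum_h eta' (g (ys h)) (phi (g' h) t).
    rewrite linear_sum (eta_sum etaD'); apply: eq_bigr => h _.
    by rewrite ract_linear etaZ'.
  rewrite -[x'](ract_pe D).
  have -> : x' ◁ e = 0.
    have [c cE] := choice (fun h => corner_lift (a h)).
    have c0 h : phi (c h) t0 = t0 ◁ (a h * e) by case: (cE h).
    have cnu h j : phi (c h) (nu j) = 0 by case: (cE h).
    pose y := \sum_h ys h ◁ c h.
    have y0 : y = 0.
      apply: (eta_eq0 etaD etaI) => [|j]; rewrite (eta_sum etaD).
        transitivity ((\sum_h x1 h ◁ a h) ◁ e); last by rewrite E1 ract0l.
        rewrite ract_suml; apply: eq_bigr => h _.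
        by rewrite etaZ c0 ract_linear ractM.
      by rewrite big1 // => h _; rewrite etaZ cnu linear0.
    have := sumE c t0; rewrite -/y y0 linear0 (eta0 etaD') => ->.
    rewrite E2 ract_suml; apply: eq_bigr => h _.
    by rewrite c0 ract_linear ractM.
  rewrite addr0.
  have [|B Bw] := rd_w_span_mx D (x := \col_h (e * a h * p)).
    by move=> h; rewrite mxE !mulrA (rd_ee D) -mulrA (rd_pp D).
  have Be h j : (B *m eps) h j * e = (B *m eps) h j.
    by rewrite mxE mulr_suml; apply: eq_bigr => i _; rewrite -mulrA (rd_epse D).
  have E1w : racts x1 (B *m w) ord0 = 0.
    transitivity ((\sum_h x1 h ◁ a h) ◁ p); last by rewrite E1 ract0l.
    rewrite Bw ract_suml; apply: eq_bigr => h _.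
    by rewrite mxE !ractM x1e.
  have [|j|j||y [y0 ynu]] := @eta_exists _ _ eta etaS 0 (racts x1 (B *m eps)).
  - exact: ract0l.
  - by apply: racts_e => h i.
  - by rewrite -ractsM -mulmxA (rd_eps_eps D).
  - by rewrite -ractsM -mulmxA (rd_eps_w D).
  have y'nu j : eta' (g y) (nu j) = racts x2 (B *m eps) j.
    have t0B h : t0 ◁ (B *m eps) h j ◁ e = t0 ◁ (B *m eps) h j by rewrite -ractM Be.
    have [b bE] := choice (fun h => endo_at_e (t0B h)).
    have [c [c0 cnu]] := endo_at_e (rd_nue D j).
    have yc : y ◁ c = \sum_h ys h ◁ b h.
      apply: (eta_inj etaD etaI) => [|i]; rewrite etaZ (eta_sum etaD).
        rewrite c0 ynu; apply: eq_bigr => h _.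
        by rewrite etaZ (bE h).1 ract_linear.
      by rewrite cnu linear0 big1 // => h _; rewrite etaZ (bE h).2 linear0.
    rewrite -c0 -etaZ' -ract_linear yc sumE; apply: eq_bigr => h _.
    by rewrite (bE h).1 ract_linear.
  rewrite -[RHS](linear0 (eta' (g y))) -(rd_nu_w D) racts_linear.
  rewrite (eq_racts (y := racts x2 (B *m eps))) // -ractsM -mulmxA (rd_eps_w D).
  rewrite Bw E2 ract_suml; apply: eq_bigr => h _.
  by rewrite mxE -/(x2 h) !ractM x2e.
Qed.



(** The module M is the tensor product of Y and T over G: generators z of Y
    give it as a quotient of T^m by the submodule generated by the columns
    c t0 with sum_i z_i c_i = 0.  The map from Y to Hom(T, M) is injective on Y f, hence
    on Y, since no nonzero element of Y is killed by all G f.  A map from T to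
    M lifts to T^m on generators; the lift u of the images of nu satisfies
    u w in R, where R is the submodule of relations, and R is generated by
    R e, so u can be corrected by elements of R e to satisfy u w = 0. *)
Lemma hom_iso_totalr (Y : fgmod G^c) : (forall y : Y, (forall g, y ◁ g ◁ f = 0) -> y = 0) ->
  exists2 M : fgmod A^c, forall x : M, generated_at_e p e w x & hom_iso M Y.
Proof.
move=> Ytf; have [m [z zS]] := fgmodP Y.
pose Tm : lmodType A^c := {ffun 'I_m -> T}.
have brL (c : 'I_m -> G) : linear ((fun t => [ffun i => phi (c i) t]) : T -> Tm).
  by move=> b x y; apply/ffunP => i; rewrite !ffunE linearP.
have [br brE] := choice (fun c => linear_exists (brL c)).
have brEi c t i : br c t i = phi (c i) t by rewrite brE ffunE.
pose sy (c : 'I_m -> G) : Y := \sum_i z i ◁ c i.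
pose X u := exists2 c, sy c = 0 & u = br c t0.
have XS := rspan_submodule X.
have [M0 [pr [prS prE]]] := quotient_projection XS.
have brM c g t : br (fun i => c i * g) t = br c (phi g t).
  by apply/ffunP => i; rewrite !brEi phiM.
have syM c g : sy (fun i => c i * g) = sy c ◁ g.
  by rewrite /sy ract_suml; apply: eq_bigr => i _; rewrite ractM.
have rel_br c t : sy c = 0 -> rspan X (br c t).
  move=> c0; have nu_br j : rspan X (br c (nu j)).
    have [b [<- _]] := endo_at_e (rd_nue D j).
    by rewrite -brM; apply: rspan_in; exists (fun i => c i * b); rewrite // syM c0 ract0l.
  have [a [d ->]] := rd_gen D t; rewrite linearD ract_linear.
  apply: (submoduleD XS).
    by apply: (submoduleZ XS); apply: rspan_in; exists c.
  rewrite racts_linear; apply: (submodule_sum XS) => j _.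
  by apply: (submoduleZ XS); apply: nu_br.
have [co0 co0E] := choice zS; pose co : Y -> 'I_m -> G := co0.
have coE y : y = sy (co y) := co0E y.
pose eta1 y : {linear T -> M0} := (pr \o br (co y))%FUN.
have etaE c t : eta1 (sy c) t = pr (br c t).
  rewrite /eta1 /=; apply/eqP; rewrite -subr_eq0 -linearB; apply/eqP/prE.
  have -> : br (co (sy c)) t - br c t = br (fun i => co (sy c) i - c i) t.
    apply/ffunP => i; rewrite !ffunE !brEi.
    by apply/eqP; rewrite subr_eq -phiD subrK.
  apply: rel_br; rewrite /sy; under eq_bigr => i _ do rewrite ractBr.
  by rewrite sumrB -(co0E (sy c)) subrr.
have Tm_gen u : generated_at_e p e w (u : Tm).
  have -> : u = \sum_i [ffun j => if j == i then u i else 0].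
    apply/ffunP => j; rewrite sum_ffunE (bigD1 j) //= ffunE eqxx big1 ?addr0 //.
    by move=> i /negPf ij; rewrite ffunE eq_sym ij.
  apply: (submodule_sum (generated_at_e_submodule D Tm)) => i _.
  have dL : linear ((fun t => [ffun j => if j == i then t else 0]) : T -> Tm).
    move=> b x y; apply/ffunP => j; rewrite !ffunE.
    by case: (j == i); rewrite // scaler0 addr0.
  have [d dE] := linear_exists dL; rewrite -dE.
  exact/generated_at_e_linear/(tilting_generated_at_e D).
have M_gen x : generated_at_e p e w (x : M0).
  by have [u <-] := prS x; apply: generated_at_e_linear.
have fgM : finitely_generated M0.
  have [l [h hS]] := fgmodP T.
  exists #|{: 'I_m * 'I_l}|, (fun r => let ij := enum_val r in
    pr [ffun i => if i == ij.1 then h ij.2 else 0]) => x.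
  have [u <-] := prS x; have [c cE] := choice (fun i => hS (u i)).
  exists (fun r => let ij := enum_val r in c ij.1 ij.2).
  transitivity (pr (\sum_i \sum_j c i j *: [ffun i' => if i' == i then h j else 0])).
    congr (pr _); apply/ffunP => i.
    rewrite sum_ffunE (bigD1 i) //= [X in _ + X]big1 ?addr0 => [|i' /negPf ii'].
      by rewrite [LHS]cE sum_ffunE; apply: eq_bigr => j _; rewrite !ffunE eqxx.
    by rewrite sum_ffunE big1 // => j _; rewrite !ffunE eq_sym ii' scaler0.
  rewrite pair_bigA (reindex (@enum_val _ {: 'I_m * 'I_l})) /=; last first.
    exact/onW_bij/enum_val_bij.
  by rewrite linear_sum; apply: eq_bigr => r _; rewrite linearZ.
exists (Fgmod fgM) => //; exists eta1; split.
- move=> y y' t; rewrite {1}(coE y) {1}(coE y').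
  have -> : sy (co y) + sy (co y') = sy (fun i => co y i + co y' i).
    by rewrite /sy -big_split; apply: eq_bigr => i _; rewrite ractDr.
  rewrite etaE /eta1 /= -linearD; congr (pr _); apply/ffunP => i.
  by rewrite !ffunE !brEi phiD.
- by move=> y g t; rewrite {1}(coE y) -syM etaE brM.
- move=> y y0; apply: Ytf => g; rewrite (coE y) -!syM.
  have : rspan X (br (fun i => co y i * g * f) t0).
    by rewrite !brM; apply/prE; apply: y0.
  move=> [l [x [a [Xx E]]]].
  have [c c0 cE] : exists2 c : 'I_l -> 'I_m -> G, forall h, sy (c h) = 0 &
      forall h, x h = br (c h) t0.
    have Xx' h : exists c, sy c = 0 /\ x h = br c t0 by case: (Xx h) => c; exists c.
    by have [c cE] := choice Xx'; exists c => h; case: (cE h).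
  have [b bE] := choice (fun h => corner_lift (a h)).
  have cb i : co y i * g * f = \sum_h c h i * b h.
    have phi_sum (F : 'I_l -> G) t : phi (\sum_h F h) t = \sum_h phi (F h) t.
      by elim/big_rec2: _ => [|h u v _ <-]; rewrite ?phi0 ?phiD.
    apply: endo_ext => [|j]; rewrite phi_sum; last first.
      rewrite phiM phi_fnu linear0 big1 // => h _.
      by case: (bE h) => _ bnu _; rewrite phiM bnu linear0.
    rewrite -[t0 in LHS](rd_t0e D) ract_linear -(brEi (fun i => co y i * g * f)).
    rewrite E sum_ffunE ract_suml.
    apply: eq_bigr => h _; case: (bE h) => b0 _ _.
    by rewrite phiM b0 ract_linear ractM ffunE cE brEi.
  rewrite /sy; under eq_bigr => i _ do rewrite cb ract_sumr.
  rewrite exchange_big /= big1 // => h _.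
  by rewrite -[LHS]/(sy (fun i => c h i * b h)) syM c0 ract0l.
- move=> kap.
  have lift_e (x : M0) : x ◁ e = x -> exists u, u ◁ e = u /\ pr u = x.
    move=> xe; have [u ux] := prS x; exists (u ◁ e).
    by rewrite (ract_ee D) ract_linear ux.
  have [|u0 [u0e pu0]] := lift_e (kap t0); first by rewrite -ract_linear (rd_t0e D).
  have nu_e j : kap (nu j) ◁ e = kap (nu j) by rewrite -ract_linear (rd_nue D).
  have [u uE] := choice (fun j => lift_e _ (nu_e j)).
  have /prE : pr (racts u w ord0) = 0.
    rewrite racts_linear (eq_racts (y := kap \o nu)) => [|j]; last by case: (uE j).
    by rewrite -racts_linear (rd_nu_w D) linear0.
  (* the defect u w lies in R and is the product of a row r over R e with w *)
  have [N [i [iI iE]]] := submodule_embedding XS.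
  move=> /iE[r rE].
  have [r' r'e r'E] : generated_at_e p e w r.
    have [l [x [a [Xx E]]]] : rspan X (i r) by apply/iE; exists r.
    have [x' x'E] := choice (fun h => (iE (x h)).1 (rspan_in (Xx h))).
    have -> : r = \sum_h x' h ◁ a h.
      by apply: iI; rewrite E linear_sum; apply: eq_bigr => h _; rewrite ract_linear x'E.
    apply: (submodule_sum (generated_at_e_submodule D N)) => h _.
    apply: (submoduleZ (generated_at_e_submodule D N)).
    apply: (generated_at_e_of D); apply: iI; rewrite ract_linear x'E.
    by case: (Xx h) => c _ ->; rewrite -ract_linear (rd_t0e D).
  (* multiplying by eps restores the relation nu eps = nu without changing nu w *)
  pose v j := racts (fun h => u h - i (r' h)) eps j.
  have rw : racts (i \o r') w ord0 = racts u w ord0.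
    by rewrite -racts_linear -r'E ract_linear rE ractsZ;
      apply: eq_bigr => h _; rewrite (rd_wp D).
  have v_e j : v j ◁ e = v j by apply: racts_e => h l; apply: (rd_epse D).
  have v_eps j : racts v eps j = v j by rewrite -ractsM (rd_eps_eps D).
  have v_w : racts v w ord0 = 0.
    by rewrite -ractsM (rd_eps_w D) ractsBl -rw subrr.
  have pv j : pr (v j) = kap (nu j).
    rewrite racts_linear (eq_racts (y := kap \o nu)) => [|h] /=.
      by rewrite -racts_linear (rd_nu_eps D).
    have -> : pr (u h - i (r' h)) = pr (u h).
      by rewrite linearB (_ : pr (i _) = 0) ?subr0 //; apply/prE/iE; exists (r' h).
    by case: (uE h).
  have compE l (x : 'I_n -> Tm) (B : 'M[A]_(n, l)) j h :
      racts (fun i => x i h) B j = racts x B j h.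
    by rewrite sum_ffunE; apply: eq_bigr => i' _; rewrite ffunE.
  have cex h : exists c, phi c t0 = u0 h /\ forall j, phi c (nu j) = v j h.
    apply: endo_exists.
    + by rewrite -[in RHS]u0e ffunE.
    + by move=> j; rewrite -[in RHS]v_e ffunE.
    + by move=> j; rewrite compE v_eps.
    + by rewrite compE v_w ffunE.
  have [c cE] := choice cex.
  exists (sy c); apply: (tilting_hom_ext D) => [|j]; rewrite etaE.
    by rewrite -pu0; congr (pr _); apply/ffunP => h; rewrite brEi (cE h).1.
  by rewrite -pv; congr (pr _); apply/ffunP => h; rewrite brEi (cE h).2.
Qed.


Section Contexts.
Variables (P : fgmod A^c) (u : P) (S : fgmod G^c) (s0 : S).
Hypothesis DP : simple_data p u.
Hypothesis DS : simple_top_data q s0.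

(** Evaluation at t0 identifies Hom(T, M) f = Hom(eA, M) with M e, which is
    M / M p as a module over the corner. *)
Lemma hom_iso_corner_iso M Y : hom_iso M Y -> exists N0 Y0,
  [/\ corner_iso N0 Y0, forall N, hom0 P N -> (hom0 M N <-> hom0 N0 N),
      forall Y', hom0 S Y' -> hom0 Y0 Y' -> hom0 Y Y'
    & hom0 Y S -> forall Z', hom0 Y Z' -> hom0 Y0 Z'].
Proof.
move=> MY; have [eta [etaD etaZ etaI etaS]] := MY; have TD := endo_triangular.
have [N0 [r [rS PN0 rE N0E]]] := calP_reflection D DP M.
have [Y0 [i [iI Y0S iE Y0E]]] := calS_coreflection TD DS G_fd Y.
exists N0, Y0.
have N0p := (hom0_simplel DP N0).1 PN0.
have Y0q := (hom0_topr TD DS Y0).1 Y0S.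
have i_nu y j : eta (i y) (nu j) = 0.
  by rewrite -phi_qnu -etaZ -ract_linear Y0q linear0 (eta0 etaD).
have i_q y t : eta (i y) (phi q t) = 0.
  by rewrite -etaZ -ract_linear Y0q linear0 (eta0 etaD).
pose l y := r (eta (i y) t0).
have lD y z : l (y + z) = l y + l z by rewrite /l linearD etaD linearD.
have lc g a y : corner g a -> l (y ◁ g) = l y ◁ a.
  move=> ga; rewrite /l ract_linear etaZ -[phi g t0]phi_fq linearD i_q addr0 ga.
  by rewrite !ract_linear.
have l0 y : l y = 0 -> y = 0.
  move=> /rE; rewrite -ract_linear (rd_t0e D) => y0.
  apply: iI; rewrite linear0; apply: (eta_eq0 etaD etaI) => // j; exact: i_nu.
have lI : injective l.
  move=> x y lxy; apply/eqP; rewrite -subr_eq0; apply/eqP/l0.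
  by apply: (addIr (l y)); rewrite -lD subrK add0r.
have lS x : exists y, l y = x.
  have [m <-] := rS x.
  have [y [y0 ynu]] := eta_at_e etaS (ract_ee D m).
  have /iE [z zE] : y ◁ q = 0.
    apply: (eta_eq0 etaD etaI) => [|j]; rewrite etaZ.
      by rewrite phi_q0 linear0.
    by rewrite phi_qnu ynu.
  exists z; rewrite /l zE y0; apply/eqP; rewrite -subr_eq0 -linearB; apply/eqP/rE.
  by rewrite ractBl (ract_ee D) subrr.
have [h hK] := choice lS.
split=> //.
- split=> //; exists h; split.
  + by exists l => // y; apply: lI; rewrite hK.
  + by move=> x y; apply: lI; rewrite lD !hK.
  + by move=> g a x ga; apply: lI; rewrite (lc _ _ _ ga) !hK.
- move=> Y' /(hom0_topl TD DS) Y'tf H g y; apply: Y'tf => b.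
  rewrite -!ract_linear; have /iE[z <-] : y ◁ b ◁ f ◁ q = 0.
    by rewrite -ractM (td_fq TD) ract0r.
  exact: (H (g \o i)%FUN).
- move=> /(hom0_topr TD DS) Yq Z' H g y.
  have iS : surj i by move=> z; apply/iE; apply: Yq.
  have [j [ij ji]] := bij_linear_inv iI iS.
  by rewrite -[y]ij; apply: (H (g \o j)%FUN).
Qed.

Lemma flip_flop_closed_classes :
  related_by_flip_flop (closed_poset (@hom0 A^c)) (closed_poset (@hom0 G^c)).
Proof.
have TD := endo_triangular.
pose F M Y := hom0 M P /\ hom_iso M Y.
have Theta_dom N Z : corner_iso N Z -> hom0 P N /\ hom0 Z S.
  by case=> Np Zq _; split; [apply/(hom0_simplel DP) | apply/(hom0_topr TD DS)].
apply: (@flip_flop_of_contexts _ _ _ _ P S _ _ _ _ _ _ _ _ F corner_iso) => //.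
- exact: (simple_not_hom0 D DP).
- exact: (simple_quotient D DP).
- exact: (top_not_hom0 TD DS).
- exact: (top_quotient TD DS).
- exact: (calT_coreflection D DP A_fd).
- by move=> M; have [N [r [_ PN _ NE]]] := calP_reflection D DP M; exists N.
- exact: (calY_reflection TD DS).
- by move=> Z; have [N [i [_ NS _ NE]]] := calS_coreflection TD DS G_fd Z; exists N.
- move=> M Y [MP MY]; split=> //; apply/(hom0_topl TD DS).
  exact: hom_iso_torsion_free MY.
- by move=> M MP; have [Y MY] := hom_iso_totall M; exists Y.
- move=> Y /(hom0_topl TD DS)/hom_iso_totalr[M Mgen MY].
  by exists M; split=> //; apply/(hom0_simpler D DP).
- move=> M Y M' Y' [/(hom0_simpler D DP) Mgen MY] [_ MY']; split.
    exact: hom_iso_full Mgen MY MY'.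
  exact: hom_iso_faithful Mgen MY MY'.
- by move=> N PN; apply: corner_iso_totall; apply/(hom0_simplel DP).
- by move=> Z ZS; apply: corner_iso_totalr; apply/(hom0_topr TD DS).
- move=> N Z N' Z'; exact: corner_iso_hom0.
- by move=> M Y [_ MY]; apply: hom_iso_corner_iso.
Qed.

End Contexts.

End Idempotents.
End Endomorphisms.

(** * Duality and injective dimension *)

(** The map from a free module given by g splits, and psi is the splitting in
    coordinates. *)
Lemma projective_dual_basis (R : nzRingType) (P : fgmod R) m (g : 'I_m -> P) :
  projective_module P -> (forall x, exists c : 'I_m -> R, x = \sum_i c i *: g i) ->
  exists psi : 'I_m -> {linear P -> R^o}, forall x, x = \sum_i psi i x *: g i.
Proof.
move=> Pproj gS.
have fgF : finitely_generated ('rV[R]_m : lmodType R).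
  exists m, (fun i => delta_mx 0 i) => x; exists (fun i => x 0 i).
  exact: row_sum_delta.
pose F := Fgmod fgF.
have hL : linear ((fun c : 'rV[R]_m => \sum_i c 0 i *: g i) : F -> P).
  move=> a c d; rewrite scaler_sumr -big_split; apply: eq_bigr => i _ /=.
  by rewrite !mxE scalerDl scalerA.
have [h hE] := linear_exists hL.
have hS : surj h.
  move=> x; have [c ->] := gS x; exists (\row_i c i); rewrite hE.
  by apply: eq_bigr => i _; rewrite mxE.
have [sec secE] := Pproj F P h idfun hS.
have psiL i : linear ((fun x => sec x 0 i) : P -> R^o).
  by move=> a x y; rewrite linearP !mxE.
have [psi psiE] := choice (fun i => linear_exists (psiL i)).
exists psi => x; rewrite -[LHS]/(idfun x) -secE hE.
by apply: eq_bigr => i _; rewrite psiE.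
Qed.

(** If V is the dual of a finite-dimensional U, then U is the dual of V: a
    form zeta on V is evaluation at the vector with coordinates zeta (v_i),
    where v_i represents the i-th coordinate form. *)
Lemma perfect_pairing (k : fieldType) (U V : lmodType k) (beta : U -> V -> k) :
  finitely_generated U ->
  (forall c u u' v, beta (c *: u + u') v = c * beta u v + beta u' v) ->
  (forall c u v v', beta u (c *: v + v') = c * beta u v + beta u v') ->
  (forall xi : {linear U -> k^o}, exists v, forall u, beta u v = xi u) ->
  (forall v, (forall u, beta u v = 0) -> v = 0) ->
  (forall zeta : {linear V -> k^o}, exists u, forall v, beta u v = zeta v) /\
  (forall u, (forall v, beta u v = 0) -> u = 0).
Proof.
move=> /dual_basis_exists[n [g [xi gE]]] betaL betaR ex nd.
have betaD u v v' : beta u (v + v') = beta u v + beta u v'.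
  by rewrite -[v]scale1r betaR mul1r scale1r.
have beta0 u : beta u 0 = 0 by apply: (addrI (beta u 0)); rewrite -betaD !addr0.
have betaDl u u' v : beta (u + u') v = beta u v + beta u' v.
  by rewrite -[u]scale1r betaL mul1r scale1r.
have beta0l v : beta 0 v = 0 by apply: (addrI (beta 0 v)); rewrite -betaDl !addr0.
have betaZ c u v : beta u (c *: v) = c * beta u v.
  by rewrite -[c *: v]addr0 betaR beta0 addr0.
have betaZl c u v : beta (c *: u) v = c * beta u v.
  by rewrite -[c *: u]addr0 betaL beta0l addr0.
have beta_suml (F : 'I_n -> U) v : beta (\sum_i F i) v = \sum_i beta (F i) v.
  by elim/big_rec2: _ => [|i x y _ <-]; rewrite ?beta0l ?betaDl.
have beta_sumr u (F : 'I_n -> V) : beta u (\sum_i F i) = \sum_i beta u (F i).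
  by elim/big_rec2: _ => [|i x y _ <-]; rewrite ?beta0 ?betaD.
have [v vE] := choice (fun i => ex (xi i)).
split=> [zeta|u u0]; last first.
  by rewrite [u]gE big1 // => i _; rewrite -vE u0 scale0r.
exists (\sum_i zeta (v i) *: g i) => x.
have xE : x = \sum_i beta (g i) x *: v i.
  apply/eqP; rewrite -subr_eq0; apply/eqP/nd => y.
  have betaN z z' : beta z (- z') = - beta z z'.
    by rewrite -scaleN1r betaZ mulN1r.
  rewrite betaD betaN beta_sumr; apply/eqP; rewrite subr_eq0; apply/eqP.
  rewrite {1}[y]gE beta_suml; apply: eq_bigr => i _.
  by rewrite betaZl betaZ vE mulrC.
rewrite [in RHS]xE linear_sum beta_suml; apply: eq_bigr => i _.
by rewrite betaZl linearZ mulrC.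
Qed.

Section Duality.
Variables (k : fieldType) (A : falgType k).
Variables (s : {rmorphism k -> A}) (sA : {rmorphism k -> A^c}).
Hypothesis sE : forall c, s c = c%:A.
Hypothesis sAE : forall c, sA c = c%:A :> A.
Hypothesis A_fdl : finitely_generated (restr s (A^o : lmodType A)).
Hypothesis A_fdr : finitely_generated (restr sA ((A^c)^o : lmodType A^c)).

(** The pairing identifies each of M and N with the k-dual of the other. *)
Record dual_pairing (M : fgmod A) (N : fgmod A^c) (beta : M -> N -> k) : Prop :=
    DualPairing {
  dp_linl : forall c m m' n, beta (s c *: m + m') n = c * beta m n + beta m' n;
  dp_linr : forall c m n n', beta m (sA c *: n + n') = c * beta m n + beta m n';
  dp_bal : forall a m n, beta (a *: m) n = beta m (n ◁ a);
  dp_exl : forall xi : {linear restr s M -> k^o}, exists n, forall m, beta m n = xi m;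
  dp_exr : forall xi : {linear restr sA N -> k^o}, exists m, forall n, beta m n = xi n;
  dp_ndl : forall n, (forall m, beta m n = 0) -> n = 0;
  dp_ndr : forall m, (forall n, beta m n = 0) -> m = 0
}.

Section Pairing.
Variables (M : fgmod A) (N : fgmod A^c) (beta : M -> N -> k).
Hypothesis D : dual_pairing beta.

Lemma dp_addl m m' n : beta (m + m') n = beta m n + beta m' n.
Proof. by rewrite -[m]scale1r -(rmorph1 s) (dp_linl D) mul1r rmorph1 scale1r. Qed.
Lemma dp_addr m n n' : beta m (n + n') = beta m n + beta m n'.
Proof. by rewrite -[n]scale1r -(rmorph1 sA) (dp_linr D) mul1r rmorph1 scale1r. Qed.
Lemma dp_0l n : beta 0 n = 0.
Proof. by apply: (addrI (beta 0 n)); rewrite -dp_addl !addr0. Qed.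
Lemma dp_0r m : beta m 0 = 0.
Proof. by apply: (addrI (beta m 0)); rewrite -dp_addr !addr0. Qed.
Lemma dp_oppl m n : beta (- m) n = - beta m n.
Proof. by apply: (addrI (beta m n)); rewrite -dp_addl !subrr dp_0l. Qed.
Lemma dp_oppr m n : beta m (- n) = - beta m n.
Proof. by apply: (addrI (beta m n)); rewrite -dp_addr !subrr dp_0r. Qed.
Lemma dp_suml (I : Type) (r : seq I) (F : I -> M) n :
  beta (\sum_(i <- r) F i) n = \sum_(i <- r) beta (F i) n.
Proof. by elim/big_rec2: _ => [|i x y _ <-]; rewrite ?dp_0l ?dp_addl. Qed.
Lemma dp_eql n n' : (forall m, beta m n = beta m n') -> n = n'.
Proof.
move=> E; apply/eqP; rewrite -subr_eq0; apply/eqP/(dp_ndl D) => m.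
by rewrite dp_addr dp_oppr E subrr.
Qed.
Lemma dp_eqr m m' : (forall n, beta m n = beta m' n) -> m = m'.
Proof.
move=> E; apply/eqP; rewrite -subr_eq0; apply/eqP/(dp_ndr D) => n.
by rewrite dp_addl dp_oppl E subrr.
Qed.
End Pairing.

Lemma is_dual_pairing (N : fgmod A^c) (M : fgmod A) : is_dual N M ->
  exists beta, @dual_pairing M N beta.
Proof.
case=> beta [blin bbal bex].
have bD m m' n : beta (m + m') n = beta m n + beta m' n.
  by rewrite -[m]scale1r bbal !scale1r.
have bl c m m' n : beta (s c *: m + m') n = c * beta m n + beta m' n.
  rewrite bbal -[_ *: n]addr0 sE blin.
  suff -> : beta m 0 = 0 by rewrite addr0.
  have := blin m 1 0 0; rewrite scaler0 addr0 mul1r => E.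
  by apply: (addrI (beta m 0)); rewrite -E addr0.
have br c m n n' : beta m (sA c *: n + n') = c * beta m n + beta m n'.
  by rewrite sAE blin.
have b0l n : beta 0 n = 0 by apply: (addrI (beta 0 n)); rewrite -bD !addr0.
have [|||||exl ndl] := @perfect_pairing k (restr sA N) (restr s M) (fun n m => beta m n).
- by apply/(fg_restrP A_fdr)/fgmodP.
- by move=> c n n' m; apply: br.
- by move=> c n m m'; apply: bl.
- move=> xi; have [|m [mE _]] := bex xi; last by exists m.
  by move=> c x y; have := linearP xi c x y; rewrite restrZ sAE.
- move=> m m0; have [|m' [_ mU]] := bex (fun=> 0).
    by move=> c x y; rewrite mulr0 addr0.
  by rewrite -(mU m m0) -(mU 0).
exists beta; split=> //.
- by move=> a m n; rewrite -[a *: m]addr0 bbal b0l addr0.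
- move=> xi; have [|m [mE _]] := bex xi; last by exists m.
  by move=> c x y; have := linearP xi c x y; rewrite restrZ sAE.
- move=> m m0; have [|m' [_ mU]] := bex (fun=> 0).
    by move=> c x y; rewrite mulr0 addr0.
  by rewrite -(mU m m0) -(mU 0).
Qed.

Lemma dual_exists (M : fgmod A) : exists (N : fgmod A^c) beta, @dual_pairing M N beta.
Proof.
pose K (x : M -> k) := forall c m m', x (s c *: m + m') = c * x m + x m'.
have sC c (a : A) : a * s c = s c * a by rewrite sE mulr_algl mulr_algr.
have KD x : K x -> forall m m', x (m + m') = x m + x m'.
  by move=> Kx m m'; rewrite -[m]scale1r -(rmorph1 s) Kx mul1r rmorph1 scale1r.
have [|x y Kx Ky|a x Kx|x a b m Kx|x a b m Kx|x m Kx|N [ev [evI evS evL]]] :=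
  @function_module A^c M k (fun (a : A^c) m => (a : A) *: m) K.
- by move=> c m m'; rewrite mulr0 addr0.
- by move=> c m m'; rewrite Kx Ky mulrBr opprD addrACA.
- by move=> c m m'; rewrite scalerDr scalerA sC -scalerA Kx.
- by rewrite scalerDl KD.
- by rewrite scalerA.
- by rewrite scale1r.
have Kev n : K (ev n) by apply/evS; exists n.
have ev0 m : ev 0 m = 0.
  have := evL 1 0 0 m; rewrite scale1r addr0 scale1r => E.
  by apply: (addrI (ev 0 m)); rewrite -E addr0.
have evD n n' m : ev (n + n') m = ev n m + ev n' m.
  by have := evL 1 n n' m; rewrite !scale1r.
have evZ a n m : ev (n ◁ a) m = ev n (a *: m).
  by have := evL a n 0 m; rewrite addr0 ev0 addr0.
have evlin c n n' m : ev (sA c *: n + n') m = c * ev n m + ev n' m.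
  rewrite evL sAE -sE -[_ *: m]addr0 Kev.
  suff -> : ev n 0 = 0 by rewrite addr0.
  by apply: (addrI (ev n 0)); rewrite -KD ?addr0.
have [d [g [xi gE]]] := dual_basis_exists ((fg_restrP A_fdl M).1 (fgmodP M)).
have fgN : finitely_generated N.
  have FL : linear ((fun n => \row_i ev n (g i)) : restr sA N -> 'rV[k]_d).
    by move=> c n n'; apply/rowP => i; rewrite !mxE restrZ evlin.
  have [F FE] := linear_exists FL.
  apply/(fg_restrP A_fdr)/(@fg_submodule_rV k _ _ F) => n n'; rewrite !FE => /rowP E.
  apply: evI => m; rewrite [m]gE.
  have sumE y : ev y (\sum_i xi i m *: g i : restr s M) = \sum_i xi i m * ev y (g i).
    elim/big_rec2: _ => [|i u v _ <-].
      by apply: (addrI (ev y 0)); rewrite -KD ?addr0.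
    exact: (Kev y (xi i m) (g i) v).
  by rewrite !sumE; apply: eq_bigr => i _; have := E i; rewrite !mxE => ->.
pose N' := Fgmod fgN.
have exl (x : {linear restr s M -> k^o}) : exists n, forall m, ev n m = x m.
  have [|n nE] := (evS x).1; last by exists n.
  by move=> c m m'; have := linearP x c m m'; rewrite restrZ.
have ndl n : (forall m, ev n m = 0) -> n = 0.
  by move=> n0; apply: evI => m; rewrite ev0.
have [|c u u' v|c u v v'|||exr ndr] :=
  @perfect_pairing k (restr s M) (restr sA N) (fun m n => ev n m).
- by apply/(fg_restrP A_fdl)/fgmodP.
- by rewrite restrZ Kev.
- by rewrite restrZ evlin.
- exact: exl.
- exact: ndl.
exists N', (fun m n => ev n m); split=> //.
by move=> c m m' n; apply: Kev.
Qed.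

Lemma transpose_exists (M M' : fgmod A) (N N' : fgmod A^c) beta beta'
    (f : {linear M -> M'}) :
  @dual_pairing M N beta -> @dual_pairing M' N' beta' ->
  exists g : {linear N' -> N}, forall m n, beta m (g n) = beta' (f m) n.
Proof.
move=> D D'.
have formL n : linear ((fun m => beta' (f m) n) : restr s M -> k^o).
  by move=> c m m'; rewrite restrZ linearP (dp_linl D').
have [h hE] := choice (fun n => linear_exists (formL n)).
have [g gE] := choice (fun n => dp_exl D (h n)).
have {}gE m n : beta m (g n) = beta' (f m) n by rewrite gE hE.
have [||g' g'E] := linear_exists (linear_ract (f := g) _ _).
- by move=> n n'; apply: (dp_eql D) => m; rewrite (dp_addr D) !gE (dp_addr D').
- by move=> n a; apply: (dp_eql D) => m; rewrite -(dp_bal D) !gE linearZ (dp_bal D').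
by exists g' => m n; rewrite g'E gE.
Qed.

Lemma cotranspose_exists (M M' : fgmod A) (N N' : fgmod A^c) beta beta'
    (g : {linear N' -> N}) :
  @dual_pairing M N beta -> @dual_pairing M' N' beta' ->
  exists f : {linear M -> M'}, forall m n, beta' (f m) n = beta m (g n).
Proof.
move=> D D'.
have formL m : linear ((fun n => beta m (g n)) : restr sA N' -> k^o).
  by move=> c n n'; rewrite restrZ linearP (dp_linr D).
have [h hE] := choice (fun m => linear_exists (formL m)).
have [f fE] := choice (fun m => dp_exr D' (h m)).
have {}fE m n : beta' (f m) n = beta m (g n) by rewrite fE hE.
have fL : linear f.
  move=> a m m'; apply: (dp_eqr D') => n.
  rewrite (dp_addl D') (dp_bal D') !fE (dp_addl D) (dp_bal D).
  by rewrite ract_linear.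
have [f' f'E] := linear_exists fL.
by exists f' => m n; rewrite f'E fE.
Qed.

(** A map h from X to the dual of M is given by the forms h_j = beta g_j (h x) on
    the generators g of M; extend these from X to Y and reassemble them with
    a dual basis. *)
Lemma dual_projective_injective (M : fgmod A) (N : fgmod A^c) beta :
  @dual_pairing M N beta -> projective_module M -> injective_module N.
Proof.
move=> D Mproj X Y i h iI.
have [d [g gS]] := fgmodP M; have [psi psiE] := projective_dual_basis Mproj gS.
have formL j : linear ((fun x => beta (g j) (h x)) : restr sA X -> k^o).
  by move=> c x y; rewrite restrZ linearP (dp_linr D).
have [xi xiE] := choice (fun j => linear_exists (formL j)).
have [i' i'E] := linear_exists (@restr_linear _ _ sA _ _ i).
have ext j : exists zeta : {linear restr sA Y -> k^o}, forall x, zeta (i' x) = xi j x.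
  apply: form_extend; try by apply/(fg_restrP A_fdr)/fgmodP.
  by move=> x y; rewrite !i'E => /iI.
have [zeta zetaE] := choice ext.
pose form (y : Y) (m : M) := \sum_j zeta j (y ◁ psi j m).
have formL' y : linear (form y : restr s M -> k^o).
  move=> c m m'; rewrite /form scaler_sumr -big_split; apply: eq_bigr => j _ /=.
  have -> : psi j (c *: m + m') = (c *: (psi j m : A) + psi j m' : A).
    by rewrite restrZ linearP sE; congr (_ + _); exact: (mulr_algl c (psi j m : A)).
  have -> : y ◁ (c *: psi j m + psi j m') =
      c *: (y ◁ psi j m : restr sA Y) + (y ◁ psi j m' : restr sA Y).
    by rewrite restrZ sAE ractDr -mulr_algr ractM.
  by rewrite linearP.
have [fo foE] := choice (fun y => linear_exists (formL' y)).
have [h' h'E] := choice (fun y => dp_exl D (fo y)).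
have {}h'E m y : beta m (h' y) = \sum_j zeta j (y ◁ psi j m) by rewrite h'E foE.
have [||h1 h1E] := linear_exists (linear_ract (f := h') _ _).
- move=> y y'; apply: (dp_eql D) => m; rewrite (dp_addr D) !h'E -big_split.
  by apply: eq_bigr => j _; rewrite ractDl linearD.
- move=> y a; apply: (dp_eql D) => m; rewrite -(dp_bal D) !h'E.
  by apply: eq_bigr => j _; rewrite linearZ -ractM.
exists h1 => x; rewrite h1E; apply: (dp_eql D) => m; rewrite h'E.
rewrite [m in RHS]psiE (dp_suml D); apply: eq_bigr => j _.
by rewrite (dp_bal D) -!ract_linear -xiE -zetaE i'E.
Qed.


Section DualPresentation.
Variables (P : fgmod A^c) (DP P1 P0 : fgmod A) (beta : DP -> P -> k).
Variables (p1 : {linear P1 -> P0}) (p0 : {linear P0 -> DP}).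
Hypothesis D : dual_pairing beta.
Hypothesis P0_proj : projective_module P0.
Hypothesis p0_surj : surj p0.
Hypothesis p01 : exact_at p1 p0.

(** Dualizing P1 -> P0 -> DP -> 0 embeds P in the injective module D P0 as the
    annihilator of the image of p1. *)
Lemma dual_copresentation : exists (J0 : fgmod A^c) (beta0 : P0 -> J0 -> k)
    (i0 : {linear P -> J0}),
  [/\ dual_pairing beta0, injective_module J0, injective i0
    & forall n, (forall y, beta0 (p1 y) n = 0) <-> exists x, i0 x = n].
Proof.
have [J0 [beta0 D0]] := dual_exists P0.
have [i0 i0E] := transpose_exists p0 D0 D.
exists J0, beta0, i0; split=> //; first exact: dual_projective_injective D0 P0_proj.
  move=> x y xy; apply: (dp_eql D) => d; have [m <-] := p0_surj d.
  by rewrite -!i0E xy.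
move=> n; split=> [n0|[x <-] y]; last first.
  by rewrite i0E (_ : p0 _ = 0) ?(dp_0l D) //; apply/p01; exists y.
have fL : linear ((fun m => beta0 m n) : restr s P0 -> k^o).
  by move=> c m m'; rewrite restrZ (dp_linl D0).
have [f fE] := linear_exists fL.
have [p pE] := linear_exists (@restr_linear _ _ s _ _ p0).
have [||g gE] := @factor_surj k _ _ _ p f.
- by move=> d; have [m md] := p0_surj d; exists m; rewrite pE.
- by move=> m; rewrite pE fE => /p01[y <-].
have [x xE] := dp_exl D g; exists x; apply: (dp_eql D0) => m.
by rewrite i0E xE -fE -gE pE.
Qed.

Lemma injective_of_zero_presentation :
  (forall y, p1 y = 0) -> injective_module P.
Proof.
move=> p10; have [J0 [beta0 [i0 [D0 J0_inj i0I i0E]]]] := dual_copresentation.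
have i0S : surj i0 by move=> n; apply/i0E => y; rewrite p10 (dp_0l D0).
have [j [ij ji]] := bij_linear_inv i0I i0S.
move=> X Y g h gI; have [f fE] := J0_inj _ _ g (i0 \o h)%FUN gI.
by exists (j \o f)%FUN => x; rewrite /= fE /= ij.
Qed.

(** Let C be the image of the map J0 -> J1 dual to p1, so that 0 -> P -> J0 ->
    C -> 0 is exact.  Comparing with 0 -> P -> I -> N -> 0, where I and N are
    injective, one obtains as in the lemma of Schanuel that the inclusion of C
    in J1 has a retraction r.  The transpose of the resulting idempotent of J1
    is an idempotent of P1 with the same kernel as p1, and its image is all of
    P1 because the kernel of p1 is superfluous. *)
Lemma injective_presentation_of_injdim1 :
  superfluous_kernel p1 -> injdim_le 1 P -> injective p1.
Proof.
move=> p1_sup [I [N [f [g [I_inj [fI fg gS] N_inj]]]]].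
have [J0 [beta0 [i0 [D0 J0_inj i0I i0E]]]] := dual_copresentation.
have [J1 [beta1 D1]] := dual_exists P1.
have [t tE] := transpose_exists p1 D1 D0.
have kert n : t n = 0 <-> exists x, i0 x = n.
  rewrite -i0E; split=> [tn y|n0]; first by rewrite -tE tn (dp_0r D1).
  by apply: (dp_ndl D1) => y; rewrite tE.
have [C [q [c [qS cI cq]]]] := image_factorization A_fdr t.
have kerq n : q n = 0 <-> exists x, i0 x = n.
  by rewrite -kert -cq; split=> [->|]; rewrite ?linear0 // => h; apply: cI; rewrite h linear0.
(* u and v compare the two embeddings of P; v u - 1 kills P, so it factors as
   wi through C, and the composite of the induced maps al and be differs from
   1 by q wi *)
have [u uE] := I_inj _ _ i0 f i0I.
have [v vE] := J0_inj _ _ f i0 fI.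
have [|al alE] := @factor_surj A^c _ _ _ q (g \o u)%FUN qS.
  by move=> n /kerq[x <-]; rewrite /= uE; apply/fg; exists x.
have [|be beE] := @factor_surj A^c _ _ _ g (q \o v)%FUN gS.
  by move=> y /fg[x <-]; rewrite /= vE; apply/kerq; exists x.
have [rho rhoE] := N_inj _ _ c al cI.
have [|wi wiE] := @factor_surj A^c _ _ _ q ((v \o u) \- idfun)%FUN qS.
  by move=> n /kerq[x <-]; rewrite /= uE vE subrr.
have [w' w'E] := J0_inj _ _ c wi cI.
pose r : {linear J1 -> C} := ((be \o rho) \- (q \o w'))%FUN.
have rK x : r (c x) = x.
  have [n <-] := qS x.
  rewrite /r /= rhoE alE /= beE /= w'E wiE /= linearB.
  by rewrite opprB addrC subrK.
have [e eE0] := cotranspose_exists (c \o r)%FUN D1 D1.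
have eE m n : beta1 (e m) n = beta1 m (c (r n)) by rewrite eE0.
have ee y : e (e y) = e y.
  by apply: (dp_eqr D1) => n; rewrite !eE rK.
have ker_e y : e y = 0 <-> p1 y = 0.
  split=> y0.
    apply: (dp_ndr D0) => n; rewrite -tE -cq -[q n]rK.
    by rewrite -eE y0 (dp_0l D1).
  apply: (dp_ndr D1) => n; rewrite eE; have [n0 <-] := qS (r n).
  by rewrite cq tE y0 (dp_0l D0).
have Se : submodule (fun y => exists x, e x = y) := image_submodule e.
have eS y : exists x, e x = y.
  apply/asboolP; apply: (p1_sup _ (submodule_closed Se)) => x.
  exists (e x), (x - e x); split; first by apply/asboolP; exists x.
    by apply/ker_e; rewrite linearB ee subrr.
  by rewrite addrC subrK.
have eid y : e y = y by have [x <-] := eS y; rewrite ee.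
move=> x y xy; apply/eqP; rewrite -subr_eq0 -[x - y]eid; apply/eqP/ker_e.
by rewrite linearB xy subrr.
Qed.

End DualPresentation.

End Duality.

(** * The idempotent of the simple projective module *)

Section SimpleProjective.
Variables (k : fieldType) (R : nzRingType) (s : {rmorphism k -> R}).
Hypothesis R_fd : finitely_generated (restr s (R^o : lmodType R)).
Variable P : fgmod R.
Hypothesis P_simple : simple_module P.
Hypothesis P_proj : projective_module P.

Lemma simple_submodule (S : P -> Prop) x : submodule S -> S x -> x <> 0 ->
  forall y, S y.
Proof.
move=> Ss Sx x0 y; case: (P_simple.2 _ (submodule_closed Ss)) => [|h].
  by move=> /(_ x) h; case: x0; apply: h; apply/asboolP.
by have /asboolP := h y.
Qed.

(** A nonzero map to P is surjective, and it splits since P is projective, so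
    its kernel is a direct summand. *)
Lemma indecomposable_onto_simple (M : fgmod R) (f : {linear M -> P}) :
  indecomposable M -> (exists x, f x <> 0) -> injective f /\ surj f.
Proof.
case=> _ M_ind [x fx].
have fS : surj f by apply: (simple_submodule (image_submodule f)) fx; exists x.
split=> //.
have [sec secE] := P_proj idfun fS.
have Ks : submodule (fun x => f x = 0).
  by split=> [|a y z fy fz]; rewrite ?linear0 // linearP fy fz scaler0 addr0.
have [K [i [iI iE]]] := submodule_object R_fd Ks.
have [h hE] := dsum_copair sec i.
have hiso : mod_iso (dsum P K) M.
  apply: (mod_iso_bij (f := h)) => [u v|y].
    rewrite !hE => huv.
    have fi z : f (i z) = 0 by apply/iE; exists z.
    have /(congr1 f) := huv; rewrite !linearD !secE !fi !addr0 /= => E1.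
    move: huv; rewrite E1 => /addrI/iI E2.
    exact: injective_projections.
  have /iE[z zE] : f (y - sec (f y)) = 0 by rewrite linearB secE subrr.
  by exists (f y, z); rewrite hE zE addrC subrK.
have [h' [h'I h'S]] := mod_iso_inj_surj hiso.
have [l [h'l lh']] := bij_linear_inv h'I h'S.
have [||K0] := M_ind P K.
- by exists l, h'.
- by move=> /(_ (f x)).
- move=> y z yz; apply/eqP; rewrite -subr_eq0; apply/eqP.
  have /iE[t <-] : f (y - z) = 0 by rewrite linearB yz subrr.
  by rewrite (K0 t) linear0.
Qed.

Lemma mod_iso_of_onto_simple (M N : fgmod R) (f : {linear M -> P}) (g : {linear N -> P}) :
  indecomposable M -> indecomposable N ->
  (exists x, f x <> 0) -> (exists x, g x <> 0) -> mod_iso M N.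
Proof.
move=> Mi Ni fx gx; have [fI fS] := indecomposable_onto_simple Mi fx.
have [gI gS] := indecomposable_onto_simple Ni gx.
have [l [gl lg]] := bij_linear_inv gI gS.
apply: (mod_iso_bij (f := (l \o f)%FUN)) => [x y /(can_inj lg)/fI //|y].
by have [x fx'] := fS (g y); exists x; rewrite /= fx' gl.
Qed.

Let sumof (t : seq (fgmod R)) := foldr (@dsum R) (zero_module R) t.

Lemma sum_onto_simple (t : seq (fgmod R)) (f : {linear sumof t -> P}) :
  (exists x, f x <> 0) -> exists i (g : {linear nth (zero_module R) t i -> P}),
    (i < size t)%N /\ exists x, g x <> 0.
Proof.
elim: t f => [|M t IH] f [x fx].
  by case: fx; rewrite [x]thinmx0 linear0.
have [a aE] := dsum_inl M (sumof t); have [b bE] := dsum_inr M (sumof t).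
have [[y fy]|none] := pselect (exists y, f (a y) <> 0).
  by exists 0%N, (f \o a)%FUN; split=> //; exists y.
have [|i [g [it gx]]] := IH (f \o b)%FUN; last by exists i.+1, g.
exists x.2; move=> fb; apply: fx.
have -> : x = a x.1 + b x.2.
  by rewrite aE bE; apply: injective_projections; rewrite /= ?addr0 ?add0r.
rewrite linearD [f (b _)]fb addr0; apply: contrapT => fa.
by apply: none; exists x.1.
Qed.

(** At most one summand of t is isomorphic to P, and every map from the sum to P
    factors through the projection to that summand. *)
Lemma basic_maps_same_kernel (t : seq (fgmod R)) (f1 f2 : {linear sumof t -> P}) :
  (forall i, (i < size t)%N -> indecomposable (nth (zero_module R) t i)) ->
  (forall i j, (i < j < size t)%N ->
    ~ mod_iso (nth (zero_module R) t i) (nth (zero_module R) t j)) ->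
  (exists x, f1 x <> 0) -> (exists x, f2 x <> 0) ->
  forall x, f1 x = 0 -> f2 x = 0.
Proof.
elim: t f1 f2 => [|M t IH] f1 f2 ind noniso.
  by case=> x; case; rewrite [x]thinmx0 linear0.
have [a aE] := dsum_inl M (sumof t); have [b bE] := dsum_inr M (sumof t).
have abE (x : dsum M (sumof t)) : x = a x.1 + b x.2.
  by rewrite aE bE; apply: injective_projections; rewrite /= ?addr0 ?add0r.
have excl (f g : {linear dsum M (sumof t) -> P}) :
    (exists y, f (a y) <> 0) -> forall y, g (b y) = 0.
  move=> [y fy] z; apply: contrapT => gz.
  have [|i [h [it hx]]] := @sum_onto_simple t (g \o b)%FUN; first by exists z.
  apply: (noniso 0%N i.+1) => //.
  apply: (@mod_iso_of_onto_simple _ _ (f \o a)%FUN h) => //.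
  - exact: (ind 0%N).
  - exact: (ind i.+1).
  - by exists y.
move=> [x1 f1x] [x2 f2x] x f1x0.
have [f1a|nf1a] := pselect (exists y, f1 (a y) <> 0).
  have f1b := excl f1 f1 f1a; have f2b := excl f1 f2 f1a.
  have [|f1I _] := @indecomposable_onto_simple M (f1 \o a)%FUN (ind 0%N isT).
    by case: f1a => y; exists y.
  have x10 : x.1 = 0 :> M.
    by apply: f1I; rewrite /= !linear0 -f1x0 [x in RHS]abE linearD f1b addr0.
  by rewrite [x]abE linearD f2b addr0 x10 !linear0.
have f1a y : f1 (a y) = 0 by apply: contrapT => h; apply: nf1a; exists y.
have f1bn : exists z, f1 (b z) <> 0.
  by exists x1.2 => h; apply: f1x; rewrite [x1]abE linearD f1a h addr0.
have f2a y : f2 (a y) = 0.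
  apply: contrapT => h; have f1b := excl f2 f1 (ex_intro _ y h).
  by case: f1bn => z; rewrite f1b.
rewrite [x]abE linearD f2a add0r.
apply: (IH (f1 \o b)%FUN (f2 \o b)%FUN) => //.
- by move=> i it; apply: (ind i.+1).
- by move=> i j ij; apply: (noniso i.+1 j.+1).
- by exists x2.2 => h; apply: f2x; rewrite [x2]abE linearD f2a add0r.
- by rewrite /= -f1x0 [x in RHS]abE linearD f1a add0r.
Qed.

End SimpleProjective.

Section Decomposition.
Variables (k : fieldType) (A : falgType k) (sA : {rmorphism k -> A^c}).
Hypothesis A_fd : finitely_generated (restr sA ((A^c)^o : lmodType A^c)).
Variables (P Q : rmod A).
Hypothesis A_basic : basic_algebra A.
Hypothesis P_simple : simple_module P.
Hypothesis P_proj : projective_module P.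
Hypothesis A_PQ : mod_iso (regular_module A^c) (dsum P Q).

(** If pAe were nonzero then A would have two nonzero maps to P with different
    kernels: left multiplication by p, which kills e, and left multiplication
    by an element p a e, which does not. *)
Lemma simple_projective_data : exists (p e : A) (u : P) (r : Q),
  [/\ p + e = 1, forall a, p * a * e = 0,
      forall a, p * a <> 0 -> exists b, p * a * b = p,
      simple_data p u & [/\ r ◁ e = r, forall x, exists a, x = r ◁ a
                           & forall a, r ◁ a = 0 -> e * a = 0]].
Proof.
have [f [fI fS]] := mod_iso_inj_surj A_PQ.
have regE (x : regular_module A^c) a : x ◁ a = (x : A) * a by [].
case f1E : (f (1 : A)) => [u r].
have fE (a : A) : f a = (u ◁ a, r ◁ a).
  by rewrite -[a in LHS]mul1r -regE ract_linear f1E.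
have [p pE] := fS (u, 0); have [e eE] := fS (0, r).
have := pE; rewrite fE => -[up rp]; have := eE; rewrite fE => -[ue re].
have pe1 : (p : A) + e = 1.
  apply: fI; rewrite linearD pE eE f1E.
  by apply: injective_projections; rewrite /= ?addr0 ?add0r.
have paE (a : A) : f ((p : A) * a) = (u ◁ a, 0).
  by rewrite fE !ractM up rp ract0l.
have eaE (a : A) : f ((e : A) * a) = (0, r ◁ a).
  by rewrite fE !ractM ue re ract0l.
have p_rel a : u ◁ a = 0 <-> (p : A) * a = 0.
  split=> [ua|pa]; last by have := paE a; rewrite pa linear0 => -[<-].
  by apply: fI; rewrite paE ua linear0.
have gen_u x : exists a, x = u ◁ a.
  by have [a] := fS (x, 0); rewrite fE => -[<- _]; exists a.
have gen_r x : exists a, x = r ◁ a.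
  by have [a] := fS (0, x); rewrite fE => -[_ <-]; exists a.
have u0 : u <> 0.
  by move=> u0; apply: P_simple.1 => x; have [a ->] := gen_u x; rewrite u0 ract0l.
have pp : (p : A) * p = p by apply: fI; rewrite paE pE up.
have ee : (e : A) * e = e by apply: fI; rewrite eaE eE re.
have pe : (p : A) * e = 0 by apply/p_rel.
have mulL (x : A) : linear ((fun a : A => u ◁ (x * a)) : regular_module A^c -> P).
  apply: linear_ract => [a b|a b]; first by rewrite mulrDr ractDr.
  by rewrite regE mulrA !ractM.
have pAe (a : A) : (p : A) * a * e = 0.
  apply: contrapT => pae.
  have [t [iso_t ind noniso]] := A_basic.
  have [h [hI hS]] := mod_iso_inj_surj iso_t.
  have [l [hl lh]] := bij_linear_inv hI hS.
  have [f1 f1P] := linear_exists (mulL 1).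
  have [f2 f2P] := linear_exists (mulL ((p : A) * a * e)).
  have upae : u ◁ ((p : A) * a * e) <> 0.
    by move=> /p_rel; rewrite !mulrA pp; apply: pae.
  have := @basic_maps_same_kernel k A^c sA A_fd P P_simple P_proj t
    (f1 \o l)%FUN (f2 \o l)%FUN ind noniso.
  move=> /(_ _ _ (h e)) H; apply: upae.
  have : f2 (l (h e)) = 0.
    apply: H.
    - by exists (h (1 : A)); rewrite /= hl f1P !mul1r ract1.
    - exists (h (e : A)); rewrite /= hl f2P -!mulrA ee !mulrA.
      by move=> /p_rel; rewrite !mulrA pp; apply: pae.
    - by rewrite /= hl f1P mul1r ue.
  by rewrite hl f2P -!mulrA ee.
exists p, e, u, r; split=> //.
- move=> a pa; have ua : u ◁ a <> 0 by move/p_rel.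
  have Ss : submodule (fun x => exists b, x = u ◁ a ◁ b).
    apply: submodule_ract => [|_ _ [b ->] [c ->]|_ c [b ->]].
    + by exists 0; rewrite ract0r.
    + by exists (b + c); rewrite ractDr.
    + by exists (b * c); rewrite ractM.
  have [|b ub] := simple_submodule P_simple Ss _ ua u.
    by exists 1; rewrite ract1.
  exists b; apply: fI; rewrite -mulrA paE pE ractM -ub //.
- split=> // a ra; apply: fI; rewrite eaE ra linear0 //.
Qed.

End Decomposition.

(** * The inverse Auslander-Reiten translate of the simple projective *)

Lemma functional_mulr (A : nzRingType) (M : lmodType A) (psi : {linear M -> A^o}) (c : A) :
  exists psi' : {linear M -> A^o}, forall x, psi' x = (psi x : A) * c.
Proof.
apply: linear_exists => a x y; rewrite linearP.
have h (b b' : A) : (a * b + b') * c = a * (b * c) + b' * c by rewrite mulrDl mulrA.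
exact: h.
Qed.

(** Here M is the k-dual of P, and [pr] presents tau^-1 P as the cokernel of
    Hom(p1, A) : Hom(P0, A) -> Hom(P1, A). *)
Section Presentation.
Variables (k : fieldType) (A : falgType k).
Variables (s : {rmorphism k -> A}) (sA : {rmorphism k -> A^c}).
Hypothesis sE : forall c, s c = c%:A.
Hypothesis sAE : forall c, sA c = c%:A :> A.
Hypothesis A_fdl : finitely_generated (restr s (A^o : lmodType A)).
Hypothesis A_fdr : finitely_generated (restr sA ((A^c)^o : lmodType A^c)).

Variables (P Q tauP : rmod A) (p e : A) (u : P) (r : Q).
Hypothesis pe1 : p + e = 1.
Hypothesis pAe : forall a, p * a * e = 0.
Hypothesis pA_simple : forall a, p * a <> 0 -> exists b, p * a * b = p.
Hypothesis DP : simple_data p u.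
Hypothesis re : r ◁ e = r.
Hypothesis r_gen : forall x, exists a, x = r ◁ a.
Hypothesis r_rel : forall a, r ◁ a = 0 -> e * a = 0.
Hypothesis u_neq0 : u <> 0.

Variables (M : fgmod A) (beta : M -> P -> k).
Hypothesis D : dual_pairing s sA beta.

Variables (P1 P0 : fgmod A) (p1 : {linear P1 -> P0}) (p0 : {linear P0 -> M}).
Hypothesis p_min : minimal_projective_presentation p1 p0.

Let pe : p * e = 0. Proof. by have := pAe 1; rewrite mulr1. Qed.
Let ee : e * e = e. Proof. by rewrite -[RHS]mul1r -pe1 mulrDl pe add0r. Qed.
Let pp : p * p = p. Proof. by rewrite -[RHS]mulr1 -pe1 mulrDr pe addr0. Qed.
Let pap a : p * a * p = p * a.
Proof. by rewrite -[RHS]mulr1 -pe1 mulrDr pAe addr0. Qed.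

Let P0_proj : projective_module P0. Proof. by case: p_min => -[]. Qed.
Let P1_proj : projective_module P1. Proof. by case: p_min => -[]. Qed.
Let p0_surj : surj p0. Proof. by case: p_min. Qed.
Let p01 : exact_at p1 p0. Proof. by case: p_min. Qed.
Let p0_sup : superfluous_kernel p0. Proof. by case: p_min. Qed.
Let p1_sup : superfluous_kernel p1. Proof. by case: p_min. Qed.

Let lact_pe (N : lmodType A) (x : N) : p *: x + e *: x = x.
Proof. by rewrite -scalerDl pe1 scale1r. Qed.

Lemma dual_simple_e (d : M) : e *: d = 0.
Proof.
apply: (dp_ndr D) => x; rewrite (dp_bal D); have [a ->] := sd_gen DP x.
by rewrite -(sd_up DP) -!ractM ?mulrA pAe ract0r (dp_0r D).
Qed.

(** A form on M that vanishes on A d is evaluation at an element x of P, and if x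
    is nonzero it generates P, so d itself vanishes on P. *)
Lemma dual_simple_transitive (d d' : M) : d <> 0 -> exists a, d' = a *: d.
Proof.
move=> d_neq0.
have Ss : submodule (fun x => exists a, x = a *: d).
  split=> [|b _ _ [a ->] [c ->]]; first by exists 0; rewrite scale0r.
  by exists (b * a + c); rewrite scalerDl scalerA.
have [L [q [qS qE]]] := quotient_module Ss.
apply/qE; apply: contrapT => qd'.
have [n [g [xi gE]]] := dual_basis_exists ((fg_restrP A_fdl L).1 (fgmodP L)).
have [q' q'E] := linear_exists (@restr_linear _ _ s _ _ q).
apply: qd'; rewrite [LHS]gE big1 // => i _.
have [x xE] := dp_exl D (xi i \o q')%FUN.
have x0 : x = 0.
  apply: contrapT => x0; apply: d_neq0; apply: (dp_ndr D) => y.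
  have [a xa] := sd_gen DP x.
  have [b ub] : exists b, u ◁ a ◁ b = u.
    have [|b bE] := pA_simple (a := a).
      by move=> pa; apply: x0; rewrite xa; apply/(sd_rel DP).
    by exists b; rewrite -[u in LHS](sd_up DP) -!ractM mulrA bE (sd_up DP).
  have [c ->] := sd_gen DP y; rewrite -ub -xa -ractM -(dp_bal D) xE /= q'E.
  have -> : q ((b * c) *: d) = 0 by apply/qE; exists (b * c).
  by rewrite linear0.
have := xE d'; rewrite x0 (dp_0r D) /= q'E => <-.
by rewrite scale0r.
Qed.

(** Some coordinate of p x in a dual basis is nonzero, and pA is simple. *)
Lemma projective_functional_at_p (x : P0) : p *: x <> 0 ->
  exists psi : {linear P0 -> A^o}, psi (p *: x) = p /\ forall y, (psi y : A) * p = psi y.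
Proof.
move=> px; have [n [g gS]] := fgmodP P0.
have [psi psiE] := projective_dual_basis P0_proj gS.
have [i pi] : exists i, p * (psi i x : A) <> 0.
  apply: contrapT => none; apply: px; rewrite [LHS]psiE big1 // => i _.
  have -> : psi i (p *: x) = 0 :> A.
    by rewrite linearZ; apply: contrapT => h; apply: none; exists i.
  by rewrite scale0r.
have [b bE] := pA_simple pi.
have [psi' psi'E] := functional_mulr (psi i) (b * p); exists psi'; split=> [|y].
  have psiZ : psi i (p *: x) = p * (psi i x : A) :> A by rewrite linearZ.
  by rewrite psi'E psiZ mulrA bE pp.
by rewrite psi'E -!mulrA pp.
Qed.

(** If p x is nonzero then A p x is a direct summand of P0, and it cannot lie in a
    superfluous kernel. *)
Lemma p_kills_kernel (x : P0) : p0 x = 0 -> p *: x = 0.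
Proof.
move=> x0; apply: contrapT => /projective_functional_at_p[psi [psix psip]].
have psiZ a y : psi (a *: y) = a * (psi y : A) :> A by rewrite linearZ.
have Ss : submodule (fun y => psi y = 0).
  by split=> [|a y z y0 z0]; rewrite ?linear0 // linearP y0 z0 scaler0 addr0.
have : psi (p *: x) = 0.
  apply/asboolP; apply: (p0_sup (submodule_closed Ss)) => y.
  exists (y - (psi y : A) *: (p *: x)), ((psi y : A) *: (p *: x)); split.
  - by apply/asboolP; rewrite linearB psiZ psix psip subrr.
  - by rewrite !linearZ /= x0 !scaler0.
  - by rewrite subrK.
rewrite psix => p_eq0; apply: u_neq0; rewrite -(sd_up DP) p_eq0; exact: ract0r.
Qed.

(** P0 is isomorphic to Ap, with x0 in the role of p. *)
Lemma cyclic_projective_cover : exists (x0 : P0) (psi0 : {linear P0 -> A^o}),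
  [/\ p *: x0 = x0, psi0 x0 = p, forall y, (psi0 y : A) * p = psi0 y
    & forall x, x = (psi0 x : A) *: x0].
Proof.
have [d d_neq0] : exists d : M, d <> 0.
  apply: contrapT => none; apply: u_neq0; apply: (dp_ndl D) => d.
  have -> : d = 0 by apply: contrapT => h; apply: none; exists d.
  by rewrite (dp_0l D).
have [y0 y0d] := p0_surj d.
have p0y : p0 (p *: y0) = d.
  by rewrite linearZ y0d -[RHS]lact_pe dual_simple_e addr0.
have [|psi [psix psip]] := @projective_functional_at_p y0.
  by move=> h; apply: d_neq0; rewrite -p0y h linear0.
have psiZ a y : psi (a *: y) = a * (psi y : A) :> A by rewrite linearZ.
have [x0 [px0 psix0 p0x0]] : exists x0, [/\ p *: x0 = x0, psi x0 = p & p0 x0 = d].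
  by exists (p *: y0); rewrite scalerA pp.
exists x0, psi; split=> //.
have ker z : psi z = 0 -> p0 z = 0.
  move=> z0; have [a aE] := dual_simple_transitive (p0 z) d_neq0.
  have pz : p *: z = (p * a) *: x0.
    apply/eqP; rewrite -subr_eq0 -scalerA -scalerBr; apply/eqP/p_kills_kernel.
    by rewrite linearB linearZ aE p0x0 subrr.
  have pa0 : p * a = 0.
    by have := congr1 psi pz; rewrite !psiZ z0 psix0 mulr0 pap.
  by rewrite -[z]lact_pe pz pa0 scale0r add0r linearZ /= dual_simple_e.
have Ss : submodule (fun x => exists a, x = a *: x0).
  split=> [|b _ _ [a ->] [c ->]]; first by exists 0; rewrite scale0r.
  by exists (b * a + c); rewrite scalerDl scalerA.
move=> x; have [a xa] : exists a, x = a *: x0.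
  apply/asboolP; apply: (p0_sup (submodule_closed Ss)) => y.
  exists ((psi y : A) *: x0), (y - (psi y : A) *: x0); split.
  - by apply/asboolP; exists (psi y).
  - by apply: ker; rewrite linearB psiZ psix0 psip subrr.
  - by rewrite addrC subrK.
by rewrite {2}xa psiZ psix0 -scalerA px0.
Qed.

(** P1 is a direct summand of a power of Ae: as p kills the image of p1, the
    elements e g_i generate P1 modulo the kernel of p1, and this kernel is
    superfluous. *)
Lemma syzygy_dual_basis : exists n (y : 'I_n -> P1) (psi : 'I_n -> {linear P1 -> A^o}),
  [/\ forall i, e *: y i = y i, forall i v, (psi i v : A) * e = psi i v
    & forall v, v = \sum_i (psi i v : A) *: y i].
Proof.
have [n [g gS]] := fgmodP P1; pose y i := e *: g i.
have ye i : e *: y i = y i by rewrite scalerA ee.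
have Ss : submodule (fun v => exists c : 'I_n -> A, v = \sum_i c i *: y i).
  split=> [|a _ _ [b ->] [c ->]].
    by exists (fun=> 0); rewrite big1 // => i _; rewrite scale0r.
  exists (fun i => a * b i + c i); rewrite scaler_sumr -big_split.
  by apply: eq_bigr => i _; rewrite scalerDl scalerA.
have yS v : exists c : 'I_n -> A, v = \sum_i c i *: y i.
  apply/asboolP; apply: (p1_sup (submodule_closed Ss)) => x.
  have [c xE] := gS x; exists (\sum_i c i *: y i), (x - \sum_i c i *: y i); split.
  - by apply/asboolP; exists c.
  - rewrite linearB; apply/eqP; rewrite subr_eq0; apply/eqP.
    rewrite xE !linear_sum; apply: eq_bigr => i _; rewrite /y !linearZ /=.
    rewrite -[p1 (g i) in LHS]lact_pe.
    have -> : p *: p1 (g i) = 0 by apply/p_kills_kernel/p01; exists (g i).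
    by rewrite add0r.
  - by rewrite addrC subrK.
have [psi psiE] := projective_dual_basis P1_proj yS.
have [psi' psi'E] := choice (fun i => functional_mulr (psi i) e).
exists n, y, psi'; split=> // [i v|v]; first by rewrite !psi'E -mulrA ee.
by rewrite [LHS]psiE; apply: eq_bigr => i _; rewrite psi'E -scalerA ye.
Qed.

Hypothesis P_injdim : injdim_eq1 P.
Variable pr : {linear P1 -> A^o} -> tauP.
Hypothesis prL : forall (a : A) (phi1 phi2 phi3 : {linear P1 -> A^o}),
  (forall x, phi3 x = phi1 x * a + phi2 x) ->
  pr phi3 = (a : A^c) *: pr phi1 + pr phi2.
Hypothesis prS : surj pr.
Hypothesis prK : forall phi, pr phi = 0 <->
  exists psi : {linear P0 -> A^o}, forall x, phi x = psi (p1 x).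

Lemma pr_combination n (psi : 'I_n -> {linear P1 -> A^o}) (c : 'I_n -> A)
    (phi : {linear P1 -> A^o}) :
  (forall v, phi v = \sum_i (psi i v : A) * c i) -> pr phi = \sum_i pr (psi i) ◁ c i.
Proof.
elim: n psi c phi => [|n IH] psi c phi phiE.
  rewrite big_ord0; apply/prK; exists \0 => x.
  by rewrite phiE big_ord0.
have L : linear ((fun v => \sum_i (psi (lift ord0 i) v : A) * c (lift ord0 i)) : P1 -> A^o).
  move=> a x y; rewrite scaler_sumr -big_split; apply: eq_bigr => i _ /=.
  have [psi' psi'E] := functional_mulr (psi (lift ord0 i)) (c (lift ord0 i)).
  by rewrite -!psi'E linearP.
have [phi' phi'E] := linear_exists L.
rewrite big_ord_recl -(IH (fun i => psi (lift ord0 i)) (fun i => c (lift ord0 i)) phi') //.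
by apply: prL => v; rewrite phiE big_ord_recl phi'E.
Qed.

(** Since P0 is Ap, the map p1 amounts to the functional psi0 p1 on P1, whose
    values on the generators y form the column w.  As p1 is injective with
    image e P0, it identifies P1 with eAp.  The functionals psi generate
    Hom(P1, A), and their classes in tau^-1 P are the generators nu. *)
Lemma reflection_data_exists : exists n (w : 'cV[A]_n) (eps : 'M[A]_n)
    (nu : 'I_n -> dsum tauP Q),
  reflection_data p e w eps ((0, r) : dsum tauP Q) nu.
Proof.
have [x0 [psi0 [px0 psi0x0 psi0p x0E]]] := cyclic_projective_cover.
have [n [y [psi [ye psie yE]]]] := syzygy_dual_basis.
have p1_inj : injective p1.
  by apply: (injective_presentation_of_injdim1 sE sAE A_fdl A_fdr D) => //; case: P_injdim.
have p1E v : e *: p1 v = p1 v.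
  have h : p *: p1 v = 0 by apply/p_kills_kernel/p01; exists v.
  by rewrite -[RHS]lact_pe h add0r.
have e_im x : exists v, p1 v = e *: x.
  by apply/p01; rewrite linearZ /= dual_simple_e.
have psi0Z a x : psi0 (a *: x) = a * (psi0 x : A) :> A by rewrite linearZ.
have psiZ i a x : psi i (a *: x) = a * (psi i x : A) :> A by rewrite linearZ.
pose w : 'cV[A]_n := \col_i psi0 (p1 (y i)).
pose eps : 'M[A]_n := \matrix_(i, j) psi j (y i).
pose v_of (b : 'rV[A]_n) := \sum_j b ord0 j *: y j.
have v_ofw (b : 'rV[A]_n) : psi0 (p1 (v_of b)) = (b *m w) ord0 ord0 :> A.
  rewrite /v_of !linear_sum mxE; apply: eq_bigr => j _.
  by rewrite mxE linearZ psi0Z.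
have v_ofeps (b : 'rV[A]_n) i : psi i (v_of b) = (b *m eps) ord0 i :> A.
  rewrite /v_of linear_sum mxE; apply: eq_bigr => j _.
  by rewrite mxE psiZ.
have v_of0 b : b *m w = 0 -> v_of b = 0.
  move=> bw; apply: p1_inj; rewrite linear0 [LHS]x0E v_ofw bw mxE.
  by rewrite scale0r.
pose nu j : dsum tauP Q := (pr (psi j), 0).
have nuE m (c : 'M[A]_(n, m)) j : racts nu c j = (\sum_i pr (psi i) ◁ c i j, 0).
  rewrite /racts; elim/big_rec2: _ => // i x z _ ->.
  by apply: injective_projections; rewrite //= scaler0 addr0.
exists n, w, eps, nu; split=> //.
- by move=> j i; rewrite mxE -psi0Z -linearZ ye.
- by move=> j i; rewrite mxE psi0p.
- by move=> i j; rewrite mxE -psiZ ye.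
- by move=> i j; rewrite mxE psie.
- apply/matrixP => i j; rewrite [j]ord1 !mxE [in RHS](yE (y i)) !linear_sum.
  by apply: eq_bigr => h _; rewrite !mxE linearZ psi0Z.
- move=> a; have [v vE] := e_im (a *: x0).
  exists (\row_i psi i v); apply/matrixP => i j; rewrite [i]ord1 [j]ord1.
  rewrite -v_ofw (_ : v_of _ = v); last first.
    by rewrite [RHS]yE; apply: eq_bigr => h _; rewrite mxE.
  by rewrite vE !psi0Z psi0x0 mxE eqxx mulr1n mulrA.
- move=> b bw; apply/rowP => i; rewrite -v_ofeps (v_of0 _ bw).
  by rewrite linear0 mxE.
(* if eAp were zero then p1 would be zero and P injective *)
- apply: contrapT => none.
  have eAp a : e * a * p = 0 by apply: contrapT => h; apply: none; exists a.
  have p10 v : p1 v = 0.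
    rewrite -p1E [p1 v]x0E scalerA -psi0p mulrA eAp.
    by rewrite scale0r.
  case: P_injdim => _; apply.
  exact: (injective_of_zero_presentation sE sAE A_fdl A_fdr D P0_proj p0_surj p01).
- by apply: injective_projections; [exact: ract0l|exact: re].
- move=> j; apply: injective_projections; last exact: ract0l.
  rewrite -[LHS]/(pr (psi j) ◁ e) -[RHS]/(pr (psi j)).
  have := @pr_combination 1 (fun=> psi j) (fun=> e) (psi j).
  by rewrite big_ord1 => <- // v; rewrite big_ord1 psie.
- move=> j; rewrite nuE; congr (_, _).
  rewrite -(pr_combination (phi := psi j)) // => v.
  rewrite {1}[v]yE linear_sum; apply: eq_bigr => i _.
  by rewrite psiZ mxE.
- rewrite nuE; apply: injective_projections => //=.
  rewrite -(pr_combination (phi := (psi0 \o p1)%FUN)) => [|v].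
    by apply/prK; exists psi0.
  rewrite /= {1}[v]yE !linear_sum; apply: eq_bigr => i _.
  by rewrite mxE linearZ psi0Z.
- move=> [x z]; have [phi <-] := prS x; have [a ->] := r_gen z.
  exists a, (\col_i phi (y i)); rewrite nuE.
  apply: injective_projections; last by rewrite /= addr0.
  rewrite /= [X in X + _](ract0l tauP) add0r; apply: pr_combination => v.
  rewrite {1}[v]yE linear_sum; apply: eq_bigr => i _.
  by rewrite mxE linearZ.
- move=> a c; rewrite nuE => E.
  have ra : r ◁ a = 0 by have := congr1 snd E; rewrite /= addr0.
  have nuc : \sum_i pr (psi i) ◁ c i ord0 = 0.
    by have := congr1 fst E; rewrite /= [X in X + _](ract0l tauP) add0r.
  split; first exact: r_rel.
  have L : linear ((fun v => \sum_i (psi i v : A) * c i ord0) : P1 -> A^o).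
    move=> b v z; rewrite scaler_sumr -big_split; apply: eq_bigr => i _ /=.
    have [psi' psi'E] := functional_mulr (psi i) (c i ord0).
    by rewrite -!psi'E linearP.
  have [phi phiE] := linear_exists L.
  have /prK[psi' psi'E] : pr phi = 0 by rewrite (pr_combination phiE).
  exists (psi' x0); apply/matrixP => i j; rewrite [j]ord1 mul_mx_scalar_r !mxE.
  transitivity (phi (y i) : A).
    by rewrite phiE; apply: eq_bigr => h _; rewrite mxE.
  by rewrite psi'E [p1 (y i) in LHS]x0E linearZ.
Qed.

End Presentation.

(** * The posets of torsion classes *)

Lemma tors_closed_poset (k : fieldType) (A : falgType k) :
  poset_iso (tors A) (closed_poset (@hom0 A^c)).
Proof.
have [sA sAE] := opposite_scalars A; have A_fd := falg_opposite_fd sAE.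
pose g (T : tors A) : closed_poset (@hom0 A^c) :=
  ClosedClass (torsion_class_closed (tcP T)).
apply: (@poset_iso_embedding _ _ g) => // -[T cT].
by exists (TorsionClass ((torsion_classP A_fd T).2 cT)); apply: closed_class_eq.
Qed.

Lemma flip_flop_iso (Z1 Z2 W1 W2 : poset) : poset_iso Z1 W1 -> poset_iso Z2 W2 ->
  related_by_flip_flop W1 W2 -> related_by_flip_flop Z1 Z2.
Proof.
move=> i1 i2 [X [Y [f [fm H]]]]; exists X, Y, f, fm.
by case: H => [] [h1 h2]; [left|right]; split; apply: poset_iso_trans; eassumption.
Qed.

Theorem theorem2 (k : fieldType) (Lambda Gamma : falgType k) :
  basic_algebra Lambda -> basic_algebra Gamma ->
  related_by_1APR_tilt Lambda Gamma ->
  related_by_flip_flop (tors Lambda) (tors Gamma).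
Proof.
move=> L_basic _ [P [Q [tauP [[P_simple P_proj] P_injdim L_PQ tauP_def]]]].
case=> phi [phi1 phiM phiL phiI phiS].
case: tauP_def => M [PM [P1 [P0 [p1 [p0 [p_min [pr [prL prS prK]]]]]]]].
have [sA sAE] := opposite_scalars Lambda; have A_fdr := falg_opposite_fd sAE.
have [s [sE A_fdl]] := falg_fd Lambda.
have [sG sGE] := opposite_scalars Gamma.
have [p [e [u [r [pe1 pAe pA_simple DP [re r_gen r_rel]]]]]] :=
  simple_projective_data A_fdr L_basic P_simple P_proj L_PQ.
have u_neq0 : u <> 0.
  by move=> u0; apply: P_simple.1 => x; have [a ->] := sd_gen DP x; rewrite u0 ract0l.
have [beta D] := is_dual_pairing sE sAE A_fdr PM.
have [n [w [eps [nu RD]]]] := reflection_data_exists sE sAE A_fdl A_fdr pe1 pAe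
  pA_simple DP re r_gen r_rel u_neq0 D p_min P_injdim prL prS prK.
have [f [q fqP]] := splitting_idempotents_exist RD phiS.
have TD := endo_triangular RD phi1 phiM phiL phiI phiS fqP.
have [S [s0 DS]] := simple_top_exists TD.
apply: flip_flop_iso (tors_closed_poset _) (tors_closed_poset _) _.
exact: (flip_flop_closed_classes RD phi1 phiM phiL phiI phiS fqP sAE sGE DP DS).
Qed.
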